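(* Let $n\ge 3$, let $(M,g)=(\mathbb R^n,g_0)$ be Euclidean space with its spinor bundle $\Sigma$, and let $N\subset\mathbb R^K$ be a compact Riemannian manifold without boundary. Suppose $(\phi,\psi)\in H^1_{\mathrm{loc}}(\mathbb R^n,N)\times S^{1,\frac43}_{\mathrm{loc}}(\Gamma(\Sigma\otimes\phi^*TN))$ is a stationary Dirac-harmonic map satisfying $$\int_{\mathbb R^n}\left(|\nabla\phi|^2+|\nabla\psi|^{\frac43}+|\psi|^4\right)<+\infty.$$ Then $\phi$ is constant and $\psi\equiv 0$.
   Context: Notation. $g_0$ is the Euclidean metric; $\Sigma=\mathbb R^n\times\mathbb C^L$, $L=\mathrm{rank}_{\mathbb C}\Sigma$, is the (trivial) spinor bundle with its standard Hermitian metric $\langle\cdot,\cdot\rangle$, flat connection, and Clifford multiplication $X\circ\psi$, which is skew-symmetric: $\langle X\circ\psi,\xi\rangle=-\langle\psi,X\circ\xi\rangle$. The usual Dirac operator is $\partial\!\!\!/=\frac{\partial}{\partial x_\alpha}\circ\nabla_{\frac{\partial}{\partial x_\alpha}}$. Repeated indices are summed. $N$ is isometrically embedded in $\mathbb R^K$. Sobolev spaces. $H^1_{\mathrm{loc}}(\mathbb R^n,N)$ is the set of $u\in H^1_{\mathrm{loc}}(\mathbb R^n,\mathbb R^K)$ with $u(x)\in N$ a.e. A section $\psi$ of $\Sigma\otimes\phi^*TN$ is a $K$-tuple $\psi=(\psi^1,\dots,\psi^K)$ of sections of $\Sigma$ with $\sum_{i=1}^K\nu_i\psi^i(x)=0$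 for a.e. $x$ and all $\nu\in (T_{\phi(x)}N)^\perp$; $\psi\in S^{1,\frac43}_{\mathrm{loc}}$ means in addition $d\psi^i\in L^{4/3}_{\mathrm{loc}}$ and $\psi^i\in L^4_{\mathrm{loc}}$ for all $i$. Dirac operator along $\phi$. $D\!\!\!\!/\,\psi=\frac{\partial}{\partial x_\alpha}\circ\overline\nabla_{\frac{\partial}{\partial x_\alpha}}\psi$, with $\overline\nabla$ the connection on $\Sigma\otimes\phi^*TN$ induced by the connection of $\Sigma$ and $\nabla^{\phi^*TN}$. Weakly and stationary Dirac-harmonic maps. Let $L(\phi,\psi)=\int\left[|\nabla\phi|^2+\langle\psi,D\!\!\!\!/\,\psi\rangle\right]dx$. The pair $(\phi,\psi)$ is weakly Dirac-harmonic if it is a critical point of $L$ (with respect to compactly supported variations in the Sobolev space $H^1_{\mathrm{loc}}(\mathbb R^n,N)\times S^{1,\frac43}_{\mathrm{loc}}(\Gamma(\Sigma\otimes\phi^*TN))$); equivalently, it is a weak solution of $\tau(\phi)=\mathcal R^N(\phi,\psi)$, $D\!\!\!\!/\,\psi=0$, where $\tau(\phi)$ is the tension field and, in local coordinates $y$ on $N$ with $\psi=\psi^i\otimes\frac{\partial}{\partial y_i}(\phi)$, $\mathcal R^N(\phi,\psi)=\frac12 R^m_{lij}(\phi)\langle\psi^i,\nabla\phi^l\circ\psi^j\rangle\frac{\partial}{\partial y_m}(\phi)$, with $R(\partial_i,\partial_j)\partial_l=R^m_{lij}\partial_m$, $R(X,Y)=[\nabla_X,\nabla_Y]-\nabla_{[X,Y]}$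 the curvature of $N$. It is stationary if, in addition, it is critical with respect to domain variations: for every $Y\in C_0^\infty(\mathbb R^n,\mathbb R^n)$, $$\frac{d}{dt}\Big|_{t=0}\int\left(|\nabla\phi_t|^2+\langle\psi_t,D\!\!\!\!/\,\psi_t\rangle\right)=0,\quad \phi_t(x)=\phi(x+tY(x)),\ \psi_t(x)=\psi(x+tY(x)).$$ *)

(* Defs.v *)
From HB Require Import structures.
From mathcomp Require Import all_boot all_order all_algebra.
From mathcomp Require Import all_classical all_reals all_analysis.
From mathcomp Require Import complex.

Set Implicit Arguments.
Unset Strict Implicit.
Unset Printing Implicit Defensive.

Import Order.TTheory GRing.Theory Num.Theory.
Import numFieldNormedType.Exports.

Local Open Scope classical_set_scope.
Local Open Scope ring_scope.

(* The product sigma-algebra, generated by the entries: on 'rV[R]_n, the Borel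
   sigma-algebra. *)
Definition mx_display : measure_display -> measure_display.
Proof. exact. Qed.

Section measurable_matrix.
Context d (T : measurableType d) (m n : nat).

Definition mx_coord_sets : set (set 'M[T]_(m, n)) :=
  \bigcup_(ij in [set: 'I_m * 'I_n])
    preimage_set_system setT (fun M : 'M[T]_(m, n) => M ij.1 ij.2) measurable.

Let mx0 : <<s mx_coord_sets >> set0.
Proof. exact: sigma_algebra0. Qed.

Let mxC A : <<s mx_coord_sets >> A -> <<s mx_coord_sets >> (~` A).
Proof. by move=> mA; rewrite -setTD; exact: sigma_algebraCD. Qed.

Let mxU (F : (set 'M[T]_(m, n))^nat) : (forall i, <<s mx_coord_sets >> (F i)) ->
  <<s mx_coord_sets >> (\bigcup_i F i).
Proof. exact: sigma_algebra_bigcup. Qed.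

HB.instance Definition _ := @isMeasurable.Build (mx_display d) 'M[T]_(m, n)
  <<s mx_coord_sets >> mx0 mxC mxU.

End measurable_matrix.
Lemma measurable_mx_coord d (T : measurableType d) m n i j :
  measurable_fun setT (fun M : 'M[T]_(m, n) => M i j).
Proof.
move=> _ A mA; rewrite setTI; apply: sub_sigma_algebra.
by exists (i, j) => //; exists A => //; rewrite setTI.
Qed.

Lemma measurable_mxP d d' (X : measurableType d') (T : measurableType d) m n
    (f : X -> 'M[T]_(m, n)) :
  (forall i j, measurable_fun setT (fun x => f x i j)) -> measurable_fun setT f.
Proof.
move=> mf; apply: (measurability (@mx_coord_sets _ T m n)) => //.
move=> _ [_ [[i j] _ [B mB <-]] <-]; rewrite setTI /=.
by rewrite setTI; have := mf i j measurableT _ mB; rewrite setTI.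
Qed.

(* Lebesgue measure on R^n, by slicing off the first coordinate. *)
Fixpoint lebesgue_rV (R : realType) (n : nat) : set 'rV[R]_n -> \bar R :=
  match n with
  | 0 => fun A => \d_(0 : 'rV[R]_0) A
  | n'.+1 => fun A =>
      (\int[@lebesgue_measure R]_x
         lebesgue_rV [set v : 'rV[R]_n' | A (row_mx x%:M v)])%E
  end.

Lemma product_measure1_sigma_finite (R : realType) d1 d2
    (T1 : measurableType d1) (T2 : measurableType d2)
    (m1 : {sigma_finite_measure set T1 -> \bar R})
    (m2 : {sigma_finite_measure set T2 -> \bar R}) :
  sigma_finite setT (m1 \x m2)%E.
Proof.
have /sigma_finiteP[F [TF ndF Foo]] := sigma_finiteT m1.
have /sigma_finiteP[G [TG ndG Goo]] := sigma_finiteT m2.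
exists (fun i => F i `*` G i).
  rewrite -setXTT TF TG predeqE => -[x y]; split.
    move=> [/= [i _ Fix] [k _ Gky]]; exists (maxn i k) => //; split.
    - by move: x Fix; exact/subsetPset/ndF/leq_maxl.
    - by move: y Gky; exact/subsetPset/ndG/leq_maxr.
  by move=> [i _ []/= ? ?]; split; exists i.
move=> k; have [? ?] := Foo k; have [? ?] := Goo k.
split; first exact: measurableX.
by rewrite product_measure1E// lte_mul_pinfty// ge0_fin_numE.
Qed.

Section lebesgue_rV.
Variable R : realType.

Let cons_rV n (p : R * 'rV[R]_n) : 'rV[R]_n.+1 := row_mx (p.1)%:M p.2.
Let uncons_rV n (v : 'rV[R]_(1 + n)) : R * 'rV[R]_n := (v 0 0, rsubmx v).

Let measurable_cons_rV n : measurable_fun setT (@cons_rV n).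
Proof.
apply: measurable_mxP => i j.
rewrite /cons_rV; case: (@split_ordP 1 n j) => k ->.
  under eq_fun do rewrite (@row_mxEl _ _ 1) !ord1 mxE mulr1n.
  exact: measurable_fst.
under eq_fun do rewrite (@row_mxEr _ _ 1).
exact: (measurableT_comp (measurable_mx_coord _ _) measurable_snd).
Qed.

Let measurable_uncons_rV n : measurable_fun setT (@uncons_rV n).
Proof.
apply: measurable_fun_pair; first exact: measurable_mx_coord.
apply: measurable_mxP => i j; under eq_fun do rewrite mxE.
exact: measurable_mx_coord.
Qed.

Let cons_rVK n : cancel (@cons_rV n) (@uncons_rV n).
Proof.
case=> x v; rewrite /cons_rV /uncons_rV row_mxKr; congr (_, _).
have -> : (0 : 'I_(1 + n)) = lshift n 0 by apply: val_inj.
by rewrite row_mxEl mxE mulr1n.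
Qed.

Let uncons_rVK n : cancel (@uncons_rV n) (@cons_rV n).
Proof.
move=> v; rewrite /cons_rV /uncons_rV -[RHS]hsubmxK; congr row_mx.
apply/rowP => i; rewrite ord1 !mxE mulr1n; congr (v _ _); exact: val_inj.
Qed.

Lemma lebesgue_rVE n :
  exists m : {sigma_finite_measure set 'rV[R]_n -> \bar R},
    m = @lebesgue_rV R n :> (set _ -> _).
Proof.
elim: n => [|n [m mE]].
  by exists (\d_(0 : 'rV[R]_0)).
pose lam : {sigma_finite_measure set (measurableTypeR R) -> \bar R} :=
  @lebesgue_measure R.
pose p : {measure set (measurableTypeR R * 'rV[R]_n)%type -> \bar R} :=
  (lam \x m)%E.
have mc : @measurable_fun _ _ (measurableTypeR R * 'rV[R]_n)%type _ setT
    (@cons_rV n) by exact: measurable_cons_rV.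
pose q : set 'rV[R]_n.+1 -> \bar R := fun A => p (@cons_rV n @^-1` A).
have mpre A : measurable A -> measurable (@cons_rV n @^-1` A).
  by move=> mA; rewrite -[X in measurable X]setTI; exact: mc.
have q0 : q set0 = 0%E by rewrite /q preimage_set0 measure0.
have q_ge0 A : (0 <= q A)%E by exact: measure_ge0.
have q_sadd : semi_sigma_additive q.
  move=> F mF tF mUF; rewrite /q preimage_bigcup.
  apply: (@measure_semi_sigma_additive _ _ _ p) => //.
  - by move=> i; exact: mpre.
  - apply/trivIsetP => i j _ _ ij; rewrite -preimage_setI.
    by move/trivIsetP : tF => /(_ _ _ _ _ ij) -> //; rewrite preimage_set0.
  - by rewrite -preimage_bigcup; exact: mpre.
have q_sf : sigma_finite setT q.
  have [F FT Ffin] := product_measure1_sigma_finite lam m.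
  exists (fun i => @uncons_rV n @^-1` F i).
    by rewrite -preimage_bigcup -FT preimage_setT.
  move=> i; have [mF pF] := Ffin i; split.
    by rewrite -[X in measurable X]setTI; exact: measurable_uncons_rV.
  rewrite /q -comp_preimage.
  suff -> : @uncons_rV n \o @cons_rV n = id by rewrite preimage_id.
  by apply/funext => x; exact: cons_rVK.
pose Qm := HB.pack_for {measure set 'rV[R]_n.+1 -> \bar R} q
  (isMeasure.Build _ _ _ q q0 q_ge0 q_sadd).
pose q_sfin := @sfinite_measure_sigma_finite _ _ _ Qm q_sf.
pose Q := HB.pack_for {sigma_finite_measure set 'rV[R]_n.+1 -> \bar R} q
  (isMeasure.Build _ _ _ q q0 q_ge0 q_sadd)
  (isSFinite.Build _ _ _ q q_sfin) (isSigmaFinite.Build _ _ _ q q_sf).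
exists Q; apply/funext => A /=.
rewrite /q /p /product_measure1 /= -mE.
apply: eq_integral => x _; congr (m _).
by apply/seteqP; split => v /=; rewrite /xsection /= inE.
Qed.

Let lebesgue_rV0 n : @lebesgue_rV R n set0 = 0%E.
Proof. by have [m <-] := lebesgue_rVE n; exact: measure0. Qed.

Let lebesgue_rV_ge0 n A : (0 <= @lebesgue_rV R n A)%E.
Proof. by have [m <-] := lebesgue_rVE n; exact: measure_ge0. Qed.

Let lebesgue_rV_sigma_additive n : semi_sigma_additive (@lebesgue_rV R n).
Proof.
by have [m <-] := lebesgue_rVE n; exact: measure_semi_sigma_additive.
Qed.

HB.instance Definition _ n := isMeasure.Build _ _ _ (@lebesgue_rV R n)
  (lebesgue_rV0 n) (@lebesgue_rV_ge0 n) (@lebesgue_rV_sigma_additive n).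

Let lebesgue_rV_sigma_finite n : sigma_finite setT (@lebesgue_rV R n).
Proof. by have [m <-] := lebesgue_rVE n; exact: sigma_finiteT. Qed.

HB.instance Definition _ n := Measure_isSigmaFinite.Build _ _ _
  (@lebesgue_rV R n) (@lebesgue_rV_sigma_finite n).

Lemma lebesgue_rV_box n (A : 'I_n -> set R) :
  (forall i, measurable (A i)) ->
  lebesgue_rV [set v : 'rV[R]_n | forall i, A i (v 0 i)] =
    (\prod_(i < n) @lebesgue_measure R (A i))%E.
Proof.
elim: n => [|n IH] in A *; move=> mA.
  rewrite big_ord0 /= diracE mem_set // => -[] //.
rewrite big_ord_recl /=.
transitivity (\int[@lebesgue_measure R]_x ((\1_(A ord0) x)%:E *
    lebesgue_rV [set v : 'rV[R]_n | forall i, A (lift ord0 i) (v ord0 i)]))%E.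
  apply: eq_integral => x _.
  have E0 (v : 'rV[R]_n) : (row_mx x%:M v : 'rV_(1 + n)) 0 (lshift n 0) = x.
    by rewrite row_mxEl mxE mulr1n.
  have l0 : lshift n (0 : 'I_1) = ord0 by exact: val_inj.
  have lS (i : 'I_n) : rshift 1 i = lift ord0 i by exact: val_inj.
  rewrite indicE; have [/set_mem A0|/negP A0] := boolP (x \in A ord0);
    last first.
    rewrite mul0e; apply: etrans (lebesgue_rV0 n); congr lebesgue_rV.
    apply/seteqP; split => v //= H; apply: A0; apply: mem_set.
    by have := H ord0; rewrite -l0 E0.
  rewrite mul1e; congr lebesgue_rV; apply/seteqP; split => v /= H i.
    by have := H (lift ord0 i); rewrite -lS (@row_mxEr _ 1 1).
  case: (@split_ordP 1 n i) => k ->; first by rewrite ord1 E0 l0.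
  by rewrite (@row_mxEr _ 1 1) lS; exact: H.
rewrite ge0_integralZr//; last first.
  apply/measurable_realfun.measurable_EFinP.
  exact: measurable_realfun.measurable_indic (mA _).
congr (_ * _)%E; last by apply: (IH (fun i => A (lift ord0 i))) => i; exact: mA.
rewrite integral_indic//; last exact: mA.
by congr lebesgue_measure; rewrite setIT.
Qed.

End lebesgue_rV.

Section calculus.
Context {R : realType}.

Fixpoint iter_derive {V W : normedModType R} (vs : seq V) (f : V -> W) :
    V -> W :=
  if vs is v :: vs' then 'D_v (iter_derive vs' f) else f.

(* C^infinity on an open subset U of a finite-dimensional space. *)
Definition smooth_on {V W : normedModType R} (U : set V) (f : V -> W) :=
  forall (vs : seq V) (x : V), U x ->
    {for x, continuous (iter_derive vs f)} /\
    forall v, derivable (iter_derive vs f) x v.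

Definition supported_in {T : Type} {W : zmodType} (D : set T) (f : T -> W) :=
  forall x, ~ D x -> f x = 0.

(* C_0^infinity(R^n, W) *)
Definition test_function {n} {W : normedModType R} (f : 'rV[R]_n -> W) :=
  smooth_on setT f /\ exists2 D, compact D & supported_in D f.

End calculus.

Section submanifolds.
Context {R : realType} {K : nat}.
Implicit Types (N : set 'rV[R]_K) (p v nu : 'rV[R]_K).

(* Smooth (C^infinity) embedded d-dimensional submanifolds without boundary of
   R^K, as local zero sets of submersions. *)
Definition submanifold (d : nat) N :=
  (d <= K)%N /\
  forall p, N p -> exists (U : set 'rV[R]_K) (F : 'rV[R]_K -> 'rV[R]_(K - d)),
    [/\ open U, U p, smooth_on U F,
        forall q, U q -> forall w, exists v, 'D_v F q = w
      & N `&` U = [set q | U q /\ F q = 0]].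

Definition tangent N p : set 'rV[R]_K :=
  [set v | exists (e : R) (c : R -> 'rV[R]_K),
    [/\ 0 < e, smooth_on [set t | - e < t < e] c,
        forall t, - e < t < e -> N (c t), c 0 = p & 'D_1 c 0 = v]].

Definition normal N p : set 'rV[R]_K :=
  [set nu | forall v, tangent N p v -> nu *m v^T = 0].

Definition is_tangent_proj N p (P : 'M[R]_K) :=
  [/\ P^T = P, P *m P = P & forall v, tangent N p v <-> v *m P = v].

(* The orthogonal projection of R^K onto T_pN (acting on row vectors), for p
   in N; 0 when there is none. *)
Definition tangent_proj N p : 'M[R]_K := xget 0 (is_tangent_proj N p).

End submanifolds.

Section sobolev.
Context {R : realType} {n : nat}.
Local Notation Rn := 'rV[R]_n.
Local Notation mu := (@lebesgue_rV R n).
Implicit Types (f g : Rn -> R) (a : 'I_n).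

(* Elements of L^p_loc are represented by Borel functions; nothing below depends
   on the choice of the representative. *)
Definition Lploc (p : R) f :=
  measurable_fun setT f /\
  forall D, compact D -> (\int[mu]_(x in D) (`|f x| `^ p)%:E < +oo)%E.

Definition is_wderiv a f g :=
  [/\ Lploc 1 f, Lploc 1 g &
      forall zeta : Rn -> R, test_function zeta ->
        \int[mu]_x (f x * 'D_(delta_mx 0 a) zeta x) =
        - \int[mu]_x (g x * zeta x)].

(* A version of the weak derivative; 0 if f has none. *)
Definition wderiv a f : Rn -> R := xget (cst 0) (is_wderiv a f).

Definition sobolev_loc (q p : R) f :=
  Lploc q f /\ forall a, exists2 g, is_wderiv a f g & Lploc p g.

(* The curve u in the space of functions with L^q values and L^p weak
   derivatives has derivative u' at time 0, in the norm of that space over R^n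
   (the increments u t - u 0 are meant to have compact support). *)
Definition sobolev_derivable (q p : R) (u : R -> Rn -> R) (u' : Rn -> R) :=
  [/\ sobolev_loc q p u',
      (\int[mu]_x (`|(u t x - u 0 x) / t - u' x| `^ q)%:E)%E @[t --> 0^']
        --> 0%E
    & forall a,
      (\int[mu]_x (`|(wderiv a (u t) x - wderiv a (u 0) x) / t
                     - wderiv a u' x| `^ p)%:E)%E @[t --> 0^'] --> 0%E].

End sobolev.

Section dirac_harmonic.
Context {R : realType} {n K L : nat}.
Local Notation Rn := 'rV[R]_n.
Local Notation RK := 'rV[R]_K.
Local Notation C := R[i].
Local Notation Re := complex.Re.
Local Notation Im := complex.Im.
Local Notation mu := (@lebesgue_rV R n).

(* [spinor] is the fibre of Sigma (x) R^K: the i-th column of psi is the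
   component psi^i in C^L.  Clifford multiplication by d/dx_a is
   left multiplication by E a; endomorphisms of R^K act on the right. *)
Local Notation spinor := 'M[C]_(L, K).

Implicit Types (E : 'I_n -> 'M[C]_L) (N : set RK) (phi : Rn -> RK)
  (psi : Rn -> spinor) (D : set Rn).

Definition herm {m} (u v : 'M[C]_(L, m)) : C :=
  \sum_s \sum_i u s i * conjc (v s i).

Definition clifford_mul E (X : Rn) {m} (u : 'M[C]_(L, m)) : 'M[C]_(L, m) :=
  \sum_a (X 0 a)%:C%C *: (E a *m u).

Record clifford_module E : Prop := {
  clifford_relation : forall (X Y : Rn) (u : 'cV[C]_L),
    clifford_mul E X (clifford_mul E Y u) +
    clifford_mul E Y (clifford_mul E X u) =
    (- 2 * \sum_a X 0 a * Y 0 a)%:C%C *: u ;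
  clifford_skew : forall (X : Rn) (u v : 'cV[C]_L),
    herm (clifford_mul E X u) v = - herm u (clifford_mul E X v) }.

Definition complexify {m k} (A : 'M[R]_(m, k)) : 'M[C]_(m, k) :=
  map_mx (fun x : R => x%:C%C) A.

Definition H1loc N phi :=
  (forall i, sobolev_loc 2 2 (fun x => phi x 0 i)) /\
  {ae mu, forall x, N (phi x)}.

Definition S14loc N phi psi :=
  (forall s i, sobolev_loc 4 (4 / 3) (fun x => Re (psi x s i)) /\
               sobolev_loc 4 (4 / 3) (fun x => Im (psi x s i))) /\
  {ae mu, forall x, forall nu, normal N (phi x) nu ->
    psi x *m (complexify nu)^T = 0}.

Definition map_deriv (a : 'I_n) phi (x : Rn) : RK :=
  \row_i wderiv a (fun y => phi y 0 i) x.

Definition spinor_deriv (a : 'I_n) psi (x : Rn) : spinor :=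
  \matrix_(s, i) (wderiv a (fun y => Re (psi y s i)) x +i*
                  wderiv a (fun y => Im (psi y s i)) x)%C.

(* The connection on Sigma (x) phi^*TN: the Levi-Civita connection of a
   submanifold is the tangential part of the flat derivative. *)
Definition spinor_nabla N (a : 'I_n) phi psi (x : Rn) : spinor :=
  spinor_deriv a psi x *m complexify (tangent_proj N (phi x)).

Definition dirac E N phi psi (x : Rn) : spinor :=
  \sum_a clifford_mul E (delta_mx 0 a) (spinor_nabla N a phi psi x).

Definition map_energy phi (x : Rn) : R :=
  \sum_a \sum_i (map_deriv a phi x 0 i) ^+ 2.

Definition spinor_norm (u : spinor) : R := Num.sqrt (Re (herm u u)).

Definition spinor_deriv_norm psi (x : Rn) : R :=
  Num.sqrt (\sum_a spinor_norm (spinor_deriv a psi x) ^+ 2).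

(* The functional L, localized to D.  Its density is real up to half the
   divergence of the field with a-th component <psi, d/dx_a o psi>, which no
   compactly supported variation sees; hence the real part. *)
Definition lagrangian E N D phi psi : R :=
  \int[mu]_(x in D)
    (map_energy phi x + Re (herm (psi x) (dirac E N phi psi x))).

(* A compactly supported curve (phit t, psit t) through (phi, psi) in
   H^1_loc(R^n, N) x S^{1,4/3}_loc, differentiable at t = 0 for the norms of
   H^1(R^n, R^K) and of L^4 with derivatives in L^{4/3}.  The functional L is
   differentiable along such curves because psit t is tangential: the
   projection in the Dirac operator can be dropped in the pairing with it. *)
Record variation N phi psi D (phit : R -> Rn -> RK) (psit : R -> Rn -> spinor)
    : Prop := {
  variation_space : \forall t \near (0 : R),
    H1loc N (phit t) /\ S14loc N (phit t) (psit t) ;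
  variation_map0 : phit 0 = phi ;
  variation_spinor0 : psit 0 = psi ;
  variation_compact : compact D ;
  variation_support : forall t x, ~ D x ->
    phit t x = phi x /\ psit t x = psi x ;
  variation_map_derivable : forall i, exists phi' : Rn -> R,
    sobolev_derivable 2 2 (fun t x => phit t x 0 i) phi' ;
  variation_spinor_derivable : forall s i, exists psi' psi'' : Rn -> R,
    sobolev_derivable 4 (4 / 3) (fun t x => Re (psit t x s i)) psi' /\
    sobolev_derivable 4 (4 / 3) (fun t x => Im (psit t x s i)) psi'' }.

Definition weakly_dirac_harmonic E N phi psi :=
  [/\ H1loc N phi, S14loc N phi psi &
      forall D phit psit, variation N phi psi D phit psit ->
        is_derive (0 : R) 1
          (fun t => lagrangian E N D (phit t) (psit t)) 0].

Definition stationary_dirac_harmonic E N phi psi :=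
  weakly_dirac_harmonic E N phi psi /\
  forall (Y : Rn -> Rn) D, test_function Y -> compact D -> supported_in D Y ->
    is_derive (0 : R) 1
      (fun t => lagrangian E N D (fun x => phi (x + t *: Y x))
                                 (fun x => psi (x + t *: Y x))) 0.

Definition finite_energy phi psi :=
  (\int[mu]_x (map_energy phi x + spinor_deriv_norm psi x `^ (4 / 3)
               + spinor_norm (psi x) ^+ 4)%:E < +oo)%E.

End dirac_harmonic.

(* Main.v *)
From HB Require Import structures.
From mathcomp Require Import all_boot all_order all_algebra.
From mathcomp Require Import all_classical all_reals all_analysis.
From mathcomp Require Import measurable_realfun.
From mathcomp Require Import complex ring lra.
Require Import Defs.

Set Implicit Arguments.
Unset Strict Implicit.
Unset Printing Implicit Defensive.

Import Order.TTheory GRing.Theory Num.Theory.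
Import numFieldNormedType.Exports.

Local Open Scope classical_set_scope.
Local Open Scope ring_scope.

(** The two criticality conditions are tested against explicit variations, and
    everything else follows from integrability on the whole space.

    Scaling the spinor field, psi + t eta psi, is a vertical variation.  The
    derivatives of the cut-off eta enter it only through the real part of
    <psi, grad eta o psi>, which vanishes since Clifford multiplication is skew.
    So the integral of eta Re <psi, D psi> is zero for all eta, and the spinor
    part of the functional vanishes ([energy_identity]).

    The domain variations along x_b eta(x/r) e_b, summed over b, localize the
    dilation field.  In the resulting identity ([virial_identity]) the terms with
    a derivative of eta live at distance of order r from the origin and
    disappear as r grows, because the densities are integrable.  With e the
    Dirichlet energy and s the spinor part of the functional there remains
    2 e + s = n (e + s).  As s = 0, this is (n - 2) e = 0, whence e = 0 for
    n >= 3 ([energy_zero]), and phi is a constant c.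

    Over a constant map the equation for psi is the flat Dirac equation in
    Sigma (x) T_c N.  Testing it with the first derivatives of a test function and
    using the Clifford relations shows that all components of psi are weakly
    harmonic ([spinor_weakly_harmonic]).  They belong to L^4, hence vanish by
    Liouville's theorem: mollify, and apply Caccioppoli's estimate for u^2 on
    balls of growing radius ([liouville_L4]).

    Three points make these variations accessible.  First, tangent vectors are
    velocities of curves, so the existence of the tangential projection rests on
    an implicit function theorem ([tangent_projP]); as psi is tangential, the
    projection disappears from the pairing of psi with its Dirac operator, and the
    density only involves flat weak derivatives ([lagrangianE]).  Secondly, the
    vertical variations are affine in t, so that the functional is a quadratic
    polynomial along them ([weak_equation]).  Thirdly, the field x_b eta e_b has one
    component, so that its variation is a shear x + t y(x) e_b; for shears the
    change of variables reduces to lines parallel to e_b ([shear_measure]) and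
    the chain rule for weak derivatives follows by mollification
    ([is_wderiv_shear]). *)

(** * Borel sets and measures on coordinate space *)

Section boxes.
Context {R : realType}.

Definition open_box n (a b : 'rV[R]_n) : set 'rV[R]_n :=
  [set v | forall i, a 0 i < v 0 i < b 0 i].

Lemma measurable_coord_box n (A : 'I_n -> set R) :
  (forall i, measurable (A i)) ->
  measurable [set v : 'rV[R]_n | forall i, A i (v 0 i)].
Proof.
move=> mA.
rewrite (_ : [set v | _] =
    ~` \bigcup_(i : 'I_n) ~` ((fun v : 'rV[R]_n => v 0 i) @^-1` A i)).
  apply: measurableC; apply: countable_bigcupT_measurable => [|i].
    exact: countableP.
  apply: measurableC.
  by have := @measurable_mx_coord _ R 1 n 0 i measurableT _ (mA i); rewrite setTI.
rewrite setC_bigcup; apply/seteqP; split=> v /= h i.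
  by move=> _ nA; exact: nA (h i).
exact: contrapT (h i I).
Qed.

Lemma open_boxE n (a b : 'rV[R]_n) : open_box a b =
  [set v | forall i, `]a 0 i, b 0 i[%classic (v 0 i)].
Proof. by apply/seteqP; split=> v /= h i; have := h i; rewrite in_itv. Qed.

Lemma measurable_open_box n (a b : 'rV[R]_n) : measurable (open_box a b).
Proof.
rewrite open_boxE.
by apply: (measurable_coord_box (A := fun i => `]a 0 i, b 0 i[%classic)) => i.
Qed.

Lemma lebesgue_open_box_lty n (a b : 'rV[R]_n) :
  (lebesgue_rV (open_box a b) < +oo)%E.
Proof.
rewrite open_boxE (lebesgue_rV_box (A := fun i => `]a 0 i, b 0 i[%classic))//.
rewrite (eq_bigr (fun i => (Num.max 0 (b 0 i - a 0 i))%:E)) => [|i _].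
  by rewrite prodEFin ltry.
rewrite lebesgue_measure_itv /= lte_fin; case: ltP => ab.
  by rewrite -EFinD max_r// subr_ge0 ltW.
by rewrite max_l// subr_le0.
Qed.

(** Rational boxes are countably many, which turns an open set into a countable
    union of boxes. *)
Lemma open_box_open n (x : 'rV[R]_n) (U : set 'rV[R]_n) : open U -> U x ->
  exists a b : 'rV[rat]_n, open_box (map_mx ratr a) (map_mx ratr b) x /\
    open_box (map_mx ratr a) (map_mx ratr b) `<=` U.
Proof.
move=> oU Ux.
have /nbhs_ballP[e /= e0 xeU] : nbhs x U by exact: open_nbhs_nbhs.
have ra i : exists q : rat, ratr q \in `]x 0 i - e, x 0 i[.
  by apply: rat_in_itvoo; rewrite ltrBlDr ltrDl.
have rb i : exists q : rat, ratr q \in `]x 0 i, x 0 i + e[.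
  by apply: rat_in_itvoo; rewrite ltrDl.
have [a ha] := choice ra; have [b hb] := choice rb.
exists (\row_i a i), (\row_i b i); split=> [i|v vab].
  rewrite !mxE; have := ha i; have := hb i.
  by rewrite !in_itv /= => /andP[-> _] /andP[_ ->].
apply: xeU; split=> // i j; rewrite ord1.
have := vab j; have := ha j; have := hb j; rewrite !mxE !in_itv /=.
rewrite /ball /= => /andP[h1 h2] /andP[h3 h4] /andP[h5 h6].
rewrite ltr_norml; apply/andP; split; lra.
Qed.

Lemma open_measurable_rV n (U : set 'rV[R]_n) : open U -> measurable U.
Proof.
move=> oU.
pose B (p : 'rV[rat]_n * 'rV[rat]_n) : set 'rV[R]_n :=
  open_box (map_mx ratr p.1) (map_mx ratr p.2).
rewrite (_ : U = \bigcup_p (if `[<B p `<=` U>] then B p else set0)).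
  apply: countable_bigcupT_measurable => [|p]; first exact: countableP.
  by case: ifP => _ //; exact: measurable_open_box.
apply/seteqP; split=> [x Ux|x [p _]].
  have [a [b [xab abU]]] := open_box_open oU Ux.
  by exists (a, b) => //; rewrite ifT//; exact/asboolP.
by case: ifPn => // /asboolP; apply.
Qed.

Lemma closed_measurable_rV n (U : set 'rV[R]_n) : closed U -> measurable U.
Proof.
move=> cU; rewrite -[U]setCK; apply: measurableC; apply: open_measurable_rV.
exact: closed_openC.
Qed.

Lemma continuous_measurable_rV n (f : 'rV[R]_n -> R) :
  continuous f -> measurable_fun setT f.
Proof.
move=> cf; apply: (measurability _ (RGenOpens.measurableE R)).
move=> _ [_ [a [b ->] <-]]; rewrite setTI; apply: open_measurable_rV.
by apply: open_comp => [x _|]; [exact: cf|exact: interval_open].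
Qed.

Lemma compact_measurable_rV n (D : set 'rV[R]_n) : compact D -> measurable D.
Proof.
by move=> cD; apply: closed_measurable_rV; apply: compact_closed.
Qed.

(** The Borel structure is generated by the half-spaces v_j > x; each of them is
    the union of an increasing sequence of boxes. *)
Lemma sigma_open_box n :
  (@measurable _ 'rV[R]_n) = <<s range (fun p => open_box p.1 p.2) >>.
Proof.
set G := range _.
apply/seteqP; split; last first.
  apply: smallest_sub; first exact: sigma_algebra_measurable.
  by move=> _ [p _ <-]; exact: measurable_open_box.
apply: smallest_sub; first exact: smallest_sigma_algebra.
move=> _ [[i j] _ [B mB <-]].
suff : @measurable_fun _ _ (g_sigma_algebraType G) R setT
    (fun M : 'rV[R]_n => M i j).
  by move=> /(_ measurableT _ mB).
apply: (measurability _ (RGenOInfty.measurableE R)).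
move=> _ [_ [x ->] <-].
rewrite setTI (_ : _ @^-1` _ = \bigcup_k
   open_box (\row_l (if l == j then x else - k%:R)) (const_mx k%:R)).
  apply: bigcup_measurable => k _; apply: sub_sigma_algebra.
  by exists (\row_l (if l == j then x else - k%:R), const_mx k%:R).
apply/seteqP; split => [v /=|v [k _ /(_ j)]]; rewrite ord1 /= in_itv /= ?andbT.
  move=> xv; near \oo => k; exists k => // l; rewrite !mxE.
  have : `|v 0 l| < k%:R.
    apply: le_lt_trans (_ : `|v| < _).
      rewrite [leRHS]mx_normrE; exact: (le_bigmax _ _ (0, l)).
    by near: k; exact: nbhs_infty_gtr.
  rewrite ltr_norml => /andP[h1 ->]; rewrite andbT.
  by case: eqVneq => [->|].
by rewrite !mxE eqxx => /andP[].
Unshelve. all: by end_near. Qed.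

(** Open boxes form a generating family that is stable under intersection. *)
Lemma rV_measure_unique n (m1 m2 : {measure set 'rV[R]_n -> \bar R}) :
  (forall a b, m1 (open_box a b) = m2 (open_box a b)) ->
  (forall a b, m1 (open_box a b) < +oo)%E ->
  forall A, measurable A -> m1 A = m2 A.
Proof.
move=> m12 m1oo; apply: (measure_unique (range (fun p => open_box p.1 p.2))
  (fun k => open_box (const_mx (- k%:R)) (const_mx k%:R))).
- exact: sigma_open_box.
- move=> _ _ [p _ <-] [q _ <-].
  exists (\row_i Num.max (p.1 0 i) (q.1 0 i), \row_i Num.min (p.2 0 i) (q.2 0 i)) => //.
  apply/seteqP; split=> v /= => [h|[h1 h2] i].
    by split=> i; have := h i; rewrite !mxE gt_max lt_min =>
      /andP[/andP[h1 h2] /andP[h3 h4]]; rewrite ?h1 ?h2 ?h3 ?h4.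
  rewrite !mxE gt_max lt_min.
  by have /andP[-> ->] := h1 i; have /andP[-> ->] := h2 i.
- by move=> k; exists (const_mx (- k%:R), const_mx k%:R).
- apply/seteqP; split=> // v _; near \oo => k; exists k => // l; rewrite !mxE.
  rewrite -ltr_norml; apply: le_lt_trans (_ : `|v| < _).
    rewrite [leRHS]mx_normrE; exact: (le_bigmax _ _ (0, l)).
  by near: k; exact: nbhs_infty_gtr.
- by move=> _ [p _ <-]; exact: m12.
- by move=> k; exact: m1oo.
Unshelve. all: by end_near. Qed.

Lemma coord_le_norm n (v : 'rV[R]_n) i : `|v 0 i| <= `|v|.
Proof. rewrite [leRHS]mx_normrE; exact: (le_bigmax _ _ (0, i)). Qed.

Lemma norm_le_coord n (v : 'rV[R]_n) (M : R) : 0 <= M ->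
  (forall i, `|v 0 i| <= M) -> `|v| <= M.
Proof.
move=> M0 h; rewrite [leLHS]mx_normrE; apply: bigmax_le => // -[i j] _.
by rewrite ord1; exact: h.
Qed.

End boxes.

(** * Fubini and change of variables *)
Section insert.
Context {R : realType}.
Local Notation lam := (@lebesgue_measure R).

Definition insert_coord n (b : 'I_n.+1) (p : R * 'rV[R]_n) : 'rV[R]_n.+1 :=
  \row_j oapp (p.2 0) p.1 (unlift b j).

Lemma insert_coord_self n (b : 'I_n.+1) p : insert_coord b p 0 b = p.1.
Proof. by rewrite mxE unlift_none. Qed.

Lemma insert_coord_lift n (b : 'I_n.+1) p k :
  insert_coord b p 0 (lift b k) = p.2 0 k.
Proof. by rewrite mxE liftK. Qed.

Lemma insert_coordD n (b : 'I_n.+1) s h (v : 'rV[R]_n) :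
  insert_coord b (s + h, v) = insert_coord b (s, v) + h *: delta_mx 0 b.
Proof.
apply/rowP => j; rewrite !mxE eqxx /=.
case: (unliftP b j) => [k|] -> /=; last by rewrite eqxx mulr1.
by rewrite [_ == b]eq_sym (negbTE (neq_lift _ _)) mulr0 addr0.
Qed.

Lemma measurable_insert_coord n (b : 'I_n.+1) :
  measurable_fun setT (@insert_coord n b : measurableTypeR R * 'rV[R]_n -> _).
Proof.
apply: measurable_mxP => i j; rewrite ord1.
case: (unliftP b j) => [k|] ->.
  under eq_fun do rewrite insert_coord_lift.
  exact: (measurableT_comp (measurable_mx_coord _ _) measurable_snd).
under eq_fun do rewrite insert_coord_self.
exact: measurable_fst.
Qed.

(** Lebesgue measure is defined by slicing off the first coordinate; by uniqueness
    any coordinate may be sliced off, both measures being products on boxes. *)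
Lemma lebesgue_insert_coord n (b : 'I_n.+1) A : measurable A ->
  lebesgue_rV A = (lam \x @lebesgue_rV R n)%E (insert_coord b @^-1` A).
Proof.
move=> mA.
apply: (@rV_measure_unique _ _ (@lebesgue_rV R n.+1)
  (pushforward (lam \x @lebesgue_rV R n)%E (insert_coord b))) => //.
- exact: measurable_insert_coord.
- move=> mi u v.
  pose I i : set R := `]u 0 i, v 0 i[%classic.
  transitivity (\prod_(i < n.+1) lam (I i))%E.
    by rewrite open_boxE -(lebesgue_rV_box (A := I)) => [//|i]; rewrite /I.
  transitivity ((lam \x @lebesgue_rV R n)%E (insert_coord b @^-1` open_box u v));
    last by [].
  rewrite (_ : insert_coord b @^-1` _ = I b `*`
    [set w : 'rV[R]_n | forall i, I (lift b i) (w 0 i)]).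
    rewrite product_measure1E; last 2 first.
    - by rewrite /I.
    - by apply: (measurable_coord_box (A := fun i => I (lift b i))) => i; rewrite /I.
    rewrite (bigD1_ord b)//=; congr (_ * _)%E.
    by rewrite -(lebesgue_rV_box (A := fun i => I (lift b i))) => [//|i]; rewrite /I.
  apply/seteqP; rewrite /I; split=> [[s w]|[s w]] /= => [h|[h1 h2] j].
    split; first by have := h b; rewrite insert_coord_self in_itv.
    by move=> i; have := h (lift b i); rewrite insert_coord_lift in_itv.
  case: (unliftP b j) => [k|] ->; rewrite ?insert_coord_lift ?insert_coord_self //=.
  by have := h2 k; rewrite in_itv.
- by move=> u v; exact: lebesgue_open_box_lty.
Qed.

Local Open Scope ereal_scope.

Lemma tonelli_coord n (b : 'I_n.+1) (f : 'rV[R]_n.+1 -> \bar R) :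
  measurable_fun setT f -> (forall x, 0 <= f x) ->
  \int[@lebesgue_rV R n.+1]_x f x =
  \int[@lebesgue_rV R n]_v \int[lam]_s f (insert_coord b (s, v)).
Proof.
move=> mf f0.
have mi := @measurable_insert_coord n b.
transitivity (\int[pushforward (lam \x @lebesgue_rV R n) (insert_coord b)]_x f x).
  by apply: eq_measure_integral => A mA _; exact: lebesgue_insert_coord.
rewrite ge0_integral_pushforward//.
rewrite preimage_setT (@fubini_tonelli2 _ _ _ _ _ lam (@lebesgue_rV R n)
    (f \o insert_coord b))//.
  exact: measurableT_comp.
by move=> x; exact: f0.
Qed.

Lemma fubini_coord n (b : 'I_n.+1) (f : 'rV[R]_n.+1 -> \bar R) :
  (@lebesgue_rV R n.+1).-integrable setT f ->
  \int[@lebesgue_rV R n.+1]_x f x =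
  \int[@lebesgue_rV R n]_v \int[lam]_s f (insert_coord b (s, v)).
Proof.
move=> intf.
have mi := @measurable_insert_coord n b.
have mf : measurable_fun setT f by have /integrableP[] := intf.
have mfi : measurable_fun setT (f \o insert_coord b : measurableTypeR R * 'rV[R]_n -> _).
  exact: measurableT_comp.
have E (g : 'rV[R]_n.+1 -> \bar R) : \int[@lebesgue_rV R n.+1]_x g x =
    \int[pushforward (lam \x @lebesgue_rV R n) (insert_coord b)]_x g x.
  by apply: eq_measure_integral => A mA _; exact: lebesgue_insert_coord.
have ifi : (lam \x @lebesgue_rV R n).-integrable setT (f \o insert_coord b).
  apply/integrableP; split=> //.
  have /integrableP[_] := intf; rewrite E ge0_integral_pushforward//.
  by apply: measurableT_comp.
rewrite E integral_pushforward//.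
rewrite preimage_setT.
by rewrite -(@integral21_prod_meas1 _ _ _ _ _ lam (@lebesgue_rV R n)).
Qed.

End insert.

Section change_of_variables.
Local Open Scope ereal_scope.
Context d (X : measurableType d) {R : realType} (m : {measure set X -> \bar R}).
Context (T : X -> X) (J : X -> R).
Hypotheses (mT : measurable_fun setT T) (mJ : measurable_fun setT J)
  (J0 : forall x, (0 <= J x)%R).

(** The image under T of the measure with density J.  A change of variables is the
    statement that this image is the given measure. *)
Lemma weighted_image_measure : exists m' : {measure set X -> \bar R},
  forall A, m' A = \int[m]_(x in T @^-1` A) (J x)%:E.
Proof.
pose q (A : set X) := \int[m]_(x in T @^-1` A) (J x)%:E.
have mpre A : measurable A -> measurable (T @^-1` A).
  by move=> mA; rewrite -[X in measurable X]setTI; exact: mT.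
have q0 : q set0 = 0 by rewrite /q preimage_set0 integral_set0.
have q_ge0 A : 0 <= q A by apply: integral_ge0 => x _; rewrite lee_fin.
have q_sadd : semi_sigma_additive q.
  move=> F mF tF mUF; rewrite /q preimage_bigcup ge0_integral_bigcup//.
  - apply: is_cvg_ereal_nneg_natsum_cond => k _ _; exact: q_ge0.
  - by move=> i; exact: mpre.
  - by apply/measurable_funTS/measurable_EFinP.
  - by move=> x _; rewrite lee_fin.
  - apply/trivIsetP => i j _ _ ij; rewrite -preimage_setI.
    by move/trivIsetP : tF => /(_ _ _ _ _ ij) -> //; rewrite preimage_set0.
pose Q := HB.pack_for {measure set X -> \bar R} q
  (isMeasure.Build _ _ _ q q0 q_ge0 q_sadd).
by exists Q.
Qed.

Import HBNNSimple.

Hypothesis mE : forall A, measurable A ->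
  m A = \int[m]_(x in T @^-1` A) (J x)%:E.

(** From sets to nonnegative functions, by simple functions and monotone
    convergence. *)
Lemma ge0_integral_weighted_image (f : X -> \bar R) :
  measurable_fun setT f -> (forall x, 0 <= f x) ->
  \int[m]_x f x = \int[m]_x (f (T x) * (J x)%:E).
Proof.
move=> mf f0.
pose f_ := nnsfun_approx measurableT mf.
have cvf x : (f_ n x)%:E @[n --> \oo] --> f x.
  by apply: cvg_nnsfun_approx => //.
have ndf x : {homo (fun n => (f_ n x)%:E) : i j / (i <= j)%N >-> (i <= j)%E}.
  by move=> i j ij; rewrite lee_fin; exact/lefP/nd_nnsfun_approx.
transitivity (limn (fun n => \int[m]_x (f_ n x)%:E)).
  rewrite -monotone_convergence//.
  - by apply: eq_integral => y _; apply/esym/cvg_lim.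
  - by move=> n; exact/measurable_EFinP/measurable_funP.
  - by move=> n y _; rewrite lee_fin.
rewrite [X in limn X](_ : _ =
    (fun n => \int[m]_x ((f_ n (T x))%:E * (J x)%:E))).
  rewrite -monotone_convergence//.
  - apply: eq_integral => y _; apply/cvg_lim => //.
    by apply: cvgeMr => //; exact: cvf.
  - move=> n; apply: emeasurable_funM; last exact/measurable_EFinP.
    apply/measurable_EFinP; apply: measurableT_comp => //.
  - by move=> n y _; rewrite mule_ge0// lee_fin.
  - by move=> x _ i j ij; rewrite lee_wpmul2r ?lee_fin//; exact: ndf.
apply/funext => n.
under eq_integral do rewrite fimfunE -fsumEFin//.
under [RHS]eq_integral => y _.
  rewrite fimfunE -fsumEFin// ge0_mule_fsuml; last first.
    by move=> r; rewrite nnfun_muleindic_ge0.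
  over.
rewrite !ge0_integral_fsum//; last 4 first.
- move=> r; apply: emeasurable_funM; last exact/measurable_EFinP.
  apply/measurable_EFinP; apply: measurable_funM => //.
  apply: (measurableT_comp _ mT); apply: measurable_indic; exact: measurable_sfunP.
- by move=> r x _; rewrite mule_ge0 ?lee_fin//; have := nnfun_muleindic_ge0 (f_ n) r (T x).
- by move=> r; apply/measurable_EFinP/measurable_funM.
- by move=> r x _; rewrite nnfun_muleindic_ge0.
apply: eq_fsbigr => r _.
have [r0|r0] := ltP r 0%R.
  rewrite preimage_nnfun0//.
  by rewrite !integral0_eq// => x _; rewrite indic0 mulr0 ?mul0e.
set A := _ @^-1` [set r].
have mA : measurable A by exact: measurable_sfunP.
under eq_integral do rewrite EFinM.
rewrite ge0_integralZl//; last first.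
  by apply/measurable_EFinP.
rewrite integral_indic// setIT.
under [RHS]eq_integral do rewrite EFinM -muleA.
rewrite ge0_integralZl//.
- congr (_ * _); rewrite mE// integral_mkcond; apply: eq_integral => x _.
  rewrite restrict_EFin patch_indic /= indicE mulrC EFinM.
  by congr (_ * _); rewrite indicE; congr (_%:R%:E); apply/idP/idP; rewrite !inE.
- apply: emeasurable_funM; last exact/measurable_EFinP.
  apply/measurable_EFinP; apply: (measurableT_comp _ mT).
  exact: measurable_indic.
- by move=> x _; rewrite -EFinM lee_fin mulr_ge0.
Qed.

(** A null set pulls back to a set that is null for the density J, and J > 0. *)
Lemma ae_weighted_image (P : set X) : (forall x, (0 < J x)%R) ->
  {ae m, forall x, P x} -> {ae m, forall x, P (T x)}.
Proof.
move=> Jgt0 [A [mA A0 PA]].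
have mTA : measurable (T @^-1` A) by rewrite -[X in measurable X]setTI; exact: mT.
exists (T @^-1` A); split => //; last by move=> x /= nP; exact: PA.
have mJA : measurable_fun (T @^-1` A) (EFin \o J).
  by apply/measurable_funTS/measurable_EFinP.
have /(ae_eq_integral_abs m mTA mJA) [B [mB B0 JB]] :
    \int[m]_(x in T @^-1` A) `|(EFin \o J) x| = 0.
  rewrite -A0 mE//; apply: eq_integral => x _ /=.
  by rewrite ger0_norm// ltW.
apply/eqP; rewrite eq_le measure_ge0 andbT -B0 le_measure ?inE//.
move=> x TAx; apply: JB => /= /(_ TAx) [] J0x.
by have := Jgt0 x; rewrite J0x ltxx.
Qed.

End change_of_variables.

Section substitution1.
Context {R : realType}.
Local Notation lam := (@lebesgue_measure R).

(** By uniqueness of Lebesgue measure it suffices to consider intervals, for which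
    the identity is the fundamental theorem of calculus. *)
Lemma lebesgue_substitution (F G : R -> R) :
  (forall x, derivable F x 1) -> continuous F^`()%classic -> (forall x, 0 < F^`()%classic x) ->
  cancel F G -> cancel G F -> forall A, measurable A ->
  lam A = (\int[lam]_(x in F @^-1` A) (F^`()%classic x)%:E)%E.
Proof.
move=> dF cF' F'0 FK GK A mA.
have cF : continuous F.
  by move=> x; apply: differentiable_continuous; exact/derivable1_diffP.
have incF x y : x < y -> F x < F y.
  move=> xy; apply: (@gtr0_derive1_incr _ F x y) => //.
  exact: continuous_subspaceT.
have leF x y : (F x <= F y) = (x <= y).
  exact/le_mono/incF.
have ltF x y : (F x < F y) = (x < y) by rewrite !ltNge leF.
have mF : measurable_fun setT (F : measurableTypeR R -> measurableTypeR R).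
  exact: continuous_measurable_fun.
have mF' : measurable_fun setT (F^`()%classic : measurableTypeR R -> R).
  exact: continuous_measurable_fun.
have [m' m'E] := @weighted_image_measure _ (measurableTypeR R) R lam F _ mF mF'
  (fun x => ltW (F'0 x)).
rewrite -m'E; apply: lebesgue_measure_unique => //= _ [[a b] _ <-].
rewrite m'E /= lebesgue_measure_itv /= lte_fin.
have -> : F @^-1` `]a, b]%classic = `]G a, G b]%classic.
  apply/seteqP; split=> x /=; rewrite !in_itv /=.
    by rewrite -{1}(GK a) -{1}(GK b) ltF leF.
  by rewrite -{2}(GK a) -{2}(GK b) ltF leF.
case: ltP => ab; last first.
  by rewrite set_itv_ge ?integral_set0// bnd_simp -leNgt -leF !GK.
have Gab : G a < G b by rewrite -ltF !GK.
rewrite integral_itv_obnd_cbnd; last first.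
  apply/measurable_EFinP; apply: measurable_funTS; exact: mF'.
rewrite (@continuous_FTC2 _ F^`()%classic F)//.
- by rewrite !GK.
- exact: continuous_subspaceT.
- split=> [x _| |]; [exact: dF| |].
    by apply: cvg_at_right_filter; exact: cF.
  by apply: cvg_at_left_filter; exact: cF.
Qed.

(** Surjectivity is the intermediate value theorem on [z - C, z + C]. *)
Lemma bounded_perturbation_bij (k : R -> R) (C : R) :
  continuous k -> (forall s, `|k s| <= C) ->
  (forall s s', s < s' -> s + k s < s' + k s') ->
  exists G, cancel (fun s => s + k s) G /\ cancel G (fun s => s + k s).
Proof.
move=> ck kC inc.
have cF : continuous (fun s => s + k s).
  by move=> s; apply: cvgD; [exact: cvg_id|exact: ck].
have surj z : exists s, s + k s = z.
  have C0 : 0 <= C by apply: le_trans (kC 0).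
  have [] := @IVT _ (fun s => s + k s) (z - C) (z + C) z.
  - lra.
  - exact: continuous_subspaceT.
  - have := kC (z - C); have := kC (z + C); rewrite !ler_norml => /andP[h1 h2] /andP[h3 h4].
    rewrite ge_min le_max; apply/andP; split; apply/orP; [left|right]; lra.
  - by move=> s _ <-; exists s.
have [G hG] := choice surj; exists G; split=> // s.
have [h|h|//] := ltgtP (G (s + k s)) s; have := inc _ _ h; rewrite hG ltxx //.
Qed.

End substitution1.

(** * Directional derivatives on coordinate space *)

Lemma cts_add {R : realType} (T : topologicalType) (f g : T -> R) :
  continuous f -> continuous g -> continuous (fun x => f x + g x).
Proof. by move=> cf cg x; exact: (cvgD (cf x) (cg x)). Qed.

Lemma cts_mul {R : realType} (T : topologicalType) (f g : T -> R) :
  continuous f -> continuous g -> continuous (fun x => f x * g x).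
Proof. by move=> cf cg x; exact: (cvgM (cf x) (cg x)). Qed.

Lemma cts_opp {R : realType} (T : topologicalType) (f : T -> R) :
  continuous f -> continuous (fun x => - f x).
Proof. by move=> cf x; exact: (cvgN (cf x)). Qed.

Lemma cts_cst {R : realType} (T : topologicalType) (c : R) :
  continuous (fun _ : T => c).
Proof. by move=> x; exact: cvg_cst. Qed.

Lemma cts_coord {R : realType} n i : continuous (fun v : 'rV[R]_n => v 0 i).
Proof. exact: coord_continuous. Qed.

Lemma cts_rV {R : realType} n m (f : 'rV[R]_n -> 'rV[R]_m) :
  (forall z e, 0 < e -> exists2 r, 0 < r &
    forall w, `|z - w| < r -> `|f z - f w| < e) -> continuous f.
Proof.
move=> h z A /nbhs_ballP[e /= e0 eA].
have [r r0 rh] := h z e e0; apply/nbhs_ballP; exists r => //= w.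
rewrite -ball_normE /= => zw; apply: eA; rewrite -ball_normE /=; exact: rh.
Qed.

Lemma cts_comp (T U V : topologicalType) (f : T -> U) (g : U -> V) :
  continuous f -> continuous g -> continuous (fun x => g (f x)).
Proof. by move=> cf cg x; apply: continuous_comp; [exact: cf|exact: cg]. Qed.

Lemma cts_line {R : realType} n (f : 'rV[R]_n -> R) (z v : 'rV[R]_n) :
  continuous f -> continuous (fun s : R => f (z + s *: v)).
Proof.
move=> cf; apply: (@cts_comp _ _ _ (fun s : R => z + s *: v)) => // s.
by apply: cvgD; [exact: cvg_cst|apply: cvgZr_tmp; exact: cvg_id].
Qed.

Lemma continuous_bigsum {R : realType} (T : topologicalType) (I : Type)
    (r : seq I) (P : pred I) (F : I -> T -> R) :
  (forall i, continuous (F i)) ->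
  continuous (fun x => \sum_(i <- r | P i) F i x).
Proof.
move=> cF; elim: r => [|i r IH] x.
  by under eq_fun do rewrite big_nil; exact: cvg_cst.
under eq_fun do rewrite big_cons; case: (P i); last exact: IH.
by apply: cvgD; [exact: cF|exact: IH].
Qed.

Section directional.
Context {R : realType} {n : nat}.
Local Notation Rn := 'rV[R]_n.

Lemma is_derive_line (f : Rn -> R) (z v : Rn) (s : R) :
  derivable f (z + s *: v) v ->
  is_derive s 1 (fun s : R => f (z + s *: v)) ('D_v f (z + s *: v)).
Proof.
move=> df.
have E (h : R) : f (z + (h *: 1 + s) *: v) = f (h *: v + (z + s *: v)).
  by congr f; rewrite scaler1 scalerDl addrCA.
split; last first.
  by rewrite /derive; under eq_fun do rewrite /= E.
by rewrite /derivable; under eq_fun do rewrite /= E.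
Qed.

Lemma mean_value_line (f : Rn -> R) (z v : Rn) (h : R) :
  (forall s : R, `|s| <= `|h| -> derivable f (z + s *: v) v) ->
  exists s : R, `|s| <= `|h| /\ f (z + h *: v) - f z = h * 'D_v f (z + s *: v).
Proof.
move=> df; pose g (s : R) := f (z + s *: v).
have dg (s : R) : `|s| <= `|h| -> is_derive s 1 g ('D_v f (z + s *: v)).
  by move=> /df; exact: is_derive_line.
have g0 : g 0 = f z by rewrite /g scale0r addr0.
have cg (a b : R) : (forall s : R, s \in `[a, b] -> `|s| <= `|h|) ->
    {within `[a, b], continuous g}.
  move=> ab; apply: derivable_within_continuous => s /ab sh.
  by have [] := dg _ sh.
have [h0|h0] := leP 0 h.
- have hs s : s \in `[0, h] -> `|s| <= `|h|.
    by rewrite in_itv /= => /andP[s0 sh]; rewrite !ger0_norm.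
  have [s /hs sh E] := @MVT_segment _ g (fun s => 'D_v f (z + s *: v)) 0 h h0
    (fun s sh => dg s (hs s (subset_itv_oo_cc sh))) (cg _ _ hs).
  by exists s; split => //; rewrite -/(g h) -g0 E subr0 mulrC.
- have hs s : s \in `[h, 0] -> `|s| <= `|h|.
    by rewrite in_itv /= => /andP[s0 sh]; rewrite !ler0_norm ?lerN2 // ltW.
  have [s /hs sh E] := @MVT_segment _ g (fun s => 'D_v f (z + s *: v)) h 0 (ltW h0)
    (fun s sh => dg s (hs s (subset_itv_oo_cc sh))) (cg _ _ hs).
  by exists s; split => //; rewrite -/(g h) -g0 -opprB E sub0r mulrN opprK mulrC.
Qed.

(** The mean value theorem along the edges of a box: x is moved to x + h one
    coordinate at a time. *)
Lemma mean_value_coord (f : Rn -> R) (x h : Rn) :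
  (forall z i, `|z - x| <= `|h| -> derivable f z ('e_i)) ->
  exists xi : 'I_n -> Rn, (forall i, `|xi i - x| <= `|h|) /\
    f (x + h) - f x = \sum_i h 0 i * 'D_('e_i) f (xi i).
Proof.
move=> df; pose hk k : Rn := \row_i (if (i < k)%N then h 0 i else 0).
suff H k : (k <= n)%N -> exists xi : 'I_n -> Rn, (forall i, `|xi i - x| <= `|h|) /\
    f (x + hk k) - f x = \sum_(i < n | (i < k)%N) h 0 i * 'D_('e_i) f (xi i).
  have [xi [xih E]] := H n (leqnn n); exists xi; split=> //.
  rewrite (_ : hk n = h) in E; last by apply/rowP => i; rewrite mxE ltn_ord.
  by rewrite E; apply: eq_bigl => i; rewrite ltn_ord.
elim: k => [_|k IH kn].
  exists (fun=> x); split=> [i|]; first by rewrite subrr normr0.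
  rewrite big_pred0// (_ : hk 0 = 0) ?addr0 ?subrr//.
  by apply/rowP => i; rewrite !mxE.
have [xi [xih E]] := IH (ltnW kn); pose j := Ordinal kn.
have hkS : hk k.+1 = hk k + h 0 j *: 'e_j.
  apply/rowP => i; rewrite !mxE eqxx /= ltnS leq_eqVlt.
  have [ij|ij] := eqVneq i j; first by rewrite ij /= eqxx ltnn /= add0r mulr1.
  by rewrite [_ == k](negbTE ij) /= mulr0 addr0.
have bnd (s : R) : `|s| <= `|h 0 j| -> `|x + hk k + s *: 'e_j - x| <= `|h|.
  move=> sh; rewrite (_ : _ - x = hk k + s *: 'e_j); last first.
    by apply/rowP => i; rewrite !mxE; ring.
  apply: norm_le_coord => // i; rewrite !mxE eqxx /=.
  have [->|ij] := eqVneq i j.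
    by rewrite ltnn add0r mulr1 (le_trans sh)// coord_le_norm.
  by rewrite mulr0 addr0; case: ifP => _; rewrite ?normr0 ?coord_le_norm.
have [s [sh Es]] := @mean_value_line f (x + hk k) 'e_j (h 0 j)
  (fun s sh => df _ _ (bnd s sh)).
exists (fun i => if i == j then x + hk k + s *: 'e_j else xi i); split=> [i|].
  by case: ifP => _; [exact: bnd|exact: xih].
rewrite hkS addrA.
rewrite (_ : _ - f x = (f (x + hk k + h 0 j *: 'e_j) - f (x + hk k)) +
   (f (x + hk k) - f x)); last by rewrite addrA subrK.
rewrite Es (bigD1 j) /= ?ltnSn// eqxx E; congr (_ + _).
apply: eq_big => i; last by move=> ik; rewrite ifN// -val_eqE /= ltn_eqF.
by rewrite ltnS [RHS]andbC -val_eqE /= ltn_neqAle.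
Qed.

(** Stated with partial derivatives; by the mean value theorem along coordinates
    such functions are differentiable. *)
Definition C1 (f : Rn -> R) := continuous f /\
  forall a, (forall x, derivable f x 'e_a) /\ continuous ('D_('e_a) f).

Definition csupp (f : Rn -> R) := exists M : R, forall x, M < `|x| -> f x = 0.

Lemma differentiable_C1_at (f : Rn -> R) (x : Rn) :
  (\forall z \near x, forall i, derivable f z 'e_i) ->
  (forall i, {for x, continuous ('D_('e_i) f)}) -> differentiable f x.
Proof.
move=> df cf.
pose l (h : Rn) := \sum_i h 0 i * 'D_('e_i) f x.
have linl : linear l.
  move=> c u v; rewrite /l scaler_sumr -big_split; apply: eq_bigr => i _ /=.
  by rewrite !mxE mulrDl -mulrA.
pose L : {linear Rn -> R} := HB.pack l (GRing.isLinear.Build _ _ _ _ l linl).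
have cL : continuous L.
  apply: continuous_bigsum => i z.
  exact: (cvgM (@coord_continuous R 1 n 0 i z) (cvg_cst _)).
have oL : f \o shift x = cst (f x) + L +o_ (0 : Rn) id.
  apply/eqaddoP => e e0.
  pose e' := e / (n%:R + 1).
  have e'0 : 0 < e' by rewrite divr_gt0// ltr_wpDl.
  have H : \forall z \near x, (forall i, derivable f z 'e_i) /\
      forall i, `|'D_('e_i) f x - 'D_('e_i) f z| < e'.
    have H2 : \forall z \near x, forall i, `|'D_('e_i) f x - 'D_('e_i) f z| < e'.
      apply: (@filter_forall Rn _ _ (nbhs x) _) => i.
      by have /cvgrPdist_lt := cf i; apply.
    by near=> z; split; near: z.
  have /nbhs_ballP[r /= r0 xrH] := H.
  apply/nbhs_ballP; exists r => //= h; rewrite -ball_normE /= sub0r normrN => hr.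
  have bz (z : Rn) : `|z - x| <= `|h| -> ball x r z.
    by rewrite -ball_normE /= distrC => /le_lt_trans; apply.
  have [xi [xih E]] := @mean_value_coord f x h (fun z i zh => (xrH z (bz z zh)).1 i).
  rewrite /= !fctE /= [h + x]addrC opprD addrA E /L /= /l -sumrB.
  apply: le_trans (ler_norm_sum _ _ _) _.
  apply: (@le_trans _ _ (\sum_(i < n) `|h| * e')).
    apply: ler_sum => i _; rewrite -mulrBr normrM ler_pM ?coord_le_norm//.
    by rewrite distrC ltW// (xrH _ (bz _ (xih i))).2.
  rewrite sumr_const card_ord -[leLHS]mulr_natr -mulrA mulrC ler_wpM2r//.
  rewrite /e' mulrAC -mulrA ler_piMr ?(ltW e0)// ler_pdivrMr ?ltr_wpDl// mul1r.
  by rewrite lerDl.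
apply/diff_locallyP.
by have E := diff_unique cL oL; rewrite E.
Unshelve. all: by end_near. Qed.

Lemma C1_differentiable (f : Rn -> R) x : C1 f -> differentiable f x.
Proof.
move=> [cf df]; apply: differentiable_C1_at.
  by apply: filterE => z i; have [+ _] := df i; apply.
by move=> i; have [_ +] := df i; apply.
Qed.

Lemma C1_lipschitz (f : Rn -> R) (C : R) : C1 f ->
  (forall a x, `|'D_('e_a) f x| <= C) ->
  forall x z, `|f x - f z| <= n%:R * C * `|x - z|.
Proof.
move=> [cf df] fC x z.
have [xi [_ E]] := @mean_value_coord f z (x - z) (fun z i _ => (df i).1 z).
rewrite -[in f x](subrK z x) [x - z + z]addrC E.
apply: le_trans (ler_norm_sum _ _ _) _.
apply: (@le_trans _ _ (\sum_(i < n) C * `|x - z|)).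
  by apply: ler_sum => i _; rewrite mulrC normrM ler_pM// coord_le_norm.
by rewrite sumr_const card_ord -[n%:R * C * _]mulrA mulr_natl.
Qed.

(** The complement of a closed ball is open, so f vanishes near x. *)
Lemma derive_supp (f : Rn -> R) v (M : R) : (forall x, M < `|x| -> f x = 0) ->
  forall x, M < `|x| -> 'D_v f x = 0.
Proof.
move=> fM x Mx.
have : \forall z \near x, f z = (cst 0 : Rn -> R) z.
  have xM : 0 < `|x| - M by rewrite subr_gt0.
  apply: filterS (nbhsx_ballx x _ xM) => z; rewrite -ball_normE /= => xz.
  by apply: fM; have := lerB_dist x z; lra.
by move=> /(near_eq_derive v) ->; rewrite derive_cst.
Qed.

Lemma csupp_derive (f : Rn -> R) v : csupp f -> csupp ('D_v f).
Proof. by move=> [M fM]; exists M; exact: derive_supp. Qed.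

Lemma compact_ball_norm (M : R) : compact [set x : Rn | `|x| <= M].
Proof.
apply: bounded_closed_compact.
  by exists M; split => [|N MN x /= xM]; [exact: num_real|rewrite (le_trans xM)// ltW].
apply: (@closed_comp _ _ (fun x : Rn => `|x|) [set y | y <= M]).
  by move=> x _; exact: norm_continuous.
exact: closed_le.
Qed.

Lemma csupp_bounded (f : Rn -> R) : continuous f -> csupp f ->
  exists C, forall x, `|f x| <= C.
Proof.
move=> cf [M fM].
have : compact (f @` [set x : Rn | `|x| <= M]).
  apply: continuous_compact; last exact: compact_ball_norm.
  exact: continuous_subspaceT.
move=> /compact_bounded[B [_ fB]]; exists (Num.max (B + 1) 0) => x.
have [xM|/fM ->] := leP `|x| M; last by rewrite normr0 le_max lexx orbT.
by rewrite le_max; apply/orP; left; apply: (fB (B + 1)); [rewrite ltrDl|exists x].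
Qed.

Lemma C1M (f g : Rn -> R) : C1 f -> C1 g -> C1 (fun x => f x * g x).
Proof.
move=> [cf df] [cg dg]; split=> [x|a]; first exact: cvgM (cf x) (cg x).
have [da ca] := df a; have [da' ca'] := dg a.
split=> [x|]; first exact: derivableM.
rewrite (_ : 'D_('e_a) _ = fun x => f x * 'D_('e_a) g x + g x * 'D_('e_a) f x).
  by move=> x; exact: (cvgD (cvgM (cf x) (ca' x)) (cvgM (cg x) (ca x))).
by apply/funext => x; exact: deriveM.
Qed.

Lemma csuppMl (f g : Rn -> R) : csupp f -> csupp (fun x => f x * g x).
Proof. by move=> [M h]; exists M => x /h ->; rewrite mul0r. Qed.

Lemma csuppMr (f g : Rn -> R) : csupp g -> csupp (fun x => f x * g x).
Proof. by move=> [M h]; exists M => x /h ->; rewrite mulr0. Qed.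

End directional.

(** * Shears *)
Section transfer.
Context d (X : measurableType d) {R : realType} (m : {measure set X -> \bar R}).
Context (T : X -> X) (J : X -> R).
Hypotheses (mT : measurable_fun setT T) (mJ : measurable_fun setT J)
  (J0 : forall x, 0 <= J x).
Hypothesis TJ : forall f : X -> \bar R, measurable_fun setT f ->
  (forall x, 0 <= f x)%E -> (\int[m]_x f x = \int[m]_x (f (T x) * (J x)%:E))%E.

Lemma integrable_transfer (f : X -> R) : m.-integrable setT (EFin \o f) ->
  m.-integrable setT (EFin \o (fun x => f (T x) * J x)).
Proof.
move=> /integrableP[mf foo]; have {}mf : measurable_fun setT f by exact/measurable_EFinP.
apply/integrableP; split.
  by apply/measurable_EFinP; apply: measurable_funM => //; exact: measurableT_comp.
move: foo; rewrite TJ; last 2 first.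
- by apply: measurableT_comp => //; exact/measurable_EFinP.
- by move=> x; exact: abse_ge0.
congr (_ < _)%E; apply: eq_integral => x _ /=.
by rewrite normrM EFinM (ger0_norm (J0 x)).
Qed.

Lemma Rintegral_transfer (f : X -> R) : m.-integrable setT (EFin \o f) ->
  \int[m]_x f x = \int[m]_x (f (T x) * J x).
Proof.
move=> intf; have /integrableP[mf foo] := intf.
have {}mf : measurable_fun setT f by exact/measurable_EFinP.
pose fp x := Num.max (f x) 0; pose fm x := Num.max (- f x) 0.
have fE x : f x = fp x - fm x.
  by rewrite /fp /fm; case: (leP (f x) 0); case: (leP (- f x) 0); lra.
have fp0 x : 0 <= fp x by rewrite /fp le_max lexx orbT.
have fm0 x : 0 <= fm x by rewrite /fm le_max lexx orbT.
have mfp : measurable_fun setT fp by apply: measurable_maxr.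
have mfm : measurable_fun setT fm.
  by apply: measurable_maxr => //; exact: measurableT_comp.
have ifp : m.-integrable setT (EFin \o fp).
  apply: le_integrable intf => //; first exact/measurable_EFinP.
  move=> x _ /=; rewrite lee_fin ger0_norm// /fp.
  by rewrite ge_max ler_norm normr_ge0.
have ifm : m.-integrable setT (EFin \o fm).
  apply: le_integrable intf => //; first exact/measurable_EFinP.
  move=> x _ /=; rewrite lee_fin ger0_norm// /fm.
  by rewrite ge_max -normrN ler_norm normr_ge0.
under eq_Rintegral do rewrite fE.
under [RHS]eq_Rintegral do rewrite fE mulrBl.
rewrite !RintegralB//; [|exact: integrable_transfer..].
congr (_ - _); rewrite /Rintegral TJ//; try exact/measurable_EFinP.
Qed.

End transfer.

Lemma indic_preimage (R : realType) (X Y : Type) (T : X -> Y) (A : set Y) x :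
  \1_A (T x) = \1_(T @^-1` A) x :> R.
Proof. by rewrite !indicE; congr (_%:R); apply/idP/idP; rewrite !inE. Qed.

Lemma integral_preimage_indic d (X : measurableType d) {R : realType}
    (m : {measure set X -> \bar R}) d' (Y : measurableType d') (T : X -> Y)
    (A : set Y) (J : X -> R) :
  (\int[m]_(x in T @^-1` A) (J x)%:E = \int[m]_x (\1_A (T x) * J x)%:E)%E.
Proof.
rewrite integral_mkcond; apply: eq_integral => x _; rewrite patchE.
have -> : \1_A (T x) = (x \in T @^-1` A)%:R :> R.
  by rewrite indic_preimage indicE.
by case: (_ \in _); rewrite ?mul1r ?mul0r.
Qed.

(** The hypotheses make k a contraction with constant 1/2 for the norm of the
    maximum, which gives x + k(x) e_b an inverse and a Jacobian that is at least
    1/2. *)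
Section shear.
Context {R : realType} {n : nat}.
Local Notation Rn := 'rV[R]_n.
Local Notation mu := (@lebesgue_rV R n).
Context (b : 'I_n) (k : Rn -> R) (C : R).
Hypotheses (kC1 : C1 k) (ks : csupp k).
Hypotheses (nC : n%:R * C <= 2^-1) (dk : forall a x, `|'D_('e_a) k x| <= C).

Definition shear (b : 'I_n) (k : Rn -> R) (x : Rn) : Rn := x + k x *: 'e_b.

Let norm_e (c : R) : `|c *: 'e_b : Rn| <= `|c|.
Proof.
apply: norm_le_coord => // i; rewrite !mxE eqxx /= normrM.
by rewrite ler_piMr//; case: eqVneq => _; rewrite ?normr1 ?normr0.
Qed.

Let lipk x z : `|k x - k z| <= 2^-1 * `|x - z|.
Proof. by apply: le_trans (C1_lipschitz kC1 dk x z) _; rewrite ler_wpM2r. Qed.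

(** On each line parallel to e_b the shear is a bounded increasing perturbation of
    the identity; as it shrinks distances at most by a factor of 2, the inverse is
    Lipschitz. *)
Lemma shear_inverse : exists Psi : Rn -> Rn,
  [/\ cancel (shear b k) Psi, cancel Psi (shear b k), continuous Psi &
      forall B, (forall x, `|k x| <= B) -> forall z, `|Psi z - z| <= B].
Proof.
have ck : continuous k by case: kC1.
have [B kB] := csupp_bounded ck ks.
have surj z : exists x, shear b k x = z.
  have [|||G [_ GK]] := @bounded_perturbation_bij R (fun s => k (z + s *: 'e_b)) B.
  - exact: cts_line.
  - by move=> s; exact: kB.
  - move=> s s' ss'.
    have := lipk (z + s *: 'e_b) (z + s' *: 'e_b).
    rewrite (_ : z + s *: 'e_b - _ = (s - s') *: 'e_b); last first.
      by apply/rowP => i; rewrite !mxE; ring.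
    have := norm_e (s - s'); rewrite [`|s - s'|]ltr0_norm ?subr_lt0// => h1.
    by rewrite ler_norml => /andP[h2 h3]; lra.
  exists (z + G 0 *: 'e_b); rewrite /shear -addrA -scalerDl.
  by have := GK 0 => /= ->; rewrite scale0r addr0.
have [Psi PsiK] := choice surj.
have inj x z : `|x - z| <= 2 * `|shear b k x - shear b k z|.
  have E : x - z = (shear b k x - shear b k z) - (k x - k z) *: 'e_b.
    by apply/rowP => i; rewrite !mxE; ring.
  have : `|x - z| <= `|shear b k x - shear b k z| + `|(k x - k z) *: 'e_b : Rn|.
    by rewrite {1}E ler_normB.
  have := norm_e (k x - k z); have := lipk x z; lra.
exists Psi; split => //.
- move=> x; apply/eqP; rewrite -subr_eq0 -normr_le0.
  by apply: le_trans (inj _ _) _; rewrite PsiK subrr normr0 mulr0.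
- apply: cts_rV => z e e0; exists (e / 2) => [|w zw]; first by lra.
  by have := inj (Psi z) (Psi w); rewrite !PsiK; lra.
- move=> D kD z; rewrite -{2}(PsiK z) /shear opprD addrA subrr add0r normrN.
  exact: le_trans (norm_e _) (kD _).
Qed.

Let J x := 1 + 'D_('e_b) k x.

Lemma shear_jacobian x : 2^-1 <= J x.
Proof.
have n1 : 1 <= n%:R :> R by rewrite ler1n; case: (n) b => [[]|].
have : C <= 2^-1.
  apply: le_trans nC; rewrite ler_peMl//.
  exact: le_trans (dk b x).
by rewrite /J; have := dk b x; rewrite ler_norml => /andP[h1 h2] h3; lra.
Qed.

Lemma measurable_shear : measurable_fun setT (shear b k).
Proof.
apply: measurable_mxP => i j; rewrite ord1; under eq_fun do rewrite !mxE.
apply: continuous_measurable_rV; apply: cts_add; first exact: cts_coord.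
by apply: cts_mul; [case: kC1|exact: cts_cst].
Qed.

Lemma measurable_shear_jacobian : measurable_fun setT J.
Proof.
apply: continuous_measurable_rV; apply: cts_add; first exact: cts_cst.
by have [_ /(_ b)[_]] := kC1.
Qed.

End shear.

Section shear_change.
Context {R : realType} {n : nat}.
Local Notation Rn := 'rV[R]_n.
Local Notation mu := (@lebesgue_rV R n).

(** Fubini with the coordinate b integrated first: on each line parallel to e_b
    the shear is the map s + k(z + s e_b) of one variable, so the Jacobian is
    1 + D_b k and one-dimensional substitution suffices. *)
Local Lemma shear_measureS m (b : 'I_m.+1) (k : 'rV[R]_m.+1 -> R) (C : R) :
  C1 k -> csupp k -> m.+1%:R * C <= 2^-1 ->
  (forall a x, `|'D_('e_a) k x| <= C) ->
  forall A, measurable A -> @lebesgue_rV R m.+1 A =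
   (\int[@lebesgue_rV R m.+1]_(x in shear b k @^-1` A) (1 + 'D_('e_b) k x)%:E)%E.
Proof.
move=> kC1 ks nC dk A mA.
have [ck /(_ b)[dbk cbk]] := kC1.
have J2 := shear_jacobian b nC dk.
have J0 x : 0 < 1 + 'D_('e_b) k x by apply: lt_le_trans (J2 x).
have mS := measurable_shear b kC1.
have mJ := measurable_shear_jacobian b kC1.
have mA' : measurable (shear b k @^-1` A).
  by rewrite -[X in measurable X]setTI; exact: mS.
rewrite (@integral_preimage_indic _ _ _ (@lebesgue_rV R m.+1)).
transitivity (\int[@lebesgue_rV R m.+1]_x (\1_A x)%:E)%E.
  by rewrite integral_indic// setIT.
rewrite !(tonelli_coord b); last 4 first.
- apply/measurable_EFinP; apply: measurable_funM => //.
  by apply: (measurableT_comp _ mS); exact: measurable_indic.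
- by move=> x; rewrite lee_fin mulr_ge0// ltW.
- by apply/measurable_EFinP; exact: measurable_indic.
- by move=> x; rewrite lee_fin.
apply: eq_integral => v _.
pose z := insert_coord b (0, v).
have zE (s : R) : insert_coord b (s, v) = z + s *: 'e_b.
  by rewrite -insert_coordD add0r.
pose K s := k (z + s *: 'e_b).
have dK (s : R) : is_derive s 1 K ('D_('e_b) k (z + s *: 'e_b)).
  by apply: is_derive_line; exact: dbk.
have dF (s : R) : is_derive s 1 (fun s => s + K s) (1 + 'D_('e_b) k (z + s *: 'e_b)).
  by apply: is_deriveD.
have F'E : (fun s : R => s + K s)^`()%classic = (fun s => 1 + 'D_('e_b) k (z + s *: 'e_b)).
  by apply/funext => s; rewrite derive1E; have [_ ->] := dF s.
have cK : continuous K by exact: cts_line.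
have [B kB] := csupp_bounded ck ks.
have [||G [FG GF]] := @bounded_perturbation_bij R K B cK.
- by move=> s; exact: kB.
- move=> s s' ss'.
  apply: (@gtr0_derive1_incr _ (fun s => s + K s) s s') => //.
  + by move=> r _; rewrite F'E; exact: J0.
  + apply: continuous_subspaceT => r.
    by apply: cvgD; [exact: cvg_id|exact: cK].
pose Av : set R := [set s | A (insert_coord b (s, v))].
have mAv : measurable (Av : set (measurableTypeR R)).
  have := measurableT_comp (@measurable_insert_coord R m b)
    (measurable_fun_pair (@measurable_id _ (measurableTypeR R) setT)
      (measurable_cst v)).
  by move=> /(_ measurableT _ mA); rewrite setTI.
transitivity (@lebesgue_measure R Av).
  rewrite -[Av in RHS]setIT -integral_indic//; apply: eq_integral => s _.
rewrite (@lebesgue_substitution R (fun s => s + K s) G)//.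
- rewrite (@integral_preimage_indic _ (measurableTypeR R) _ lebesgue_measure).
  apply: eq_integral => s _; rewrite F'E zE; congr (_ * _)%:E.
  rewrite (_ : shear b k _ = insert_coord b (s + K s, v)); last first.
    by rewrite insert_coordD /shear zE.
  exact/esym/(indic_preimage R (fun s => insert_coord b (s, v)) A (s + K s)).
- rewrite F'E; apply: cts_add; first exact: cts_cst.
  exact: (@cts_line R _ _ z 'e_b cbk).
- by move=> s; rewrite F'E; exact: J0.
Qed.

Context (b : 'I_n) (k : Rn -> R) (C : R).
Hypotheses (kC1 : C1 k) (ks : csupp k).
Hypotheses (nC : n%:R * C <= 2^-1) (dk : forall a x, `|'D_('e_a) k x| <= C).

Lemma shear_measure A : measurable A ->
  mu A = (\int[mu]_(x in shear b k @^-1` A) (1 + 'D_('e_b) k x)%:E)%E.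
Proof.
move: b k kC1 ks nC dk A; case: n => [[[]//]|m] b' k' kC1' ks' nC' dk' A.
exact: (shear_measureS b' kC1' ks' nC' dk').
Qed.

Lemma shear_jacobian_gt0 x : 0 < 1 + 'D_('e_b) k x.
Proof. exact: lt_le_trans (shear_jacobian b nC dk x). Qed.

Lemma shear_transfer (f : Rn -> \bar R) : measurable_fun setT f ->
  (forall x, 0 <= f x)%E ->
  (\int[mu]_x f x = \int[mu]_x (f (shear b k x) * (1 + 'D_('e_b) k x)%:E))%E.
Proof.
apply: (@ge0_integral_weighted_image _ _ R mu) => //.
- exact: measurable_shear.
- exact: measurable_shear_jacobian.
- by move=> x; exact: ltW (shear_jacobian_gt0 x).
- exact: shear_measure.
Qed.

Lemma shear_ae (P : set Rn) : {ae mu, forall x, P x} ->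
  {ae mu, forall x, P (shear b k x)}.
Proof.
apply: (@ae_weighted_image _ _ R mu _ (fun x => 1 + 'D_('e_b) k x)) => //.
- exact: measurable_shear.
- exact: measurable_shear_jacobian.
- by move=> x; exact: ltW (shear_jacobian_gt0 x).
- exact: shear_measure.
- exact: shear_jacobian_gt0.
Qed.

Lemma shear_integrable (f : Rn -> R) : mu.-integrable setT (EFin \o f) ->
  mu.-integrable setT (EFin \o (fun x => f (shear b k x) * (1 + 'D_('e_b) k x))).
Proof.
apply: integrable_transfer.
- exact: measurable_shear.
- exact: measurable_shear_jacobian.
- by move=> x; exact: ltW (shear_jacobian_gt0 x).
- exact: shear_transfer.
Qed.

Lemma shear_Rintegral (f : Rn -> R) : mu.-integrable setT (EFin \o f) ->
  \int[mu]_x f x = \int[mu]_x (f (shear b k x) * (1 + 'D_('e_b) k x)).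
Proof.
apply: Rintegral_transfer.
- exact: measurable_shear.
- exact: measurable_shear_jacobian.
- by move=> x; exact: ltW (shear_jacobian_gt0 x).
- exact: shear_transfer.
Qed.

End shear_change.

(** * Integration of real functions on coordinate space *)

Section ae_integral.
Import HBNNSimple.
Context d (X : measurableType d) {R : realType} (m : {measure set X -> \bar R}).

Lemma ge0_integral_le (f g : X -> \bar R) : (forall x, 0 <= f x)%E ->
  (forall x, f x <= g x)%E -> (\int[m]_x f x <= \int[m]_x g x)%E.
Proof.
move=> f0 fg; have g0 x : (0 <= g x)%E := le_trans (f0 x) (fg x).
rewrite !ge0_integralTE//; apply: ge_ereal_sup => _ [h hf <-]; apply: ereal_sup_ubound.
by exists h => // x; exact: le_trans (hf x) (fg x).
Qed.

(** The integral of a nonnegative function is a supremum over simple functions,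
    which may be cut off on a null set.  This covers densities that are only known
    to be almost everywhere equal to a measurable function. *)
Let ge0_integral_ae_le (f g : X -> \bar R) : (forall x, 0 <= f x)%E ->
  (forall x, 0 <= g x)%E -> {ae m, forall x, f x = g x} ->
  (\int[m]_x f x <= \int[m]_x g x)%E.
Proof.
move=> f0 g0 [N [mN N0 fgN]]; rewrite !ge0_integralTE//.
apply: ge_ereal_sup => _ [h hf <-]; apply: ereal_sup_ubound.
have mC : measurable (~` N) by exact: measurableC.
exists (proj_nnsfun h mC).
  move=> x; rewrite -(mrestrict h mC) patchE; case: ifPn => [|_]; last exact: g0.
  rewrite inE => xN; apply: le_trans (hf x) _.
  suff -> : f x = g x by [].
  by apply: contrapT => fg; apply: xN; exact: fgN.
rewrite -!integralT_nnsfun [RHS](ge0_negligible_integral mN measurableT _ _ N0) //; last 2 first.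
- by apply/measurable_EFinP; exact: measurable_funPT.
- by move=> x _; rewrite lee_fin.
rewrite setTD [RHS]integral_mkcond; apply: eq_integral => x _.
by rewrite -mrestrict !patchE; case: ifP.
Qed.

Lemma ge0_integral_ae (f g : X -> \bar R) : (forall x, 0 <= f x)%E ->
  (forall x, 0 <= g x)%E -> {ae m, forall x, f x = g x} ->
  (\int[m]_x f x = \int[m]_x g x)%E.
Proof.
move=> f0 g0 fg; apply/eqP; rewrite eq_le !ge0_integral_ae_le//.
by apply: filterS fg => x ->.
Qed.

Lemma Rintegral_ae (D : set X) (f g : X -> R) : {ae m, forall x, f x = g x} ->
  \int[m]_(x in D) f x = \int[m]_(x in D) g x.
Proof.
move=> fg; rewrite /Rintegral; congr fine.
rewrite integral_mkcond [RHS]integral_mkcond integralE [RHS]integralE.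
by congr (_ - _)%E; apply: ge0_integral_ae => //; apply: filterS fg => x fgx;
  rewrite ?funeposE ?funenegE !patchE fgx.
Qed.

End ae_integral.

Section real_integration.
Context d (X : measurableType d) {R : realType} (m : {measure set X -> \bar R}).
Implicit Types f g : X -> R.

Lemma rint_meas f : m.-integrable setT (EFin \o f) -> measurable_fun setT f.
Proof. by move=> /integrableP[/measurable_EFinP]. Qed.

Lemma rint_dom f g : measurable_fun setT f -> (forall x, `|f x| <= g x) ->
  m.-integrable setT (EFin \o g) -> m.-integrable setT (EFin \o f).
Proof.
move=> mf fg; apply: le_integrable => //; first exact/measurable_EFinP.
by move=> x _ /=; rewrite lee_fin (le_trans (fg x))// ler_norm.
Qed.

Lemma rintD f g : m.-integrable setT (EFin \o f) ->
  m.-integrable setT (EFin \o g) ->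
  m.-integrable setT (EFin \o (fun x => f x + g x)).
Proof. by move=> fi gi; exact: (integrableD measurableT fi gi). Qed.

Lemma rintB f g : m.-integrable setT (EFin \o f) ->
  m.-integrable setT (EFin \o g) ->
  m.-integrable setT (EFin \o (fun x => f x - g x)).
Proof. by move=> fi gi; exact: (integrableB measurableT fi gi). Qed.

Lemma rintZ (c : R) f : m.-integrable setT (EFin \o f) ->
  m.-integrable setT (EFin \o (fun x => c * f x)).
Proof. by move=> fi; exact: (integrableZl measurableT c fi). Qed.

Lemma rintN f : m.-integrable setT (EFin \o f) ->
  m.-integrable setT (EFin \o (fun x => - f x)).
Proof. by move=> /(rintZ (-1)); apply: eq_integrable => // x _ /=; rewrite mulN1r. Qed.

Lemma rint0 : m.-integrable setT (EFin \o (fun _ : X => 0 : R)).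
Proof. exact: integrable0. Qed.

Lemma rint_norm f : m.-integrable setT (EFin \o f) ->
  m.-integrable setT (EFin \o (fun x => `|f x|)).
Proof. by move=> /integrable_abse; apply: eq_integrable. Qed.

Lemma rint_sum (I : Type) (r : seq I) (P : pred I) (F : I -> X -> R) :
  (forall i, m.-integrable setT (EFin \o F i)) ->
  m.-integrable setT (EFin \o (fun x => \sum_(i <- r | P i) F i x)).
Proof.
move=> Fi; elim: r => [|i r IH].
  by apply: eq_integrable rint0 => // x _ /=; rewrite big_nil.
have := IH; case Pi : (P i) => IH'; last first.
  by apply: eq_integrable IH' => // x _ /=; rewrite big_cons Pi.
by apply: eq_integrable (rintD (Fi i) IH') => // x _ /=; rewrite big_cons Pi.
Qed.

Lemma Rint_sum (I : Type) (r : seq I) (P : pred I) (F : I -> X -> R) :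
  (forall i, m.-integrable setT (EFin \o F i)) ->
  \int[m]_x (\sum_(i <- r | P i) F i x) = \sum_(i <- r | P i) \int[m]_x F i x.
Proof.
move=> Fi; elim: r => [|i r IH].
  by under eq_Rintegral do rewrite big_nil; rewrite big_nil /Rintegral integral0.
rewrite big_cons; case Pi : (P i); under eq_Rintegral do rewrite big_cons Pi.
  by rewrite RintegralD// ?IH//; exact: rint_sum.
by rewrite IH.
Qed.

Lemma Rint0 : \int[m]_x (0 : R) = 0.
Proof. by rewrite /Rintegral integral0. Qed.

Lemma RintN f : m.-integrable setT (EFin \o f) ->
  \int[m]_x (- f x) = - \int[m]_x f x.
Proof.
move=> fi; rewrite -[RHS]mulN1r -RintegralZl//.
by apply: eq_Rintegral => x _; rewrite mulN1r.
Qed.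

Lemma Rint_EFin f : m.-integrable setT (EFin \o f) ->
  (\int[m]_x (f x)%:E = (\int[m]_x f x)%:E)%E.
Proof. by move=> fi; rewrite /Rintegral fineK//; exact: integrable_fin_num. Qed.

Lemma rint_ae_eq f g : measurable_fun setT g ->
  {ae m, forall x, f x = g x} -> m.-integrable setT (EFin \o f) ->
  m.-integrable setT (EFin \o g).
Proof.
move=> mg fg /integrableP[/measurable_EFinP mf foo]; apply/integrableP; split.
  exact/measurable_EFinP.
apply: le_lt_trans foo; rewrite le_eqVlt; apply/orP; left; apply/eqP.
apply: ae_eq_integral => //.
- by apply/measurable_EFinP; exact: measurableT_comp.
- by apply/measurable_EFinP; exact: measurableT_comp.
- by apply: filterS fg => x /= ->.
Qed.

Lemma integral_supp (D : set X) (f : X -> \bar R) :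
  (forall x, ~ D x -> f x = 0%E) -> (\int[m]_x f x = \int[m]_(x in D) f x)%E.
Proof.
move=> fD; rewrite [RHS]integral_mkcond; apply: eq_integral => x _.
by rewrite patchE; case: ifPn => // /negP xD; rewrite fD// => /mem_set.
Qed.

Lemma Rint_supp (D : set X) f :
  (forall x, ~ D x -> f x = 0) -> \int[m]_x f x = \int[m]_(x in D) f x.
Proof. by move=> fD; congr fine; apply: integral_supp => x /fD ->. Qed.

Lemma Rint_dct (f_ : nat -> X -> R) f g :
  (forall k, measurable_fun setT (f_ k)) ->
  (forall x, f_ ^~ x @ \oo --> f x) ->
  (forall k x, `|f_ k x| <= g x) -> m.-integrable setT (EFin \o g) ->
  m.-integrable setT (EFin \o f) /\
  \int[m]_x f_ k x @[k --> \oo] --> \int[m]_x f x.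
Proof.
move=> mf_ cvf fg ig.
have mf : measurable_fun setT f.
  by apply: (measurable_fun_cvg mf_) => x _; exact: cvf.
have H1 k : measurable_fun setT (fun x => (f_ k x)%:E) by exact/measurable_EFinP.
have H2 : measurable_fun setT (EFin \o f) by exact/measurable_EFinP.
have H3 : {ae m, forall x, setT x -> (f_ k x)%:E @[k --> \oo] --> (EFin \o f) x}.
  by apply: aeW => x _; apply: cvg_EFin; [exact: nearW|exact: cvf].
have H4 : {ae m, forall x (k : nat), setT x -> (`|(f_ k x)%:E| <= (EFin \o g) x)%E}.
  by apply: aeW => x k _; rewrite lee_fin.
have [fi _ cv] := dominated_convergence measurableT H1 H2 H3 ig H4.
by split=> //; apply: fine_cvg; rewrite -Rint_EFin.
Qed.

Lemma integral_eq0_ae f : measurable_fun setT f -> (forall x, 0 <= f x) ->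
  (\int[m]_x (f x)%:E = 0)%E -> {ae m, forall x, f x = 0}.
Proof.
move=> mf f0 E.
have /(ae_eq_integral_abs m measurableT) : measurable_fun setT (EFin \o f).
  exact/measurable_EFinP.
move=> [+ _]; move=> /(_ _)[|A hA]; last first.
  by exists A; case: hA => mA A0 hA; split=> // x nfx; apply: hA => /= /(_ I)[].
by rewrite -[RHS]E; apply: eq_integral => x _ /=; rewrite ger0_norm.
Qed.

End real_integration.

Section integration_by_parts.
Context {R : realType} {n : nat}.
Local Notation Rn := 'rV[R]_n.
Local Notation mu := (@lebesgue_rV R n).
Implicit Types (u w f g : Rn -> R).

Lemma ball_lty (M : R) : (mu [set x | (`|x| <= M)%R] < +oo)%E.
Proof.
have mB : measurable [set x : Rn | `|x| <= M].
  by apply: compact_measurable_rV; exact: compact_ball_norm.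
apply: le_lt_trans (lebesgue_open_box_lty (const_mx (- (M + 1))) (const_mx (M + 1))).
apply: le_measure; rewrite ?inE//; first exact: measurable_open_box.
move=> x /= xM i; rewrite !mxE -ltr_norml.
by apply: le_lt_trans (coord_le_norm x i) _; rewrite (le_lt_trans xM)// ltrDl.
Qed.

Lemma Lploc1_cst (c : R) : Lploc 1 (fun _ : Rn => c).
Proof.
split; first exact: measurable_cst.
move=> D cD; rewrite integral_cst; last exact: compact_measurable_rV.
apply: lte_mul_pinfty => //.
have [M [Mr DM]] := compact_bounded cD.
apply: le_lt_trans (ball_lty (M + 1)); apply: le_measure; rewrite ?inE.
- exact: compact_measurable_rV.
- by apply: compact_measurable_rV; exact: compact_ball_norm.
- by move=> x Dx; apply: (DM (M + 1)) => //; rewrite ltrDl.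
Qed.

Lemma rint_loc u w (B : R) : Lploc 1 u -> measurable_fun setT w ->
  (forall x, `|w x| <= B) -> csupp w ->
  mu.-integrable setT (EFin \o (fun x => u x * w x)).
Proof.
move=> [mu' Du] mw wB [M wM].
pose D := [set x : Rn | `|x| <= M].
have cD : compact D by exact: compact_ball_norm.
have mD : measurable D by exact: compact_measurable_rV.
apply/integrableP; split.
  by apply/measurable_EFinP; apply: measurable_funM.
rewrite (@integral_supp _ _ _ mu D); last first.
  by move=> x /negP; rewrite -ltNge => /wM /= ->; rewrite mulr0 normr0.
apply: (@le_lt_trans _ _ (\int[mu]_(x in D) (B%:E * (`|u x| `^ 1)%:E))%E).
  apply: ge0_le_integral => //.
  - by apply/measurable_EFinP; apply: measurableT_comp => //; apply/measurable_funTS/measurable_funM.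
  - apply/measurable_EFinP; apply: measurable_funM => //.
    apply/measurable_funTS/(measurableT_comp (f := @powR R ^~ 1)) => //.
    by apply: measurableT_comp.
  - move=> x _; rewrite -EFinM lee_fin normrM powRr1// mulrC ler_wpM2r//.
rewrite ge0_integralZl//.
- apply: lte_mul_pinfty => //; first by rewrite lee_fin (le_trans _ (wB 0)).
  exact: Du.
- apply/measurable_EFinP/measurable_funTS/(measurableT_comp (f := @powR R ^~ 1)) => //.
  by apply: measurableT_comp.
- by rewrite lee_fin (le_trans _ (wB 0)).
Qed.

Lemma rint_loc_cts u w : Lploc 1 u -> continuous w -> csupp w ->
  mu.-integrable setT (EFin \o (fun x => u x * w x)).
Proof.
move=> u1 cw sw; have [B wB] := csupp_bounded cw sw.
by apply: (rint_loc u1 _ wB sw); exact: continuous_measurable_rV.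
Qed.

Lemma rint_cts w : continuous w -> csupp w -> mu.-integrable setT (EFin \o w).
Proof.
move=> cw sw; apply: eq_integrable (rint_loc_cts (Lploc1_cst 1) cw sw) => //.
by move=> x _ /=; rewrite mul1r.
Qed.

(** The fundamental theorem of calculus on an interval that contains the support. *)
Lemma integral_derivative_csupp1 (K K' : R -> R) (M : R) :
  (forall s : R, is_derive s 1 K (K' s)) -> continuous K' ->
  (forall s, M < `|s| -> K s = 0 /\ K' s = 0) ->
  (\int[@lebesgue_measure R]_s (K' s)%:E = 0)%E.
Proof.
move=> dK cK' KM; pose N := `|M| + 1.
have NM : M < `|N|.
  by rewrite ger0_norm ?addr_ge0// (le_lt_trans (ler_norm M))// ltrDl.
have N0 : 0 < N by rewrite /N ltr_wpDl.
rewrite (@integral_supp _ (measurableTypeR R) _ lebesgue_measure `[- N, N]%classic); last first.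
  move=> s; rewrite /= in_itv /= -ler_norml => /negP; rewrite -ltNge => Ns.
  by rewrite (KM s _).2// (lt_trans NM)// gtr0_norm.
have cK : continuous K.
  move=> s; apply: differentiable_continuous; apply/derivable1_diffP.
  by have [] := dK s.
rewrite (@continuous_FTC2 _ K' K) => [||||s _].
- by rewrite !(KM _ _).1 ?normrN// subee.
- lra.
- exact: continuous_subspaceT.
- split=> [x _| |]; first by have [] := dK x.
  + by apply: cvg_at_right_filter; exact: cK.
  + by apply: cvg_at_left_filter; exact: cK.
- by rewrite derive1E; have [_ ->] := dK s.
Qed.

End integration_by_parts.

(** Fubini, the differentiated coordinate being integrated first. *)
Lemma integral_derive_csupp {R : realType} n (w : 'rV[R]_n -> R) a :
  C1 w -> csupp w -> \int[@lebesgue_rV R n]_x 'D_('e_a) w x = 0.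
Proof.
case: n => [|n] in w a *; first by case: a.
move=> [cw /(_ a)[dw cdw]] sw.
have sdw := csupp_derive 'e_a sw.
rewrite /Rintegral (fubini_coord a); last exact: rint_cts.
rewrite integral0_eq// => v _.
pose z := insert_coord a (0, v).
have zE (s : R) : insert_coord a (s, v) = z + s *: 'e_a.
  by rewrite -insert_coordD add0r.
under eq_integral do rewrite zE.
have [M wM] := sw; have [M' wM'] := sdw.
apply: (@integral_derivative_csupp1 R (fun s => w (z + s *: 'e_a)) _ (Num.max M M')).
- by move=> s; apply: is_derive_line.
- exact: (@cts_line R _ _ z 'e_a cdw).
- move=> s; rewrite gt_max => /andP[Ms M's].
  have sz : `|s| <= `|z + s *: 'e_a|.
    by rewrite -zE -{1}[s](insert_coord_self a (s, v)) coord_le_norm.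
  by rewrite wM ?(lt_le_trans Ms)// wM' ?(lt_le_trans M's).
Qed.

Lemma integration_by_parts_rV {R : realType} n (f w : 'rV[R]_n -> R) a :
  C1 f -> C1 w -> csupp w ->
  \int[@lebesgue_rV R n]_x (f x * 'D_('e_a) w x) =
  - \int[@lebesgue_rV R n]_x ('D_('e_a) f x * w x).
Proof.
move=> fC wC sw.
have [cf /(_ a)[df cdf]] := fC; have [cw /(_ a)[dw cdw]] := wC.
have sdw := csupp_derive 'e_a sw.
have := integral_derive_csupp a (C1M fC wC) (csuppMr f sw).
under eq_Rintegral => x _.
  rewrite (_ : 'D_('e_a) _ x = f x * 'D_('e_a) w x + 'D_('e_a) f x * w x); last first.
    by rewrite (deriveM (df x) (dw x)) /GRing.scale /= [w x * _]mulrC.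
  over.
rewrite RintegralD//; last 2 first.
- by apply: rint_cts; [exact: cts_mul|exact: csuppMr].
- by apply: rint_cts; [exact: cts_mul|exact: csuppMr].
by move/eqP; rewrite addr_eq0 => /eqP.
Qed.

(** * Smooth functions *)

Section smooth_closure.
Context {R : realType} {V : normedModType R}.

Lemma is_derive_val (W : normedModType R) (f : V -> W) x v a b :
  is_derive x v f a -> a = b -> is_derive x v f b.
Proof. by move=> h <-. Qed.

Lemma near_eq_continuous (W : topologicalType) (f g : V -> W) x :
  (\forall y \near x, g y = f y) -> {for x, continuous g} -> {for x, continuous f}.
Proof.
move=> gf; rewrite /prop_for /continuous_at -(nbhs_singleton gf) => cg.
by apply: cvg_trans cg; exact: near_eq_cvg.
Qed.

(** Coinduction: a class of functions that is closed under directional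
    derivatives consists of smooth functions. *)
Lemma smooth_on_coind (W : normedModType R) (U : set V) (P : set (V -> W)) :
  open U ->
  (forall f x, P f -> U x -> {for x, continuous f} /\ forall v, derivable f x v) ->
  (forall f v, P f -> exists2 g, P g & forall x, U x -> 'D_v f x = g x) ->
  forall f, P f -> smooth_on U f.
Proof.
move=> oU Pc PD f Pf vs x Ux.
have [g Pg fg] : exists2 g, P g & forall x, U x -> iter_derive vs f x = g x.
  elim: vs => [|v vs [g Pg fg]] /=; first by exists f.
  have [h Ph gh] := PD _ v Pg; exists h => // y Uy; rewrite -gh//.
  by apply: near_eq_derive; apply: filterS (open_nbhs_nbhs (conj oU Uy)).
have [cg dg] := Pc _ _ Pg Ux.
have nfg : \forall y \near x, g y = iter_derive vs f y.
  by apply: filterS (open_nbhs_nbhs (conj oU Ux)) => y /fg ->.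
split=> [|v]; last exact: near_eq_derivable nfg (dg v).
exact: near_eq_continuous nfg cg.
Qed.

Lemma smooth_on_derive (W : normedModType R) (U : set V) (f : V -> W) v :
  smooth_on U f -> smooth_on U ('D_v f).
Proof.
have E vs : iter_derive vs ('D_v f) = iter_derive (rcons vs v) f.
  by elim: vs => //= w vs ->.
by move=> sf vs x Ux; rewrite E; exact: sf.
Qed.

Lemma smooth_on_continuous (W : normedModType R) (U : set V) (f : V -> W) :
  smooth_on U f -> forall x, U x -> {for x, continuous f}.
Proof. by move=> sf x Ux; have [] := sf [::] x Ux. Qed.

Lemma smooth_on_derivable (W : normedModType R) (U : set V) (f : V -> W) :
  smooth_on U f -> forall x v, U x -> derivable f x v.
Proof. by move=> sf x v Ux; have [] := sf [::] x Ux. Qed.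

End smooth_closure.

Section smooth_algebra.
Context {R : realType} {V : normedModType R}.

(** The algebra generated by B, closed also under inverses, exponentials and
    substitution of affine forms in smooth functions of one variable. *)
Inductive smooth_algebra (B : set (V -> R)) (U : set V) : (V -> R) -> Prop :=
| smooth_gen f : B f -> smooth_algebra B U f
| smooth_cst c : smooth_algebra B U (fun=> c)
| smooth_add f g : smooth_algebra B U f -> smooth_algebra B U g ->
    smooth_algebra B U (fun x => f x + g x)
| smooth_mul f g : smooth_algebra B U f -> smooth_algebra B U g ->
    smooth_algebra B U (fun x => f x * g x)
| smooth_inv f : smooth_algebra B U f -> (forall x, U x -> f x != 0) ->
    smooth_algebra B U (fun x => (f x)^-1)
| smooth_exp f : smooth_algebra B U f -> smooth_algebra B U (fun x => expR (f x))
| smooth_affine (h : R -> R) (l l' : V -> R) : smooth_on setT h ->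
    continuous l -> (forall x v, is_derive x v l (l' v)) ->
    smooth_algebra B U (fun x => h (l x))
| smooth_ext f g : smooth_algebra B U f -> (forall x, U x -> f x = g x) ->
    smooth_algebra B U g.

Lemma is_derive_comp1 (h : R -> R) (l : V -> R) (x v : V) (a b : R) :
  is_derive x v l a -> is_derive (l x) 1 h b ->
  is_derive x v (fun y => h (l y)) (b * a).
Proof.
move=> dl dh.
have El (s : R) : l (s *: v + x) = (fun s : R => l (x + s *: v)) s by rewrite addrC.
have dl0 : is_derive (0 : R) 1 (fun s : R => l (s *: v + x)) a.
  have [dlx <-] := dl; split; first exact: (derivable1P l x v).1 dlx.
  by rewrite /derive; under eq_fun do rewrite /= addr0 scaler1 scale0r add0r.
have dh0 : is_derive ((fun s : R => l (s *: v + x)) 0) 1 h b.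
  by rewrite scale0r add0r.
have [dc Dc] := @is_derive1_comp _ h (fun s : R => l (s *: v + x)) 0 _ _ dh0 dl0.
split; first exact: (derivable1P (fun y => h (l y)) x v).2 dc.
rewrite -Dc /derive /comp.
by under [in RHS]eq_fun do rewrite /= addr0 scaler1 scale0r add0r.
Qed.

(** The derivative of an expression is an expression again, as soon as this holds
    for the generators: coinduction applies. *)
Lemma smooth_algebra_on (B : set (V -> R)) (U : set V) : open U ->
  (forall f x, B f -> U x -> {for x, continuous f} /\ forall v, derivable f x v) ->
  (forall f v, B f -> exists2 g, smooth_algebra B U g &
     forall x, U x -> 'D_v f x = g x) ->
  forall f, smooth_algebra B U f -> smooth_on U f.
Proof.
move=> oU Bc BD.
have near_U x : U x -> \forall y \near x, U y.
  by move=> Ux; exact: open_nbhs_nbhs.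
have cts f x : smooth_algebra B U f -> U x ->
    {for x, continuous f} /\ forall v, derivable f x v.
  move=> + Ux; elim=> {f}.
  - by move=> f Bf; exact: Bc.
  - by move=> c; split=> [|v]; [exact: cvg_cst|exact: derivable_cst].
  - move=> f g _ [cf df] _ [cg dg]; split=> [|v]; first exact: cvgD.
    exact: derivableD.
  - move=> f g _ [cf df] _ [cg dg]; split=> [|v]; first exact: cvgM.
    exact: derivableM.
  - move=> f _ [cf df] f0; split=> [|v]; last exact: derivableV (f0 _ Ux) _.
    by apply: cvgV => //; exact: f0.
  - move=> f _ [cf df]; split=> [|v].
      by apply: continuous_comp cf _; exact: continuous_expR.
    by have [] := is_derive_comp1 (derivableP (df v)) (is_derive_expR (f x)).
  - move=> h l l' sh cl dl; split=> [|v].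
      by apply: continuous_comp (cl x) _; exact: (smooth_on_continuous sh I).
    have dh := (sh [::] (l x) I).2 1.
    by have [] := is_derive_comp1 (dl x v) (derivableP dh).
  - move=> f g _ [cf df] fg.
    have nfg : \forall y \near x, f y = g y by apply: filterS (near_U _ Ux).
    split=> [|v]; last exact: near_eq_derivable nfg (df v).
    exact: near_eq_continuous nfg cf.
apply: smooth_on_coind => // f v.
elim=> {f}.
- by move=> f Bf; have [g] := BD f v Bf; exists g.
- by move=> c; exists (fun=> 0); [exact: smooth_cst|move=> x Ux; exact: derive_cst].
- move=> f g Af [f' Af' ff'] Ag [g' Ag' gg'].
  exists (fun x => f' x + g' x); first exact: smooth_add.
  move=> x Ux; rewrite -ff'// -gg'//.
  by apply: deriveD; [have [_] := cts f x Af Ux|have [_] := cts g x Ag Ux].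
- move=> f g Af [f' Af' ff'] Ag [g' Ag' gg'].
  exists (fun x => f x * g' x + g x * f' x).
    by apply: smooth_add; exact: smooth_mul.
  move=> x Ux; rewrite -ff'// -gg'//.
  by apply: deriveM; [have [_] := cts f x Af Ux|have [_] := cts g x Ag Ux].
- move=> f Af [f' Af' ff'] f0.
  exists (fun x => - 1 * (f x)^-1 * (f x)^-1 * f' x).
    apply: smooth_mul => //; apply: smooth_mul; last exact: smooth_inv.
    by apply: smooth_mul; [exact: smooth_cst|exact: smooth_inv].
  move=> x Ux; have [_ df] := cts f x Af Ux.
  rewrite deriveV ?f0// ff'// /GRing.scale /=; congr (_ * _).
  by rewrite -mulrA -invfM -expr2 mulN1r.
- move=> f Af [f' Af' ff']; exists (fun x => expR (f x) * f' x).
    by apply: smooth_mul => //; exact: smooth_exp.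
  move=> x Ux; have [_ df] := cts f x Af Ux; rewrite -ff'//.
  by have [_ ->] := is_derive_comp1 (derivableP (df v)) (is_derive_expR (f x)).
- move=> h l l' sh cl dl; exists (fun x => 'D_1 h (l x) * l' v).
    apply: smooth_mul; last exact: smooth_cst.
    by apply: (@smooth_affine B U ('D_1 h) l l' _ cl dl); exact: smooth_on_derive.
  move=> x Ux; have dh := (sh [::] (l x) I).2 1.
  by have [_ ->] := is_derive_comp1 (dl x v) (derivableP dh).
- move=> f g Af [f' Af' ff'] fg; exists f' => // x Ux; rewrite -ff'//.
  by apply: near_eq_derive; apply: filterS (near_U _ Ux) => y Uy; rewrite fg.
Qed.

Lemma smooth_algebra_smooth (U : set V) (f : V -> R) : open U ->
  smooth_algebra (smooth_on U) U f -> smooth_on U f.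
Proof.
move=> oU; apply: smooth_algebra_on => //.
- move=> g x sg Ux; split; first exact: smooth_on_continuous sg _ Ux.
  by move=> v; exact: smooth_on_derivable sg _ _ Ux.
- move=> g v sg; exists ('D_v g) => //.
  by apply: smooth_gen; exact: smooth_on_derive.
Qed.

Lemma smooth_onM (U : set V) (f g : V -> R) : open U ->
  smooth_on U f -> smooth_on U g -> smooth_on U (fun x => f x * g x).
Proof.
by move=> oU sf sg; apply: (smooth_algebra_smooth oU); apply: smooth_mul; apply: smooth_gen.
Qed.

Lemma smooth_onD (U : set V) (f g : V -> R) : open U ->
  smooth_on U f -> smooth_on U g -> smooth_on U (fun x => f x + g x).
Proof.
by move=> oU sf sg; apply: (smooth_algebra_smooth oU); apply: smooth_add; apply: smooth_gen.
Qed.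

Lemma smooth_onV (U : set V) (f : V -> R) : open U ->
  smooth_on U f -> (forall x, U x -> f x != 0) -> smooth_on U (fun x => (f x)^-1).
Proof.
by move=> oU sf f0; apply: (smooth_algebra_smooth oU); apply: smooth_inv => //; apply: smooth_gen.
Qed.

Lemma smooth_on_cst (U : set V) (c : R) : open U ->
  smooth_on U (fun=> c).
Proof. by move=> oU; apply: (smooth_algebra_smooth oU); exact: smooth_cst. Qed.

End smooth_algebra.

Section bump.
Context {R : realType}.

(** The family x^-k exp(-1/x) is closed under derivatives up to linear
    combinations, which gives smoothness of all its members at once. *)
Definition flat (k : nat) (x : R) : R :=
  if 0 < x then x ^- k * expR (- x^-1) else 0.

Lemma flat_ge0 k x : 0 <= flat k x.
Proof.
by rewrite /flat; case: ifP => // x0; rewrite mulr_ge0 ?expR_ge0// invr_ge0 exprn_ge0// ltW.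
Qed.

(** Since exp y dominates (y / (k+1))^(k+1), with y = 1/x. *)
Lemma flat_le k x : `|flat k x| <= k.+1%:R ^+ k.+1 * `|x|.
Proof.
rewrite ger0_norm ?flat_ge0// /flat; case: ltP => x0; last by rewrite mulr_ge0 ?exprn_ge0.
set y := x^-1; have y0 : 0 < y by rewrite invr_gt0.
have E : (y / k.+1%:R) ^+ k.+1 <= expR y.
  have -> : expR y = expR (y / k.+1%:R) ^+ k.+1.
    by rewrite -expRM_natl mulrC divfK// pnatr_eq0.
  rewrite lerXn2r ?nnegrE ?expR_ge0//.
    by rewrite divr_ge0// ltW.
  by apply: le_trans (expR_ge1Dx _); rewrite lerDr.
have K0 : k.+1%:R ^+ k.+1 != 0 :> R by rewrite expf_neq0// pnatr_eq0.
rewrite gtr0_norm// expRN ler_pdivrMr ?expR_gt0//.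
apply: le_trans (_ : k.+1%:R ^+ k.+1 * x * (y / k.+1%:R) ^+ k.+1 <= _); last first.
  by rewrite ler_pM2l// mulr_gt0// exprn_gt0// ltr0n.
rewrite expr_div_n [y ^+ _]exprS -exprVn -/y.
rewrite (_ : _ * _ * _ = (k.+1%:R ^+ k.+1 / k.+1%:R ^+ k.+1) * (x * y) * y ^+ k); last by ring.
by rewrite !mulfV ?mul1r// gt_eqF.
Qed.

Lemma is_derive_flat k (x : R) :
  is_derive x 1 (flat k) (- k%:R * flat k.+1 x + flat k.+2 x).
Proof.
have [x0|x0|->] := ltgtP x 0.
- have nx : \forall y \near x, cst 0 y = flat k y.
    have : \forall y \near x, y < 0 by exact: lt_nbhsl.
    by apply: filterS => y y0; rewrite /flat ltNge ltW.
  have E j : flat j x = 0 by rewrite /flat ltNge ltW.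
  by rewrite !E mulr0 addr0; exact: (near_eq_is_derive nx).
- have nx : \forall y \near x, (y^-1) ^+ k * expR (- y^-1) = flat k y.
    have : \forall y \near x, 0 < y by exact: lt_nbhsr.
    by apply: filterS => y y0; rewrite /flat y0 exprVn.
  apply: (near_eq_is_derive nx).
  have xn0 : x != 0 by rewrite gt_eqF.
  have dV : is_derive x 1 (fun y : R => y^-1) (- (x^-1) ^+ 2).
    apply: (is_derive_val (is_deriveV (f := id) xn0 (is_derive_id x 1))).
    by rewrite /GRing.scale /= mulr1 exprVn.
  have dG : is_derive (x^-1) 1 (fun w : R => w ^+ k * expR (- w))
      (k%:R * x^-1 ^+ k.-1 * expR (- x^-1) - x^-1 ^+ k * expR (- x^-1)).
    have dE : is_derive (x^-1) 1 (fun w : R => expR (- w)) (- expR (- x^-1)).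
      by apply: is_derive_eq; rewrite mulrN1.
    have dX : is_derive (x^-1) 1 (fun w : R => w ^+ k) (k%:R * x^-1 ^+ k.-1).
      split; first exact: exprn_derivable.
      by rewrite exp_derive /GRing.scale /= mulr1.
    apply: (is_derive_val (is_deriveM dX dE)).
    by rewrite /GRing.scale /=; ring.
  apply: (is_derive_val (is_derive1_comp dG dV)).
  rewrite /flat x0 -!exprVn; case: (k) => [|j]; first by rewrite expr0; ring.
  by rewrite /= !exprS; ring.
- have E j : flat j (0 : R) = 0 by rewrite /flat ltxx.
  rewrite !E mulr0 addr0.
  have F0 : flat k.+1 h @[h --> (0 : R)] --> (0 : R).
    apply/cvgrPdist_lt => e e0; set K := k.+2%:R ^+ k.+2 : R.
    have K0 : 0 < K by rewrite exprn_gt0// ltr0n.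
    have eK : 0 < e / K by rewrite divr_gt0.
    apply: filterS (nbhsx_ballx (0 : R) _ eK) => h.
    rewrite /ball /= !sub0r !normrN ltr_pdivlMr// mulrC => hK.
    exact: le_lt_trans (flat_le _ _) hK.
  have cv : h^-1 *: ((flat k \o shift 0) (h *: (1 : R)) - flat k 0) @[h --> 0^'] --> (0 : R).
    have : flat k.+1 h @[h --> 0^'] --> (0 : R) by apply: cvg_within_filter.
    apply: cvg_trans; apply: near_eq_cvg; near=> h.
    rewrite /= addr0 scaler1 E subr0 /flat /GRing.scale /=.
    by case: ifP; rewrite ?mulr0// => h0; rewrite mulrA exprS invfM.
  split; first exact: cvgP cv.
  exact: cvg_lim cv.
Unshelve. all: by end_near. Qed.

Lemma smooth_flat k : smooth_on setT (flat k).
Proof.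
apply: (@smooth_algebra_on R R [set f | exists k, f = flat k] setT openT).
- move=> _ x [j ->] _; have dj := is_derive_flat j x; split.
    by apply: differentiable_continuous; apply/derivable1_diffP.
  by move=> v; apply: diff_derivable; apply/derivable1_diffP.
- move=> _ v [j ->].
  exists (fun x => v * (- j%:R * flat j.+1 x + flat j.+2 x)).
    by apply: smooth_mul; [exact: smooth_cst|apply: smooth_add; [apply: smooth_mul; [exact: smooth_cst|]|]; apply: smooth_gen; eexists].
  move=> x _; have dj := is_derive_flat j x.
  have df : differentiable (flat j) x by apply/derivable1_diffP.
  rewrite deriveE// -[v in LHS]mulr1 -[v * 1]/(v *: 1) linearZ -deriveE//.
  by have [_ ->] := dj.
- by apply: smooth_gen; exists k.
Qed.

Definition bump (a b x : R) : R := flat 0 (x - a) * flat 0 (b - x).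

Lemma is_derive_affine (c e : R) (x v : R) :
  is_derive x v (fun x => e + c * x) (c * v).
Proof.
have h : is_derive x v (fun x => c * x) (c * v).
  exact: (@is_deriveZ _ _ _ id c x v v (is_derive_id x v)).
apply: (is_derive_val (is_deriveD (is_derive_cst e x v) h)).
by rewrite add0r.
Qed.

Lemma smooth_bump a b : smooth_on setT (bump a b).
Proof.
apply: (smooth_algebra_smooth openT); apply: smooth_mul.
- apply: (@smooth_ext R R (smooth_on setT) setT (fun x : R => flat 0 (- a + 1 * x))).
    apply: (@smooth_affine R R (smooth_on setT) setT (flat 0) (fun x : R => - a + 1 * x) (fun v : R => 1 * v)).
    + exact: smooth_flat.
    + apply: cts_add; first exact: cts_cst.
      by apply: cts_mul; [exact: cts_cst|move=> x; exact: cvg_id].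
    + by move=> x v; exact: is_derive_affine.
  by move=> x _; rewrite mul1r addrC.
- apply: (@smooth_ext R R (smooth_on setT) setT (fun x : R => flat 0 (b + -1 * x))).
    apply: (@smooth_affine R R (smooth_on setT) setT (flat 0) (fun x : R => b + -1 * x) (fun v : R => -1 * v)).
    + exact: smooth_flat.
    + apply: cts_add; first exact: cts_cst.
      by apply: cts_mul; [exact: cts_cst|move=> x; exact: cvg_id].
    + by move=> x v; exact: is_derive_affine.
  by move=> x _; rewrite mulN1r.
Qed.

Lemma bump_ge0 a b x : 0 <= bump a b x.
Proof. by rewrite mulr_ge0 ?flat_ge0. Qed.

Lemma bump_eq0 a b x : x <= a \/ b <= x -> bump a b x = 0.
Proof.
rewrite /bump /flat !subr_gt0 => -[ax|bx].
  by rewrite [in a < x]ltNge ax mul0r.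
by rewrite [in x < b]ltNge bx mulr0.
Qed.

Lemma bump_gt0 a b x : a < x < b -> 0 < bump a b x.
Proof.
move=> /andP[ax xb]; rewrite /bump /flat !subr_gt0 ax xb.
by rewrite !expr0 invr1 !mul1r mulr_gt0 ?expR_gt0.
Qed.

End bump.

Section product_functions.
Context {R : realType} {n : nat}.
Local Notation Rn := 'rV[R]_n.

Lemma is_derive_coord (i : 'I_n) (x v : Rn) :
  is_derive x v (fun x : Rn => x 0 i) (v 0 i).
Proof.
have dx : derivable id x v by exact: derivable_id.
split; first exact: (derivable_mxP (id : Rn -> Rn) x v).1 dx 0 i.
by have := derive_mx dx; rewrite derive_id => /rowP /(_ i); rewrite mxE.
Qed.

(** Products of functions of the single coordinates: the form of all cut-offs and
    mollifiers below. *)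
Definition product_fun (g : 'I_n -> R -> R) (x : Rn) : R := \prod_i g i (x 0 i).

Lemma smooth_product_fun g : (forall i, smooth_on setT (g i)) ->
  smooth_on setT (product_fun g).
Proof.
move=> sg; apply: (smooth_algebra_smooth openT).
rewrite /product_fun; elim: (index_enum _) => [|i s IH].
  by apply: (@smooth_ext R Rn (smooth_on setT) setT (fun=> 1)); [exact: smooth_cst|move=> x _; rewrite big_nil].
apply: (@smooth_ext R Rn (smooth_on setT) setT (fun x : Rn => g i (x 0 i) * \prod_(i <- s) g i (x 0 i))).
  apply: smooth_mul IH.
  apply: (@smooth_affine R Rn (smooth_on setT) setT (g i) (fun x : Rn => x 0 i) (fun v : Rn => v 0 i)) => //.
    exact: cts_coord.
  by move=> x v; exact: is_derive_coord.
by move=> x _; rewrite big_cons.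
Qed.

Lemma smooth_C1 (f : Rn -> R) : smooth_on setT f -> C1 f.
Proof.
move=> sf; split=> [x|a]; first exact: (sf [::] x I).1.
by split=> x; [exact: (sf [::] x I).2|exact: (sf [:: 'e_a] x I).1].
Qed.

Lemma csupp_test (f : Rn -> R) : smooth_on setT f -> csupp f -> test_function f.
Proof.
move=> sf [M fM]; split=> //; exists [set x | `|x| <= M]; first exact: compact_ball_norm.
by move=> x /negP; rewrite -ltNge; exact: fM.
Qed.

Lemma test_csupp (f : Rn -> R) : test_function f -> csupp f.
Proof.
move=> [_ [D cD fD]]; have [M [_ DM]] := compact_bounded cD.
exists (M + 1) => x Mx; apply: fD => Dx.
have := DM (M + 1); rewrite ltrDl ltr01 => /(_ isT x Dx) /=.
by rewrite leNgt Mx.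
Qed.

Lemma test_C1 (f : Rn -> R) : test_function f -> C1 f.
Proof. by move=> [sf _]; exact: smooth_C1. Qed.

Lemma csupp_product_fun (g : 'I_n -> R -> R) (M : R) :
  (forall i s, M < `|s| -> g i s = 0) -> csupp (product_fun g).
Proof.
move=> gM; exists (Num.max M 0) => x; rewrite gt_max => /andP[Mx x0].
have : mx_norm x != 0 by rewrite gt_eqF.
move=> /mx_norm_neq0[[i j] /= xE].
move: xE; rewrite (ord1 i) => xE.
by rewrite /product_fun (bigD1 j)//= gM ?mul0r// -xE.
Qed.

End product_functions.

(** * Local integrability *)

Section local_integrability.
Context {R : realType} {n : nat}.
Local Notation Rn := 'rV[R]_n.
Local Notation mu := (@lebesgue_rV R n).
Implicit Types (u v w f g : Rn -> R).

Lemma measurable_powR_norm (p : R) f : measurable_fun setT f ->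
  measurable_fun setT (fun x => `|f x| `^ p).
Proof.
move=> mf; apply: (measurableT_comp (f := @powR R ^~ p)) => //.
exact: measurableT_comp.
Qed.

Lemma LplocE (p : R) f : Lploc p f <->
  measurable_fun setT f /\ Lploc 1 (fun x => `|f x| `^ p).
Proof.
have E D : (\int[mu]_(x in D) (`|f x| `^ p)%:E =
   \int[mu]_(x in D) (`|(`|f x| `^ p)%R| `^ 1)%:E)%E.
  by apply: eq_integral => x _; rewrite powRr1// [in RHS]ger0_norm// powR_ge0.
split=> -[mf fD]; split=> //.
  by split=> [|D cD]; [exact: measurable_powR_norm|rewrite -E; exact: fD].
by move=> D cD; rewrite E; exact: fD.2.
Qed.

Lemma L1loc_dom f g : measurable_fun setT f -> (forall x, `|f x| <= g x) ->
  Lploc 1 g -> Lploc 1 f.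
Proof.
move=> mf fg [mg gD]; split; [exact: mf|move=> D cD].
have mD : measurable D by exact: compact_measurable_rV.
apply: le_lt_trans (gD D cD); apply: ge0_le_integral => //.
- by apply/measurable_EFinP/measurable_funTS; exact: measurable_powR_norm.
- by apply/measurable_EFinP/measurable_funTS; exact: measurable_powR_norm.
- move=> x _; rewrite lee_fin !powRr1//.
  by rewrite (le_trans (fg x))// ler_norm.
Qed.

Lemma L1loc_int f (D : set Rn) : Lploc 1 f -> compact D ->
  mu.-integrable D (EFin \o f).
Proof.
move=> [mf fD] cD; apply/integrableP; split.
  by apply/measurable_EFinP/measurable_funTS.
apply: le_lt_trans (fD D cD); rewrite le_eqVlt; apply/orP; left; apply/eqP.
by apply: eq_integral => x _ /=; rewrite powRr1.
Qed.

Lemma int_L1loc f : measurable_fun setT f ->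
  (forall D, compact D -> mu.-integrable D (EFin \o f)) -> Lploc 1 f.
Proof.
move=> mf fD; split=> // D /fD /integrableP[_]; apply: le_lt_trans.
rewrite le_eqVlt; apply/orP; left; apply/eqP.
by apply: eq_integral => x _ /=; rewrite powRr1.
Qed.

Lemma rint_L1loc f : mu.-integrable setT (EFin \o f) -> Lploc 1 f.
Proof.
move=> fi; apply: int_L1loc; first exact: (rint_meas fi).
move=> D cD; apply: integrableS fi => //; exact: compact_measurable_rV.
Qed.

Lemma L1locD f g : Lploc 1 f -> Lploc 1 g -> Lploc 1 (fun x => f x + g x).
Proof.
move=> f1 g1; apply: int_L1loc; first by apply: measurable_funD; [case: f1|case: g1].
move=> D cD; have mD : measurable D by exact: compact_measurable_rV.
exact: (integrableD mD (L1loc_int f1 cD) (L1loc_int g1 cD)).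
Qed.

Lemma L1locZ (c : R) f : Lploc 1 f -> Lploc 1 (fun x => c * f x).
Proof.
move=> f1; apply: int_L1loc; first by apply: measurable_funM => //; case: f1.
move=> D cD; have mD : measurable D by exact: compact_measurable_rV.
exact: (integrableZl mD c (L1loc_int f1 cD)).
Qed.

(** |a + b| is at most twice the larger of |a| and |b|. *)
Lemma powR_normD (p a b : R) : 0 <= p ->
  `|a + b| `^ p <= 2 `^ p * (`|a| `^ p + `|b| `^ p).
Proof.
move=> p0.
have H (x y : R) : `|x| <= `|y| -> `|x + y| `^ p <= 2 `^ p * (`|x| `^ p + `|y| `^ p).
  move=> xy; apply: (@le_trans _ _ ((2 * `|y|) `^ p)).
    apply: ge0_ler_powR => //; rewrite ?nnegrE ?mulr_ge0//.
    by apply: le_trans (ler_normD _ _) _; lra.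
  by rewrite powRM// ler_wpM2l ?powR_ge0// lerDr powR_ge0.
have [/H //|/ltW /H] := leP `|a| `|b|.
by rewrite addrC [`|b| `^ p + _]addrC.
Qed.

Lemma LplocD (p : R) f g : 0 <= p -> Lploc p f -> Lploc p g ->
  Lploc p (fun x => f x + g x).
Proof.
move=> p0 /LplocE[mf fp] /LplocE[mg gp].
have mfg : measurable_fun setT (fun x => f x + g x) by exact: measurable_funD.
apply/LplocE; split; first exact: mfg.
apply: (L1loc_dom (measurable_powR_norm p mfg)) (L1locZ (2 `^ p) (L1locD fp gp)).
by move=> x; rewrite ger0_norm ?powR_ge0//; exact: powR_normD.
Qed.

Lemma Lploc_mul (p B : R) f w : 0 <= p -> Lploc p f -> measurable_fun setT w ->
  (forall x, `|w x| <= B) -> Lploc p (fun x => w x * f x).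
Proof.
move=> p0 /LplocE[mf fp] mw wB.
have mwf : measurable_fun setT (fun x => w x * f x) by exact: measurable_funM.
apply/LplocE; split; first exact: mwf.
apply: (L1loc_dom (measurable_powR_norm p mwf)) (L1locZ (B `^ p) fp) => x.
have B0 : 0 <= B by exact: le_trans (wB x).
rewrite ger0_norm ?powR_ge0// -powRM//.
by apply: ge0_ler_powR => //; rewrite ?nnegrE ?mulr_ge0// normrM ler_wpM2r.
Qed.

Lemma LplocZ (p c : R) f : 0 <= p -> Lploc p f -> Lploc p (fun x => c * f x).
Proof.
move=> p0 fp; exact: (@Lploc_mul p `|c| f (fun=> c) p0 fp (measurable_cst _)).
Qed.

(** |f|^q <= 1 + |f|^p, and constants are locally integrable. *)
Lemma Lploc_le (p q : R) f : 0 <= q -> q <= p -> Lploc p f -> Lploc q f.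
Proof.
move=> q0 qp /LplocE[mf fp]; apply/LplocE; split; first exact: mf.
apply: (L1loc_dom (measurable_powR_norm q mf)) (L1locD (Lploc1_cst 1) fp) => x.
rewrite ger0_norm ?powR_ge0//; have [f1|f1] := leP `|f x| 1.
  apply: (@le_trans _ _ (1 `^ q)); last by rewrite powR1 lerDl powR_ge0.
  by apply: ge0_ler_powR => //; rewrite nnegrE.
apply: (@le_trans _ _ (`|f x| `^ p)); last by rewrite lerDr.
by apply: ler_powR => //; exact: ltW.
Qed.

Lemma Lploc_bounded (p : R) f : 0 <= p -> measurable_fun setT f ->
  (forall D, compact D -> exists B, forall x, D x -> `|f x| <= B) -> Lploc p f.
Proof.
move=> p0 mf fB; split; [exact: mf|move=> D cD]; have [B DB] := fB D cD.
have mD : measurable D by exact: compact_measurable_rV.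
have [_ /(_ D cD)] := Lploc1_cst (R := R) (n := n) (`|B| `^ p).
apply: le_lt_trans; apply: ge0_le_integral => //.
- by apply/measurable_EFinP/measurable_funTS; exact: measurable_powR_norm.
- move=> x Dx; rewrite lee_fin powRr1// (le_trans _ (ler_norm _))//.
  apply: ge0_ler_powR => //; rewrite ?nnegrE//.
  by rewrite (le_trans (DB x Dx))// ler_norm.
Qed.

Lemma Lploc_cts (p : R) f : 0 <= p -> continuous f -> Lploc p f.
Proof.
move=> p0 cf; apply: Lploc_bounded => //; first exact: continuous_measurable_rV.
move=> D cD.
have : compact (f @` D) by apply: continuous_compact => //; exact: continuous_subspaceT.
move=> /compact_bounded[B [_ fB]]; exists (B + 1) => x Dx.
by apply: (fB (B + 1)); [rewrite ltrDl|exists x].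
Qed.

Lemma Lploc_ae (p : R) f g : measurable_fun setT g ->
  {ae mu, forall x, f x = g x} -> Lploc p f -> Lploc p g.
Proof.
move=> mg fg [mf fD]; split; [exact: mg|move=> D cD].
have mD : measurable D by exact: compact_measurable_rV.
apply: le_lt_trans (fD D cD); rewrite le_eqVlt; apply/orP; left; apply/eqP.
apply: ae_eq_integral => //.
- by apply/measurable_EFinP/measurable_funTS; exact: measurable_powR_norm.
- by apply/measurable_EFinP/measurable_funTS; exact: measurable_powR_norm.
- by apply: filterS fg => x ->.
Qed.

End local_integrability.

(** * Test functions separate locally integrable functions *)

Section fundamental_lemma.
Context {R : realType} {n : nat}.
Local Notation Rn := 'rV[R]_n.
Local Notation mu := (@lebesgue_rV R n).

(** 1 - exp(-k bump) increases to the indicator of an interval. *)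
Definition box_cutoff (a b : Rn) (k : nat) : Rn -> R :=
  product_fun (fun i s => 1 + - 1 * expR (- k%:R * bump (a 0 i) (b 0 i) s)).

Lemma box_cutoff_test a b k : test_function (box_cutoff a b k).
Proof.
apply: csupp_test.
  apply: smooth_product_fun => i; apply: (smooth_algebra_smooth openT).
  apply: smooth_add; first exact: smooth_cst.
  apply: smooth_mul; first exact: smooth_cst.
  apply: smooth_exp; apply: smooth_mul; first exact: smooth_cst.
  by apply: smooth_gen; exact: smooth_bump.
apply: (@csupp_product_fun _ _ _ (`|a| + `|b|)) => i s Ms.
rewrite bump_eq0 ?mulr0 ?expR0 ?mulr1 ?subrr//.
have := coord_le_norm a i; have := coord_le_norm b i.
rewrite !ler_norml => /andP[b1 b2] /andP[a1 a2].
have a0 := normr_ge0 a; have b0 := normr_ge0 b.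
by move: Ms; rewrite lter_normr => /orP[|] Ms; [right|left]; lra.
Qed.

Let cutoff1_itv (a b s : R) (k : nat) :
  0 <= 1 + - 1 * expR (- k%:R * bump a b s) <= 1.
Proof.
rewrite mulN1r subr_ge0 gerBl expR_ge0 andbT -expR0 ler_expR mulNr oppr_le0.
by rewrite mulr_ge0// bump_ge0.
Qed.

Lemma box_cutoff_le a b k x : `|box_cutoff a b k x| <= \1_(open_box a b) x.
Proof.
rewrite indicE; have [xab|xab] := boolP (x \in _).
  rewrite /box_cutoff /product_fun ger0_norm.
    by apply: prodr_ile1 => i _; exact: cutoff1_itv.
  by apply: prodr_ge0 => i _; case/andP: (cutoff1_itv (a 0 i) (b 0 i) (x 0 i) k).
have [i hi] : exists i, ~ (a 0 i < x 0 i < b 0 i).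
  by apply/existsNP => h; move: xab; rewrite notin_setE; apply.
rewrite /box_cutoff /product_fun (bigD1 i)//= bump_eq0.
  by rewrite mulr0 expR0 mulr1 subrr mul0r normr0.
move/negP: hi; rewrite negb_and -!leNgt => /orP[|]; tauto.
Qed.

Lemma box_cutoff_cvg a b x :
  box_cutoff a b k x @[k --> \oo] --> (\1_(open_box a b) x : R).
Proof.
have [xab|xab] := boolP (x \in open_box a b); last first.
  rewrite (_ : (fun k => box_cutoff a b k x) = cst 0).
    by rewrite indicE (negbTE xab); exact: cvg_cst.
  apply/funext => k; apply/eqP; rewrite -normr_le0.
  by apply: le_trans (box_cutoff_le a b k x) _; rewrite indicE (negbTE xab).
rewrite indicE xab /= /box_cutoff /product_fun.
rewrite (_ : 1%:R = \prod_(i < n) (1 : R)); last by rewrite big1.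
move: xab; rewrite inE => xab.
elim: (index_enum _) => [|i s IH].
  by under eq_fun do rewrite big_nil; rewrite big_nil; exact: cvg_cst.
under eq_fun do rewrite big_cons; rewrite big_cons; apply: cvgM => //.
set c := bump _ _ _; have c0 : 0 < c by apply: bump_gt0; exact: xab.
rewrite -[X in _ --> X]addr0 -[X in _ --> _ + X](mulr0 (-1)).
apply: cvgD; first exact: cvg_cst.
apply: cvgM; first exact: cvg_cst.
apply/cvgrPdist_lt => e e0; near=> k.
rewrite sub0r normrN ger0_norm ?expR_ge0// mulNr expRN.
rewrite invf_plt ?posrE ?expR_gt0//.
apply: lt_le_trans (expR_ge1Dx _).
have : e^-1 / c < k%:R by near: k; exact: nbhs_infty_gtr.
by rewrite ltr_pdivrMr// => h; rewrite (lt_trans h)// ltrDr.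
Unshelve. all: by end_near. Qed.

(** Dominated convergence along the smooth cut-offs of the box. *)
Lemma box_integral0 (g : Rn -> R) : Lploc 1 g ->
  (forall zeta : Rn -> R, test_function zeta -> \int[mu]_x (g x * zeta x) = 0) ->
  forall a b, mu.-integrable setT (EFin \o (fun x => g x * \1_(open_box a b) x)) /\
    \int[mu]_x (g x * \1_(open_box a b) x) = 0.
Proof.
move=> g1 gz a b.
have mI : measurable_fun setT (\1_(open_box a b) : Rn -> R).
  by apply: measurable_indic; exact: measurable_open_box.
have gI : mu.-integrable setT (EFin \o (fun x => g x * \1_(open_box a b) x)).
  apply: (@rint_loc _ _ g _ 1) => //.
  - by move=> x; rewrite indicE; case: (_ \in _); rewrite ?normr1 ?normr0.
  - exists (`|a| + `|b|) => x; apply: contraPP => /eqP.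
    rewrite indicE pnatr_eq0 eqb0 negbK inE => xab; apply/negP; rewrite -leNgt.
    apply: norm_le_coord => // i.
    have := coord_le_norm a i; have := coord_le_norm b i.
    rewrite !ler_norml => /andP[b1 b2] /andP[a1 a2].
    have a0 := normr_ge0 a; have b0 := normr_ge0 b.
    by have /andP[h1 h2] := xab i; apply/andP; split; lra.
split=> //.
have [||||_ cv] := @Rint_dct _ Rn R mu (fun k x => g x * box_cutoff a b k x)
  (fun x => g x * \1_(open_box a b) x) (fun x => `|g x * \1_(open_box a b) x|).
- move=> k; apply: measurable_funM; first by case: g1.
  by apply: continuous_measurable_rV; case: (test_C1 (box_cutoff_test a b k)).
- by move=> x; apply: cvgM; [exact: cvg_cst|exact: box_cutoff_cvg].
- move=> k x; rewrite !normrM ler_wpM2l// (le_trans (box_cutoff_le _ _ _ _))//.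
  exact: ler_norm.
- exact: rint_norm.
apply/esym; move: cv; rewrite (_ : (fun k => _) = cst 0).
  by move=> cv; apply: (cvg_unique _ (@cvg_cst _ _ _ _ _) cv).
by apply/funext => k; apply: gz; exact: box_cutoff_test.
Qed.

(** The positive and the negative part of g, restricted to a large box, are the
    densities of two measures that agree on all boxes.  So they agree on the set
    where g > 0, on which the second one vanishes. *)
Let pos_part_null (g : Rn -> R) : measurable_fun setT g ->
  (forall a b, mu.-integrable setT (EFin \o (fun x => g x * \1_(open_box a b) x)) /\
    \int[mu]_x (g x * \1_(open_box a b) x) = 0) ->
  forall k : nat, {ae mu, forall x, Num.max (g x) 0 *
     \1_(open_box (const_mx (- k%:R)) (const_mx k%:R)) x = 0}.
Proof.
move=> mg gab k; set B := open_box _ _.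
have mB : measurable B by exact: measurable_open_box.
pose J1 x := Num.max (g x) 0 * \1_B x; pose J2 x := Num.max (- g x) 0 * \1_B x.
have mJ1 : measurable_fun setT J1.
  by apply: measurable_funM; [apply: measurable_maxr|exact: measurable_indic].
have mJ2 : measurable_fun setT J2.
  apply: measurable_funM; last exact: measurable_indic.
  by apply: measurable_maxr => //; exact: measurableT_comp.
have J10 x : 0 <= J1 x by rewrite mulr_ge0// ?le_max ?lexx ?orbT// indicE.
have J20 x : 0 <= J2 x by rewrite mulr_ge0// ?le_max ?lexx ?orbT// indicE.
have [m1 m1E] := @weighted_image_measure _ Rn R mu id J1 (@measurable_id _ _ _) mJ1 J10.
have [m2 m2E] := @weighted_image_measure _ Rn R mu id J2 (@measurable_id _ _ _) mJ2 J20.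
have boxI a b : exists c e, open_box a b `&` B = open_box c e :> set Rn.
  exists (\row_i Num.max (a 0 i) (- k%:R)), (\row_i Num.min (b 0 i) k%:R).
  apply/seteqP; split=> x /= => [[h1 h2] i|h].
    rewrite !mxE gt_max lt_min; have := h2 i; rewrite !mxE => /andP[-> ->].
    by have /andP[-> ->] := h1 i.
  by split=> i; have := h i; rewrite !mxE gt_max lt_min =>
    /andP[/andP[h1 h2] /andP[h3 h4]]; rewrite ?h1 ?h2 ?h3 ?h4.
have i1 a b : mu.-integrable setT (EFin \o (fun x => \1_(open_box a b) x * J1 x)) /\
   mu.-integrable setT (EFin \o (fun x => \1_(open_box a b) x * J2 x)).
  have [c [e ce]] := boxI a b; have [gi _] := gab c e.
  have mbox : measurable (open_box a b) by exact: measurable_open_box.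
  have E x : \1_(open_box c e) x = \1_(open_box a b) x * \1_B x :> R.
    by rewrite -ce indicI.
  have mI : measurable_fun setT (\1_(open_box a b) : Rn -> R) by exact: measurable_indic.
  split; [apply: (rint_dom _ _ (rint_norm gi)); first exact: measurable_funM
         |apply: (rint_dom _ _ (rint_norm gi)); first exact: measurable_funM].
  - move=> x; rewrite E !normrM !indicE; case: (_ \in _); case: (_ \in _);
      rewrite !(mulr0, mul0r, normr0, normr1, mulr1, mul1r) ?normr_ge0//.
    by rewrite ger0_norm ?le_max ?lexx ?orbT// ge_max ler_norm normr_ge0.
  - move=> x; rewrite E !normrM !indicE; case: (_ \in _); case: (_ \in _);
      rewrite !(mulr0, mul0r, normr0, normr1, mulr1, mul1r) ?normr_ge0//.
    by rewrite ger0_norm ?le_max ?lexx ?orbT// ge_max -normrN ler_norm normr_ge0.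
have m1b a b : m1 (open_box a b) = (\int[mu]_x (\1_(open_box a b) x * J1 x))%:E.
  by rewrite m1E (@integral_preimage_indic _ _ _ mu _ _ id) Rint_EFin//; case: (i1 a b).
have m2b a b : m2 (open_box a b) = (\int[mu]_x (\1_(open_box a b) x * J2 x))%:E.
  by rewrite m2E (@integral_preimage_indic _ _ _ mu _ _ id) Rint_EFin//; case: (i1 a b).
have m12 A : measurable A -> m1 A = m2 A.
  apply: rV_measure_unique => a b; last by rewrite m1b ltry.
  have [ia ib] := i1 a b; rewrite m1b m2b; congr _%:E.
  apply/eqP; rewrite -subr_eq0 -RintegralB//; apply/eqP.
  have [c [e ce]] := boxI a b; have [_ <-] := gab c e.
  apply: eq_Rintegral => x _; rewrite -ce indicI /J1 /J2 /=.
  have {3}-> : g x = Num.max (g x) 0 - Num.max (- g x) 0.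
    by case: (leP (g x) 0); case: (leP (- g x) 0); lra.
  by ring.
pose A := g @^-1` `]0, +oo[%classic.
have mA : measurable A.
  by rewrite /A -[X in measurable X]setTI; apply: mg => //; exact: measurable_itv.
have : m1 A = 0%E.
  rewrite m12// m2E; apply: integral0_eq => x; rewrite /A /= in_itv /= andbT => gx0.
  by rewrite /J2 max_r ?mul0r// oppr_le0 ltW.
rewrite m1E (@integral_preimage_indic _ _ _ mu _ _ id).
rewrite (_ : (\int[mu]_x _ = \int[mu]_x (J1 x)%:E)%E).
  by apply: integral_eq0_ae.
apply: eq_integral => x _; rewrite indicE; have [|] := boolP (x \in A); rewrite ?mul1r//.
by rewrite notin_setE /A /= in_itv /= andbT => /negP; rewrite -leNgt => g0; rewrite /J1 max_r// !mul0r.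
Qed.

(** The integrals of g over boxes vanish; apply the preceding to g and to -g. *)
Lemma fundamental_lemma (g : Rn -> R) : Lploc 1 g ->
  (forall zeta : Rn -> R, test_function zeta -> \int[mu]_x (g x * zeta x) = 0) ->
  {ae mu, forall x, g x = 0}.
Proof.
move=> g1 gz; have mg : measurable_fun setT g by case: g1.
have gab := box_integral0 g1 gz.
have Ngab a b : mu.-integrable setT (EFin \o (fun x => - g x * \1_(open_box a b) x)) /\
    \int[mu]_x (- g x * \1_(open_box a b) x) = 0.
  have [gi g0] := gab a b; split.
    by apply: eq_integrable (rintN gi) => // x _ /=; rewrite mulNr.
  by under eq_Rintegral do rewrite mulNr; rewrite RintN// g0 oppr0.
have mNg : measurable_fun setT (fun x => - g x) by exact: measurableT_comp.
have h1 := ae_foralln (pos_part_null mg gab).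
have h2 := ae_foralln (pos_part_null mNg Ngab).
apply: filterS2 h1 h2 => x h1 h2.
near \oo => k; have := h1 k; have := h2 k.
rewrite indicE (_ : x \in _); last first.
  rewrite inE => i; rewrite !mxE -ltr_norml; apply: le_lt_trans (coord_le_norm x i) _.
  by near: k; exact: nbhs_infty_gtr.
by rewrite !mulr1; case: (leP (g x) 0); case: (leP (- g x) 0); lra.
Unshelve. all: by end_near. Qed.

End fundamental_lemma.

(** * Weak derivatives *)

Section test_functions.
Context {R : realType} {n : nat}.
Local Notation Rn := 'rV[R]_n.
Implicit Types (f g zeta : Rn -> R).

Lemma test_mul f zeta : smooth_on setT f -> test_function zeta ->
  test_function (fun x => f x * zeta x).
Proof.
move=> sf tz; apply: csupp_test; last by apply: csuppMr; exact: test_csupp.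
by apply: (smooth_onM openT) => //; case: tz.
Qed.

Lemma test_scale (c : R) zeta : test_function zeta ->
  test_function (fun x => c * zeta x).
Proof. by apply: test_mul; exact: smooth_on_cst openT. Qed.

Lemma test_derive v zeta : test_function zeta -> test_function ('D_v zeta).
Proof.
move=> tz; apply: csupp_test; last by apply: csupp_derive; exact: test_csupp.
by apply: smooth_on_derive; case: tz.
Qed.

Lemma test_cts zeta : test_function zeta -> continuous zeta.
Proof. by move/test_C1; case. Qed.

Lemma test_derivable zeta x v : test_function zeta -> derivable zeta x v.
Proof. by move=> [sz _]; apply: (smooth_on_derivable sz). Qed.

Lemma csuppD f g : csupp f -> csupp g -> csupp (fun x => f x + g x).
Proof.
move=> [M fM] [M' gM]; exists (Num.max M M') => x.
by rewrite gt_max => /andP[h1 h2]; rewrite fM// gM// addr0.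
Qed.

End test_functions.

Section weak_derivatives.
Context {R : realType} {n : nat}.
Local Notation Rn := 'rV[R]_n.
Local Notation mu := (@lebesgue_rV R n).
Implicit Types (f g u v w zeta : Rn -> R) (a : 'I_n).

Lemma rint_test u zeta : Lploc 1 u -> test_function zeta ->
  mu.-integrable setT (EFin \o (fun x => u x * zeta x)).
Proof.
by move=> u1 tz; apply: rint_loc_cts => //; [exact: test_cts|exact: test_csupp].
Qed.

(** The difference of two weak derivatives integrates to zero against all test
    functions. *)
Lemma wderiv_unique a f g g' : is_wderiv a f g -> is_wderiv a f g' ->
  {ae mu, forall x, g x = g' x}.
Proof.
move=> [f1 g1 fg] [_ g'1 fg'].
have h1 : Lploc 1 (fun x => g x + -1 * g' x).
  by apply: L1locD; [exact: g1|exact: L1locZ].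
have : {ae mu, forall x, g x + -1 * g' x = 0}.
  apply: fundamental_lemma => // zeta tz.
  rewrite (_ : (fun x => _) = (fun x => g x * zeta x - g' x * zeta x)).
    rewrite RintegralB//; [|exact: rint_test..].
    by apply/eqP; rewrite subr_eq0 -eqr_opp -fg// -fg'.
  by apply/funext => x; ring.
by apply: filterS => x h; lra.
Qed.

Lemma is_wderiv_wderiv a f g : is_wderiv a f g -> is_wderiv a f (wderiv a f).
Proof. by move=> fg; exact: (xgetPex (cst 0) (ex_intro _ g fg)). Qed.

Lemma wderiv_ae a f g : is_wderiv a f g -> {ae mu, forall x, wderiv a f x = g x}.
Proof. by move=> fg; exact: (wderiv_unique (is_wderiv_wderiv fg) fg). Qed.

Lemma is_wderivD a f f' g g' : is_wderiv a f g -> is_wderiv a f' g' ->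
  is_wderiv a (fun x => f x + f' x) (fun x => g x + g' x).
Proof.
move=> [f1 g1 fg] [f'1 g'1 fg']; split; [exact: L1locD|exact: L1locD|].
move=> zeta tz; have tdz := test_derive 'e_a tz.
under eq_Rintegral do rewrite mulrDl; rewrite RintegralD//; [|exact: rint_test..].
under [in RHS]eq_Rintegral do rewrite mulrDl.
rewrite [in RHS]RintegralD//; [|exact: rint_test..].
by rewrite fg// fg'// opprD.
Qed.

Lemma is_wderivZ a (c : R) f g : is_wderiv a f g ->
  is_wderiv a (fun x => c * f x) (fun x => c * g x).
Proof.
move=> [f1 g1 fg]; split; [exact: L1locZ|exact: L1locZ|].
move=> zeta tz; have tdz := test_derive 'e_a tz.
under eq_Rintegral do rewrite -mulrA; rewrite RintegralZl//; last exact: rint_test.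
under [in RHS]eq_Rintegral do rewrite -mulrA.
by rewrite [in RHS]RintegralZl//; [rewrite fg// mulrN|exact: rint_test].
Qed.

Lemma is_wderiv0 a : is_wderiv a (fun _ : Rn => 0 : R) (fun=> 0).
Proof.
split; [exact: Lploc1_cst|exact: Lploc1_cst|].
move=> zeta tz; under eq_Rintegral do rewrite mul0r.
by under [in RHS]eq_Rintegral do rewrite mul0r; rewrite !Rint0 oppr0.
Qed.

Lemma is_wderiv_sum (I : Type) (r : seq I) (F G : I -> Rn -> R) a :
  (forall i, is_wderiv a (F i) (G i)) ->
  is_wderiv a (fun x => \sum_(i <- r) F i x) (fun x => \sum_(i <- r) G i x).
Proof.
move=> FG; elim: r => [|i r IH].
  under eq_fun do rewrite big_nil; under [X in is_wderiv _ _ X]eq_fun do rewrite big_nil.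
  exact: is_wderiv0.
under eq_fun do rewrite big_cons; under [X in is_wderiv _ _ X]eq_fun do rewrite big_cons.
exact: is_wderivD.
Qed.

Lemma is_wderiv_ae a f f' g g' : measurable_fun setT f' -> measurable_fun setT g' ->
  {ae mu, forall x, f x = f' x} -> {ae mu, forall x, g x = g' x} ->
  is_wderiv a f g -> is_wderiv a f' g'.
Proof.
move=> mf' mg' ff' gg' [f1 g1 fg].
split; [exact: Lploc_ae ff' f1|exact: Lploc_ae gg' g1|].
move=> zeta tz; have tdz := test_derive 'e_a tz.
rewrite -(@Rintegral_ae _ _ _ _ _ (fun x => f x * 'D_('e_a) zeta x)).
  rewrite fg//; congr (- _); apply: Rintegral_ae.
  by apply: filterS gg' => x ->.
by apply: filterS ff' => x ->.
Qed.

(** Classical derivatives are weak derivatives: integration by parts. *)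
Lemma is_wderiv_C1 a f : C1 f -> is_wderiv a f ('D_('e_a) f).
Proof.
move=> cf; have [c1 /(_ a) [df c2]] := cf.
split; [exact: Lploc_cts|exact: Lploc_cts|].
move=> zeta tz; exact: (integration_by_parts_rV a cf (test_C1 tz) (test_csupp tz)).
Qed.

(** Leibniz rule: test against the product of eta and the test function. *)
Lemma is_wderivM a (eta : Rn -> R) f g : test_function eta -> is_wderiv a f g ->
  is_wderiv a (fun x => eta x * f x) (fun x => eta x * g x + 'D_('e_a) eta x * f x).
Proof.
move=> te [f1 g1 fg]; have tde := test_derive 'e_a te.
have bd h zeta : Lploc 1 h -> test_function zeta -> Lploc 1 (fun x => zeta x * h x).
  move=> h1 tz.
  have [C zC] := csupp_bounded (test_cts tz) (test_csupp tz).
  have mz := continuous_measurable_rV (test_cts tz).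
  exact: (Lploc_mul ler01 h1 mz zC).
split; [exact: bd|by apply: L1locD; apply: bd|].
move=> zeta tz; have tdz := test_derive 'e_a tz.
have tez : test_function (fun x => eta x * zeta x) by apply: test_mul => //; case: te.
have D x : 'D_('e_a) (fun x => eta x * zeta x) x =
    'D_('e_a) eta x * zeta x + eta x * 'D_('e_a) zeta x.
  rewrite (@deriveM _ _ eta zeta); [|exact: test_derivable..].
  by rewrite /GRing.scale /= addrC; congr (_ + _); rewrite mulrC.
have t1 : test_function (fun x => 'D_('e_a) eta x * zeta x) by apply: test_mul => //; case: tde.
have t2 : test_function (fun x => eta x * 'D_('e_a) zeta x) by apply: test_mul => //; case: te.
have := fg _ tez; under eq_Rintegral do rewrite D mulrDr.
rewrite RintegralD//; [|exact: rint_test..] => E.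
under eq_Rintegral do rewrite (mulrC (eta _)) -mulrA.
under [in RHS]eq_Rintegral do
  rewrite mulrDl (mulrC (eta _)) -mulrA (mulrC ('D_('e_a) eta _)) -(mulrA (f _)).
rewrite RintegralD//; [|exact: rint_test..].
by rewrite opprD -E; ring.
Qed.

End weak_derivatives.

(** * Convolution with test functions *)

Section kernels.
Context {R : realType} {n : nat}.
Local Notation Rn := 'rV[R]_n.
Local Notation mu := (@lebesgue_rV R n).
Implicit Types (f g u v w rho zeta : Rn -> R) (a : 'I_n).

Lemma lebesgue_open_box (a b : Rn) :
  mu (open_box a b) = (\prod_(i < n) (if a 0 i < b 0 i then b 0 i - a 0 i else 0))%:E.
Proof.
rewrite open_boxE (lebesgue_rV_box (A := fun i => `]a 0 i, b 0 i[%classic))//.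
rewrite -prodEFin; apply: eq_bigr => i _.
by rewrite lebesgue_measure_itv /= lte_fin; case: ifP.
Qed.

Lemma measurable_subr_rV (c : Rn) : measurable_fun setT (fun y : Rn => c - y).
Proof.
apply: measurable_mxP => i j; under eq_fun do rewrite !mxE.
by apply: measurable_funB => //; exact: measurable_mx_coord.
Qed.

(** Boxes are reflected to boxes with the same side lengths. *)
Let reflect_measure (c : Rn) A : measurable A ->
  mu A = (\int[mu]_(x in (fun y : Rn => (c - y)%R) @^-1` A) ((fun=> 1%R) x)%:E)%E.
Proof.
have [m' m'E] := @weighted_image_measure _ Rn R mu (fun y : Rn => c - y) (fun=> 1)
  (measurable_subr_rV c) (measurable_cst _) (fun=> ler01).
move=> mA; rewrite -m'E; move: A mA.
have mb (a b : Rn) : m' (open_box a b) = mu (open_box a b).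
  rewrite m'E integral_cst; last first.
    by rewrite -[X in measurable X]setTI; apply: measurable_subr_rV => //; exact: measurable_open_box.
  rewrite mul1e (_ : _ @^-1` _ = open_box (c - b) (c - a)).
    apply: (etrans (lebesgue_open_box _ _)); apply: (etrans _ (esym (lebesgue_open_box _ _))).
  apply/eqP; rewrite eqe; apply/eqP; apply: eq_bigr => i _; rewrite !mxE.
    by rewrite ltrD2l ltrN2; case: ifP => // _; ring.
  apply/seteqP; split=> x h i; have := h i; rewrite !mxE => /andP[h1 h2];
    by apply/andP; split; lra.
apply: rV_measure_unique => a b; first by rewrite mb.
exact: lebesgue_open_box_lty.
Qed.

Lemma ge0_integral_reflect (c : Rn) (f : Rn -> \bar R) : measurable_fun setT f ->
  (forall x, 0 <= f x)%E -> (\int[mu]_x f x = \int[mu]_x f (c - x)%R)%E.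
Proof.
move=> mf f0; rewrite (@ge0_integral_weighted_image _ Rn R mu (fun y : Rn => c - y)
  (fun=> 1) (measurable_subr_rV c) (measurable_cst _) (fun=> ler01) (@reflect_measure c) f mf f0).
by apply: eq_integral => x _; rewrite mule1.
Qed.

Let reflect_transfer (c : Rn) (f : Rn -> \bar R) : measurable_fun setT f ->
  (forall x, 0 <= f x)%E -> (\int[mu]_x f x = \int[mu]_x (f (c - x)%R * ((fun=> 1%R) x)%:E))%E.
Proof.
by move=> mf f0; rewrite (ge0_integral_reflect c mf f0); apply: eq_integral => x _; rewrite mule1.
Qed.

Lemma Rintegral_reflect (c : Rn) f : mu.-integrable setT (EFin \o f) ->
  \int[mu]_x f x = \int[mu]_x f (c - x).
Proof.
move=> fi; rewrite (@Rintegral_transfer _ Rn R mu _ (fun=> 1) (measurable_subr_rV c)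
  (measurable_cst _) (fun=> ler01) (@reflect_transfer c) f fi).
by apply: eq_Rintegral => x _; rewrite mulr1.
Qed.

(** The kernel is bounded, so the integrand is dominated by the product of |w(x)|
    and |u(y)|. *)
Lemma fubini_kernel u w (kap : Rn * Rn -> R) (C : R) :
  mu.-integrable setT (EFin \o u) -> mu.-integrable setT (EFin \o w) ->
  measurable_fun setT kap -> (forall p, `|kap p| <= C) ->
  \int[mu]_x ((\int[mu]_y (u y * kap (x, y))) * w x) =
  \int[mu]_y (u y * \int[mu]_x (kap (x, y) * w x)).
Proof.
move=> ui wi mk kC; have mu_ := rint_meas ui; have mw := rint_meas wi.
have C0 : 0 <= C by apply: le_trans (kC (0, 0)).
pose f (p : Rn * Rn) := w p.1 * (u p.2 * kap p).
have mf : measurable_fun setT f.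
  apply: measurable_funM; first exact: (measurableT_comp mw measurable_fst).
  by apply: measurable_funM => //; exact: (measurableT_comp mu_ measurable_snd).
have ki1 x : mu.-integrable setT (EFin \o (fun y => u y * kap (x, y))).
  apply: (rint_dom (g := fun y => C * `|u y|)); last exact/rintZ/rint_norm.
    by apply: measurable_funM => //; exact: (measurableT_comp mk (measurable_pair1 x)).
  by move=> y; rewrite normrM mulrC ler_wpM2r.
have ki2 y : mu.-integrable setT (EFin \o (fun x => kap (x, y) * w x)).
  apply: (rint_dom (g := fun x => C * `|w x|)); last exact/rintZ/rint_norm.
    by apply: measurable_funM => //; exact: (measurableT_comp mk (measurable_pair2 y)).
  by move=> x; rewrite normrM ler_wpM2r.
have fi : (mu \x mu)%E.-integrable setT (EFin \o f).
  apply/integrableP; split; first exact/measurable_EFinP.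
  rewrite fubini_tonelli1 => [||//]; last first.
    by apply: measurableT_comp => //; exact/measurable_EFinP.
  have uE : (\int[mu]_y (`|u y|)%:E = (\int[mu]_y `|u y|)%:E)%E.
    by rewrite Rint_EFin//; exact: rint_norm.
  apply: (@le_lt_trans _ _ (\int[mu]_x (`|w x| * C * (\int[mu]_y `|u y|))%:E)%E).
    apply: ge0_le_integral => //.
    - by move=> x _; apply: integral_ge0 => y _; exact: abse_ge0.
    - apply: measurable_fun_fubini_tonelli_F => //.
      by apply: measurableT_comp => //; exact/measurable_EFinP.
    - apply/measurable_EFinP; do 2 apply: measurable_funM => //.
      exact: measurableT_comp.
    - move=> x _; rewrite EFinM -uE -ge0_integralZl//; last 2 first.
      + by apply/measurable_EFinP; exact: measurableT_comp.
      + by rewrite lee_fin mulr_ge0.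
      apply: ge0_le_integral => //.
      + apply: measurableT_comp => //; apply/measurable_EFinP; rewrite /f /=.
        by apply: measurable_funM => //; exact: (rint_meas (ki1 x)).
      + apply/measurable_EFinP; apply: measurable_funM => //; exact: measurableT_comp.
      + move=> y _; rewrite /= -EFinM lee_fin /f /= !normrM -mulrA ler_wpM2l// mulrC ler_wpM2r//.
  under eq_integral do rewrite -mulrA mulrC.
  rewrite Rint_EFin ?ltry//; apply: rintZ => //; exact: rint_norm.
have := Fubini fi; rewrite /= => E.
rewrite /Rintegral; congr fine.
transitivity (\int[mu]_x \int[mu]_y (f (x, y))%:E)%E.
  apply: eq_integral => x _; rewrite /f /= [RHS]Rint_EFin; last exact: rintZ.
  by rewrite RintegralZl// mulrC.
rewrite E; apply: eq_integral => y _.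
transitivity (\int[mu]_x (u y * (kap (x, y) * w x))%:E)%E.
  by apply: eq_integral => x _; rewrite /f /=; apply: congr1; ring.
by rewrite [LHS]Rint_EFin; [rewrite RintegralZl|exact: rintZ].
Qed.

(** Coinduction on the class of all multiples of functions r(z + c y) with r
    smooth. *)
Lemma smooth_comp_affine rho (z : Rn) (c : R) : smooth_on setT rho ->
  smooth_on setT (fun y => rho (z + c *: y)) /\
  forall v y : Rn, 'D_v (fun y => rho (z + c *: y)) y = c * 'D_v rho (z + c *: y).
Proof.
have D (r : Rn -> R) (v y : Rn) : smooth_on setT r ->
    is_derive y v (fun y => r (z + c *: y)) (c * 'D_v r (z + c *: y)).
  move=> sr; set q := z + c *: y.
  have d0 : derivable r (q + 0 *: (c *: v)) (c *: v).
    by rewrite scale0r addr0; apply: (smooth_on_derivable sr).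
  have := is_derive_line d0; rewrite scale0r addr0 => -[h1 h2].
  have E : (fun h : R => h^-1 *: ((fun y => r (z + c *: y)) (h *: v + y) - r q)) =
      (fun h : R => h^-1 *: ((fun s : R => r (q + s *: (c *: v))) (h *: 1 + 0) -
         r (q + 0 *: (c *: v)))).
    apply/funext => h; congr (_ *: (r _ - r _)).
      by apply/rowP => i; rewrite addr0 /q !mxE /GRing.scale /=; ring.
    by rewrite scale0r addr0.
  split; first by rewrite /derivable E.
  transitivity ('D_1 (fun s : R => r (q + s *: (c *: v))) 0); first by rewrite /derive E.
  rewrite h2; have dr : differentiable r q by exact/C1_differentiable/smooth_C1.
  by rewrite !deriveE// linearZ.
move=> sr; split; last by move=> v y; case: (D rho v y sr).
pose P (f : Rn -> R) := exists (e : R) (r : Rn -> R), smooth_on setT r /\ f = (fun y => e * r (z + c *: y)).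
have : P (fun y => rho (z + c *: y)).
  by exists 1, rho; split => //; apply/funext => y; rewrite mul1r.
have ca : continuous (fun y : Rn => z + c *: y).
  apply: cts_rV => y e e0; have c1 : 0 < `|c| + 1 by rewrite ltr_wpDl.
  exists (e / (`|c| + 1)) => [|w]; first by rewrite divr_gt0.
  rewrite ltr_pdivlMr// => yw.
  rewrite (_ : z + c *: y - (z + c *: w) = c *: (y - w)); last first.
    by apply/rowP => i; rewrite !mxE; ring.
  rewrite normrZ; apply: le_lt_trans yw; rewrite mulrC ler_wpM2l//; lra.
apply: smooth_on_coind; first exact: openT.
- move=> _ y [e [r [sr1 ->]]] _; split.
    have cr : continuous r by move=> q; exact: (smooth_on_continuous sr1).
    have cc : continuous (fun y : Rn => e * r (z + c *: y)).
      have cr2 : continuous (fun y : Rn => r (z + c *: y)).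
        by move=> q; apply: (continuous_comp (ca q) (cr _)).
      by move=> q; apply: (@cvgM _ _ _ _ (fun=> e) _ e _ (@cvg_cst _ _ _ _ _) (cr2 q)).
    exact: cc.
  move=> v; have [h _] := D r v y sr1.
  by apply: derivableZ h.
- move=> _ v [e [r [sr1 ->]]].
  exists (fun y => e * c * 'D_v r (z + c *: y)).
    by exists (e * c), ('D_v r); split => //; exact: (smooth_on_derive v sr1).
  move=> y _; have [h1 h2] := D r v y sr1.
  by rewrite (@deriveZ _ _ _ (fun y => r (z + c *: y)) e y v h1) h2 /GRing.scale /= mulrA.
Qed.

Lemma smooth_reflect rho (x : Rn) : smooth_on setT rho ->
  smooth_on setT (fun y => rho (x - y)) /\
  forall v y : Rn, 'D_v (fun y => rho (x - y)) y = - 'D_v rho (x - y).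
Proof.
move=> sr; have [h1 h2] := smooth_comp_affine x (-1) sr.
have E : (fun y => rho (x - y)) = (fun y => rho (x + -1 *: y)).
  by apply/funext => y; rewrite scaleN1r.
by rewrite E; split => // v y; rewrite h2 mulN1r scaleN1r.
Qed.

Lemma test_reflect rho (x : Rn) : test_function rho ->
  test_function (fun y => rho (x - y)).
Proof.
move=> tr; have [M rM] := test_csupp tr; apply: csupp_test.
  by apply: (smooth_reflect x _).1; case: tr.
exists (`|x| + M) => y h; apply: rM.
have := ler_normB (x - y) x; rewrite addrAC subrr sub0r normrN; lra.
Qed.

Lemma test_dilate rho (c : R) : c != 0 -> test_function rho ->
  test_function (fun y => rho (c *: y)) /\
  forall v y : Rn, 'D_v (fun y => rho (c *: y)) y = c * 'D_v rho (c *: y).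
Proof.
move=> c0 tr; have [M rM] := test_csupp tr.
have E : (fun y => rho (c *: y)) = (fun y => rho (0 + c *: y)).
  by apply/funext => y; rewrite add0r.
have [h1 h2] := smooth_comp_affine 0 c tr.1.
rewrite E; split; last by move=> v y; rewrite h2 add0r.
apply: csupp_test => //; exists (M / `|c|) => y h; apply: rM.
by rewrite add0r normrZ mulrC -ltr_pdivrMr ?normr_gt0.
Qed.

End kernels.

Section mollification.
Context {R : realType} {n : nat}.
Local Notation Rn := 'rV[R]_n.
Local Notation mu := (@lebesgue_rV R n).
Implicit Types (f g u v w rho zeta : Rn -> R) (a : 'I_n).

Lemma cts_rVR f : (forall z e, 0 < e -> exists2 r, 0 < r &
    forall w : Rn, `|z - w| < r -> `|f z - f w| < e) -> continuous f.
Proof.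
move=> fe z A /nbhs_ballP[e /= e0 eA].
have [r r0 rP] := fe z e e0; apply/nbhs_ballP; exists r => //= w.
by rewrite -ball_normE /= => zw; apply: eA; rewrite -ball_normE /=; exact: rP.
Qed.

(** A quadratic remainder allows for differentiating under the integral sign
    without passing to the limit in the integrand. *)
Lemma is_derive_quadratic f (x v : Rn) (l C : R) :
  (forall h : R, `|h| <= 1 -> `|f (x + h *: v) - f x - h * l| <= C * h ^+ 2) ->
  is_derive x v f l.
Proof.
move=> fC.
have C0 : 0 <= C by have := fC 1; rewrite expr1n mulr1 normr1 => /(_ (lexx _)); apply: le_trans.
suff cv : h^-1 *: ((f \o shift x) (h *: v) - f x) @[h --> (0 : R)^'] --> l.
  by split; [apply/cvg_ex; exists l|apply: cvg_lim].
apply/cvgrPdist_le => e e0; near=> h.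
have h0 : h != 0 by near: h; exact: nbhs_dnbhs_neq.
have h1 : `|h| <= 1.
  near: h; apply: cvg_within; apply: filterS (nbhsx_ballx (0 : R) 1 ltr01) => z.
  by rewrite -ball_normE /= sub0r normrN => /ltW.
have -> : l - h^-1 *: ((f \o shift x) (h *: v) - f x) =
    - (h^-1 * (f (x + h *: v) - f x - h * l)).
  by rewrite /= [h *: v + x]addrC /GRing.scale /=; field.
rewrite normrN normrM normfV mulrC ler_pdivrMr ?normr_gt0//.
apply: le_trans (fC h h1) _; rewrite -real_normK ?num_real// expr2 mulrA ler_wpM2r//.
have : `|h| <= e / (C + 1).
  near: h; apply: cvg_within.
  apply: filterS (nbhsx_ballx (0 : R) (e / (C + 1)) _) => [z|].
    by rewrite -ball_normE /= sub0r normrN => /ltW.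
  by apply: divr_gt0 => //; have C0' := C0; lra.
rewrite ler_pdivlMr ?ltr_wpDl// => h2; apply: le_trans h2.
by rewrite mulrC ler_wpM2l// lerDl.
Unshelve. all: by end_near. Qed.

Lemma test_lipschitz zeta : test_function zeta ->
  exists2 C, 0 <= C & forall x y, `|zeta x - zeta y| <= C * `|x - y|.
Proof.
move=> tz.
have : forall a, exists C : R, forall x : Rn, `|'D_('e_a) zeta x| <= C.
  move=> a; apply: csupp_bounded; [exact/test_cts/test_derive|exact/test_csupp/test_derive].
move=> /choice[C CP]; exists (n%:R * \sum_a `|C a|).
  by rewrite mulr_ge0// sumr_ge0.
apply: C1_lipschitz; first exact: test_C1.
move=> a x; apply: le_trans (CP a x) _; apply: le_trans (ler_norm _) _.
by rewrite (bigD1 a)//= lerDl sumr_ge0.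
Qed.

Lemma test_taylor rho (v : Rn) : test_function rho -> exists2 C, 0 <= C &
  forall z (h : R), `|rho (z + h *: v) - rho z - h * 'D_v rho z| <= C * h ^+ 2.
Proof.
move=> tr; have [C C0 CP] := test_lipschitz (test_derive v tr).
exists (C * `|v|); first by rewrite mulr_ge0.
move=> z h.
have [s [sh ->]] := @mean_value_line R n rho z v h (fun s _ => @test_derivable _ _ _ (z + s *: v) v tr).
rewrite -mulrBr normrM -(real_normK (num_real h)) expr2 mulrCA ler_wpM2l//.
apply: le_trans (CP _ _) _; rewrite addrAC subrr add0r normrZ -mulrA ler_wpM2l//.
by rewrite mulrC ler_wpM2l.
Qed.

Definition moll rho u (x : Rn) : R := \int[mu]_y (u y * rho (x - y)).

Lemma moll_int rho u x : test_function rho -> Lploc 1 u ->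
  mu.-integrable setT (EFin \o (fun y => u y * rho (x - y))).
Proof. by move=> tr u1; apply: rint_test => //; exact: test_reflect. Qed.

Let ballI (M : R) u : Lploc 1 u ->
  mu.-integrable setT (EFin \o (fun y => u y * \1_([set y : Rn | `|y| <= M]) y)).
Proof.
move=> u1; apply: (@rint_loc _ _ u _ 1); first exact: u1.
- apply: measurable_indic; apply: compact_measurable_rV; exact: compact_ball_norm.
- by move=> x; rewrite indicE; case: (_ \in _); rewrite ?normr1 ?normr0.
- exists M => x Mx; rewrite indicE memNset//= => h.
  by move: Mx; rewrite ltNge h.
Qed.

Let int_bound (M c : R) u f : Lploc 1 u -> measurable_fun setT f -> 0 <= c ->
  (forall y, `|f y| <= c) -> (forall y, M < `|y| -> f y = 0) ->
  `|\int[mu]_y (u y * f y)| <=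
    c * \int[mu]_y (`|u y * \1_([set y : Rn | `|y| <= M]) y|).
Proof.
move=> u1 mf c0 fc fM; have ui := rint_norm (ballI M u1).
have fi : mu.-integrable setT (EFin \o (fun y => u y * f y)).
  by apply: (rint_loc u1 mf fc); exists M.
apply: le_trans (le_normr_Rintegral _ fi) _ => //.
rewrite -RintegralZl//; apply: le_Rintegral => //; [exact: rint_norm|exact: rintZ|].
move=> y _; rewrite !normrM indicE; have [h|h] := leP `|y| M.
  by rewrite mem_set// normr1 mulr1 mulrC ler_wpM2r.
by rewrite fM// normr0 mulr0 mulr_ge0// mulr_ge0.
Qed.

Lemma is_derive_moll rho u (x v : Rn) : test_function rho -> Lploc 1 u ->
  is_derive x v (moll rho u) (moll ('D_v rho) u x).
Proof.
move=> tr u1; have [C C0 CP] := test_taylor v tr.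
have [M rM] := test_csupp tr.
have tdr := test_derive v tr.
(* For |h| <= 1 the remainder vanishes outside the ball of radius B. *)
pose B := `|x| + `|v| + Num.max M 0.
pose I := \int[mu]_y (`|u y * \1_([set y : Rn | `|y| <= B]) y|).
apply: (@is_derive_quadratic _ _ _ _ (C * I)) => h h1.
pose f y := rho (x - y + h *: v) - rho (x - y) - h * 'D_v rho (x - y).
have E : moll rho u (x + h *: v) - moll rho u x - h * moll ('D_v rho) u x =
    \int[mu]_y (u y * f y).
  rewrite /moll -RintegralB//; [|exact: moll_int..].
  rewrite -RintegralZl//; last exact: (moll_int x tdr u1).
  rewrite -RintegralB//; last 2 first.
  - by apply: rintB; exact: moll_int.
  - by apply: rintZ; exact: (moll_int x tdr u1).
  apply: eq_Rintegral => y _; rewrite /f [x - y + _]addrAC; ring.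
rewrite E -mulrA mulrC -mulrA; apply: le_trans (@int_bound B (C * h ^+ 2) u f u1 _ _ _ _) _.
- have cts y : continuous (fun z : Rn => rho (y - z)) by exact/test_cts/test_reflect.
  apply: continuous_measurable_rV; rewrite /f; apply: cts_add; first apply: cts_add.
  + rewrite (_ : (fun y => _) = (fun y => rho ((x + h *: v) - y))); first exact: cts.
    by apply/funext => y; rewrite addrAC.
  + exact/cts_opp/cts.
  + apply: cts_opp; apply: (@cts_mul R Rn (fun=> h)); first exact: cts_cst.
    exact: (test_cts (test_reflect x tdr)).
- by rewrite mulr_ge0// sqr_ge0.
- by move=> y; exact: CP.
- move=> y By; have M0 : M <= Num.max M 0 by rewrite le_max lexx.
  have M0' : 0 <= Num.max M 0 by rewrite le_max lexx orbT.
  have hv : `|h *: v| <= `|v| by rewrite normrZ ler_piMl.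
  have h0 : M < `|x - y| by have := lerB_normD x (x - y); rewrite /B in By *; have := ler_normB (x - y) x; rewrite addrAC subrr sub0r normrN; have := normr_ge0 v; lra.
  have h2 : M < `|x - y + h *: v|.
    have := ler_normB (x - y + h *: v) (x + h *: v).
    rewrite (_ : x - y + h *: v - (x + h *: v) = - y); last by apply/rowP => i; rewrite !mxE; ring.
    by rewrite normrN; have := ler_normD x (h *: v); rewrite /B in By; lra.
  rewrite /f rM// rM// (_ : 'D_v rho (x - y) = 0) ?mulr0 ?subr0//.
  exact: (derive_supp v rM h0).
- by rewrite -/I le_eqVlt; apply/orP; left; apply/eqP; ring.
Qed.

Lemma continuous_moll rho u : test_function rho -> Lploc 1 u ->
  continuous (moll rho u).
Proof.
move=> tr u1; have [C C0 CP] := test_lipschitz tr.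
have [M rM] := test_csupp tr.
apply: cts_rVR => z e e0.
pose B := `|z| + 1 + Num.max M 0.
pose I := \int[mu]_y (`|u y * \1_([set y : Rn | `|y| <= B]) y|).
have I0 : 0 <= I by apply: Rintegral_ge0 => y _.
have CI0 : 0 <= C * I by rewrite mulr_ge0.
exists (Num.min 1 (e / (C * I + 1))).
  by rewrite lt_min ltr01 /= divr_gt0//; lra.
move=> w; rewrite lt_min => /andP[w1 we].
have E : moll rho u z - moll rho u w = \int[mu]_y (u y * (rho (z - y) - rho (w - y))).
  rewrite /moll -RintegralB//; [|exact: moll_int..].
  by apply: eq_Rintegral => y _; ring.
rewrite E; apply: le_lt_trans (@int_bound B (C * `|z - w|) u _ u1 _ _ _ _) _.
- by apply: continuous_measurable_rV; apply: cts_add; [|apply: cts_opp];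
    exact/test_cts/test_reflect.
- by rewrite mulr_ge0.
- move=> y; apply: le_trans (CP _ _) _.
  by rewrite (_ : z - y - (w - y) = z - w)//; apply/rowP => i; rewrite !mxE; ring.
- move=> y By; have M0 : M <= Num.max M 0 by rewrite le_max lexx.
  have hz : M < `|z - y|.
    have := ler_normB (z - y) z; rewrite addrAC subrr sub0r normrN.
    by rewrite /B in By; lra.
  have hw : M < `|w - y|.
    have := ler_normB (w - y) w; rewrite addrAC subrr sub0r normrN.
    have := ler_normB z (z - w); rewrite opprB addrC subrK.
    by rewrite /B in By; lra.
  by rewrite rM// rM// subrr.
- rewrite mulrAC -/I; move: we; rewrite ltr_pdivlMr; last by lra.
  apply: le_lt_trans; rewrite mulrC ler_wpM2l//; lra.
Qed.

Lemma C1_moll rho u : test_function rho -> Lploc 1 u -> C1 (moll rho u).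
Proof.
move=> tr u1; split; first exact: continuous_moll.
move=> a; have D x := is_derive_moll x 'e_a tr u1; split=> [x|].
  by case: (D x).
rewrite (_ : 'D_('e_a) _ = moll ('D_('e_a) rho) u).
  by apply: continuous_moll => //; exact: test_derive.
by apply/funext => x; case: (D x).
Qed.

Lemma derive_moll rho u (v : Rn) : test_function rho -> Lploc 1 u ->
  'D_v (moll rho u) = moll ('D_v rho) u.
Proof. by move=> tr u1; apply/funext => x; case: (is_derive_moll x v tr u1). Qed.

(** Test the weak derivative with the reflected kernel rho(x - y). *)
Lemma moll_wderiv rho u g a : test_function rho -> is_wderiv a u g ->
  moll ('D_('e_a) rho) u = moll rho g.
Proof.
move=> tr [u1 g1 ug]; apply/funext => x.
have := ug _ (test_reflect x tr).
have [_ D] := smooth_reflect x tr.1.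
under eq_Rintegral do rewrite D mulrN.
rewrite RintN; first by move/oppr_inj.
exact: (moll_int x (test_derive 'e_a tr) u1).
Qed.

(** * Approximate units *)

Definition mollifier_raw (k : nat) : Rn -> R :=
  product_fun (fun=> bump (- k.+1%:R^-1) k.+1%:R^-1).

Definition mollifier (k : nat) (x : Rn) : R :=
  (\int[mu]_y mollifier_raw k y)^-1 * mollifier_raw k x.

Let raw_ge0 k x : 0 <= mollifier_raw k x.
Proof. by apply: prodr_ge0 => i _; exact: bump_ge0. Qed.

Let raw_supp k x : k.+1%:R^-1 < `|x| -> mollifier_raw k x = 0.
Proof.
move=> h; have [i hi] : exists i, ~ (`|x 0 i| <= k.+1%:R^-1).
  apply/existsNP => H; move: h; rewrite ltNge => /negP; apply.
  by apply: norm_le_coord.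
rewrite /mollifier_raw /product_fun (bigD1 i)//= bump_eq0 ?mul0r//.
move/negP: hi; rewrite -ltNge lter_normr; move: (k.+1%:R^-1 : R) => c.
by move=> /orP[|] hi; [right|left]; lra.
Qed.

Let raw_test k : test_function (mollifier_raw k).
Proof.
apply: csupp_test; first by apply: smooth_product_fun => i; exact: smooth_bump.
by exists k.+1%:R^-1; exact: raw_supp.
Qed.

Let raw_int k : mu.-integrable setT (EFin \o mollifier_raw k).
Proof. by apply: rint_cts; [exact/test_cts|exact/test_csupp]. Qed.

(** A nonnegative function with vanishing integral is zero almost everywhere,
    but the kernel is positive on a box of positive volume. *)
Let raw_gt0 k : 0 < \int[mu]_y mollifier_raw k y.
Proof.
rewrite lt_neqAle Rintegral_ge0 ?andbT//; apply/eqP => /esym I0.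
have : {ae mu, forall x, mollifier_raw k x = 0}.
  apply: integral_eq0_ae => //; first exact: (rint_meas (raw_int k)).
  by rewrite Rint_EFin// I0.
have S : ~` [set x | mollifier_raw k x = 0] =
    open_box (const_mx (- k.+1%:R^-1)) (const_mx k.+1%:R^-1).
  apply/seteqP; split => x /=.
    move=> h i; rewrite !mxE; apply/negPn/negP => hi; apply: h.
    rewrite /mollifier_raw /product_fun (bigD1 i)//= bump_eq0 ?mul0r//.
    by move: hi; rewrite negb_and -!leNgt => /orP[|]; tauto.
  move=> h; apply/eqP; rewrite gt_eqF//; apply: prodr_gt0 => i _.
  by apply: bump_gt0; have := h i; rewrite !mxE.
move=> /negligibleP; rewrite S => /(_ (measurable_open_box _ _)) h.
have /eqP := etrans (esym (lebesgue_open_box _ _)) h.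
apply/negP; rewrite eqe gt_eqF//; apply: prodr_gt0 => i _; rewrite !mxE gtrN//.
Qed.

Lemma mollifier_test k : test_function (mollifier k).
Proof. exact: test_scale. Qed.

Lemma mollifier_ge0 k x : 0 <= mollifier k x.
Proof. by rewrite mulr_ge0// invr_ge0 ltW. Qed.

Lemma mollifier_gt0 k : 0 < mollifier k 0.
Proof.
rewrite mulr_gt0 ?invr_gt0 ?raw_gt0//; apply: prodr_gt0 => i _; rewrite mxE.
by apply: bump_gt0; rewrite oppr_lt0 invr_gt0 ltr0n.
Qed.

Lemma mollifier_supp k x : k.+1%:R^-1 < `|x| -> mollifier k x = 0.
Proof. by move=> h; rewrite /mollifier raw_supp ?mulr0. Qed.

Lemma mollifier_int k : mu.-integrable setT (EFin \o mollifier k).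
Proof. exact: rintZ. Qed.

Lemma mollifier_mass k : \int[mu]_x mollifier k x = 1.
Proof. by rewrite RintegralZl// mulVf// gt_eqF. Qed.

Lemma mollifier_massl k x : \int[mu]_y mollifier k (x - y) = 1.
Proof. by rewrite -(Rintegral_reflect x (mollifier_int k)) mollifier_mass. Qed.

Lemma mollifier_intl k x : mu.-integrable setT (EFin \o (fun y => mollifier k (x - y))).
Proof.
have t := test_reflect x (mollifier_test k).
by apply: rint_cts; [exact: test_cts|exact: test_csupp].
Qed.

Let neg_test k : test_function (fun x => mollifier k (- x)).
Proof.
rewrite (_ : (fun x => _) = (fun x => mollifier k (0 - x))).
  exact: test_reflect (mollifier_test k).
by apply/funext => x; rewrite sub0r.
Qed.

Lemma mollifier_intr k y : mu.-integrable setT (EFin \o (fun x => mollifier k (x - y))).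
Proof.
have t := test_reflect y (neg_test k).
apply: (eq_integrable measurableT (EFin \o (fun x => mollifier k (- (y - x))))).
  by move=> x _ /=; rewrite opprB.
by apply: rint_cts; [exact: test_cts|exact: test_csupp].
Qed.

Lemma mollifier_massr k y : \int[mu]_x mollifier k (x - y) = 1.
Proof.
transitivity (\int[mu]_x mollifier k (- (y - x))).
  by apply: eq_Rintegral => x _; rewrite opprB.
rewrite -(@Rintegral_reflect R n y (fun x => mollifier k (- x))).
  transitivity (\int[mu]_x mollifier k (0 - x)); last exact: mollifier_massl.
  by apply: eq_Rintegral => x _; rewrite sub0r.
by apply: rint_cts; [exact/test_cts/neg_test|exact/test_csupp/neg_test].
Qed.

End mollification.

(** * Weak convergence of mollifications *)
Section weak_convergence.
Context {R : realType} {n : nat}.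
Local Notation Rn := 'rV[R]_n.
Local Notation mu := (@lebesgue_rV R n).
Implicit Types (f g u v w rho zeta : Rn -> R) (a : 'I_n).

(** The adjoint of mollification. *)
Let smoothing k w (y : Rn) : R := \int[mu]_x (mollifier k (x - y) * w x).

Let smoothing_int k w y : continuous w -> csupp w ->
  mu.-integrable setT (EFin \o (fun x => mollifier k (x - y) * w x)).
Proof.
move=> cw sw; apply: rint_loc_cts => //; apply: rint_L1loc.
exact: mollifier_intr.
Qed.

Let smoothing_near k w (y : Rn) (e : R) : continuous w -> csupp w ->
  (forall x, `|x - y| <= k.+1%:R^-1 -> `|w x - w y| <= e) ->
  `|smoothing k w y - w y| <= e.
Proof.
move=> cw sw we.
have mi := mollifier_intr k y; have si := smoothing_int k y cw sw.
have E : smoothing k w y - w y = \int[mu]_x (mollifier k (x - y) * (w x - w y)).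
  rewrite -[X in _ - X]mulr1 -(mollifier_massr k y) -RintegralZl//.
  rewrite -RintegralB//; last exact: rintZ.
  by apply: eq_Rintegral => x _; ring.
have i1 : mu.-integrable setT (EFin \o (fun x => mollifier k (x - y) * (w x - w y))).
  apply: (eq_integrable measurableT (EFin \o (fun x => mollifier k (x - y) * w x - w y * mollifier k (x - y)))).
    by move=> x _ /=; congr EFin; ring.
  by apply: rintB => //; exact: rintZ.
rewrite E; apply: le_trans (le_normr_Rintegral _ i1) _ => //.
rewrite -[leRHS]mulr1 -(mollifier_massr k y) -RintegralZl//.
apply: le_Rintegral => //; [exact: rint_norm|exact: rintZ|move=> x _].
rewrite normrM ger0_norm ?mollifier_ge0// mulrC.
have [h|h] := leP `|x - y| k.+1%:R^-1; first by rewrite ler_wpM2r ?mollifier_ge0// we.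
by rewrite mollifier_supp// !mulr0.
Qed.

Lemma invS_lt (e : R) : 0 < e -> \forall k \near \oo, k.+1%:R^-1 < e :> R.
Proof.
move=> e0; near=> k.
rewrite invf_plt ?posrE//; apply: lt_le_trans (_ : k%:R <= _); last by rewrite ler_nat.
by near: k; exact: nbhs_infty_gtr.
Unshelve. all: by end_near. Qed.

Lemma invS_le1 k : k.+1%:R^-1 <= 1 :> R.
Proof. by rewrite invf_le1// ler1n. Qed.

(** Mollifications converge weakly, by moving the mollifier onto the
    continuous function against which they are integrated. *)
Lemma moll_cvg u w : Lploc 1 u -> continuous w -> csupp w ->
  \int[mu]_x (moll (mollifier k) u x * w x) @[k --> \oo] --> \int[mu]_x (u x * w x).
Proof.
move=> u1 cw sw; have [C wC] := csupp_bounded cw sw; have [M wM] := sw.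
have C0 : 0 <= C by exact: le_trans (wC 0).
pose B : set Rn := [set y : Rn | `|y| <= M + 1].
(* The mollifiers have radius at most 1, so only the values of u on B matter. *)
pose uB (y : Rn) := u y * \1_B y.
have mB : measurable B by apply: compact_measurable_rV; exact: compact_ball_norm.
have uBi : mu.-integrable setT (EFin \o uB).
  apply: (@rint_loc _ _ u _ 1); first exact: u1.
  - exact: measurable_indic.
  - by move=> x; rewrite indicE; case: (_ \in _); rewrite ?normr1 ?normr0.
  - exists (M + 1) => x Mx; rewrite indicE memNset//= => h.
    by move: Mx; rewrite ltNge h.
have wi := rint_cts cw sw.
have E k : \int[mu]_x (moll (mollifier k) u x * w x) =
    \int[mu]_y (uB y * smoothing k w y).
  transitivity (\int[mu]_x ((\int[mu]_y (uB y * mollifier k (x - y))) * w x)).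
    apply: eq_Rintegral => x _; have [h|/wM ->] := leP `|x| M; last by rewrite !mulr0.
    congr (_ * _); apply: eq_Rintegral => y _; rewrite /uB indicE.
    have [_|] := boolP (y \in B); first by rewrite mulr1.
    rewrite notin_setE /B /= => /negP; rewrite -ltNge => hy.
    rewrite mollifier_supp ?mulr0//; apply: le_lt_trans (invS_le1 k) _.
    by have := ler_normB x (x - y); rewrite opprB addrC subrK; lra.
  have tm := @mollifier_test R n k.
  have [c mc] := csupp_bounded (test_cts tm) (test_csupp tm).
  apply: (@fubini_kernel _ _ _ _ (fun p => mollifier k (p.1 - p.2)) c uBi wi _ _) => //.
  have mm : measurable_fun setT (mollifier k : Rn -> R).
    exact: (continuous_measurable_rV (test_cts tm)).
  apply: (measurableT_comp mm); apply: measurable_mxP => i j.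
  under eq_fun do rewrite !mxE.
  by apply: measurable_funB; apply: (measurableT_comp (measurable_mx_coord i j)).
have sb k y : `|smoothing k w y| <= C.
  rewrite /smoothing; apply: le_trans (le_normr_Rintegral _ (smoothing_int k y cw sw)) _ => //.
  have mi := mollifier_intr k y.
  rewrite -[leRHS]mulr1 -(mollifier_massr k y) -RintegralZl//.
  apply: le_Rintegral => //; [exact: rint_norm (smoothing_int k y cw sw)|exact: rintZ|move=> x _].
  by rewrite normrM ger0_norm ?mollifier_ge0// mulrC ler_wpM2r ?mollifier_ge0.
have ms k : measurable_fun setT (smoothing k w).
  apply: continuous_measurable_rV.
  have -> : smoothing k w = moll (fun x => mollifier k (- x)) w.
    by apply/funext => y; apply: eq_Rintegral => x _; rewrite opprB mulrC.
  apply: continuous_moll; last exact: Lploc_cts.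
  rewrite (_ : (fun x => _) = (fun x => mollifier k (0 - x))).
    exact: test_reflect (mollifier_test k).
  by apply/funext => x; rewrite sub0r.
have [||||_] := @Rint_dct _ Rn R mu (fun k y => uB y * smoothing k w y)
  (fun y => uB y * w y) (fun y => C * `|uB y|).
- by move=> k; apply: measurable_funM => //; exact: (rint_meas uBi).
- move=> y; apply: cvgM; first exact: cvg_cst.
  apply/cvgrPdist_le => e e0.
  have := cw y; move=> /(_ (ball (w y) e) (nbhsx_ballx _ _ e0))/nbhs_ballP[r /= r0 rP].
  near=> k; rewrite distrC; apply: smoothing_near => // x xy.
  rewrite distrC; apply: ltW; have := rP x; rewrite -!ball_normE /=; apply.
  rewrite distrC; apply: le_lt_trans xy _; near: k; exact: invS_lt.
- by move=> k y; rewrite normrM mulrC ler_wpM2r.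
- by apply: rintZ; exact: rint_norm.
move=> cv; have -> : \int[mu]_x (u x * w x) = \int[mu]_x (uB x * w x).
  apply: eq_Rintegral => x _; rewrite /uB indicE.
  have [_|] := boolP (x \in B); first by rewrite mulr1.
  rewrite notin_setE /B /= => /negP; rewrite -ltNge => hy.
  by rewrite wM ?mulr0//; lra.
rewrite (_ : (fun k => _) = (fun k => \int[mu]_y (uB y * smoothing k w y))).
  exact: cv.
by apply/funext => k; rewrite E.
Unshelve. all: by end_near. Qed.

(** The mollifications have vanishing gradient, so they are constants; the
    constants converge since the mollifications converge weakly. *)
Lemma wderiv0_cst u : (forall a, is_wderiv a u (fun=> 0)) -> Lploc 1 u ->
  exists c, {ae mu, forall x, u x = c}.
Proof.
move=> u0 u1.
have [c cP] : exists c : nat -> R, forall k x, moll (mollifier k) u x = c k.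
  exists (fun k => moll (mollifier k) u 0) => k x.
  have cm := C1_moll (mollifier_test k) u1.
  have L := @C1_lipschitz _ _ _ 0 cm.
  apply/eqP; rewrite -subr_eq0 -normr_le0; apply: le_trans (L _ _ _) _; last first.
    by rewrite mulr0 mul0r.
  move=> a y; rewrite [X in `|X| <= _](_ : _ = 0) ?normr0//.
  transitivity (moll ('D_('e_a) (mollifier k)) u y).
    exact: (congr1 (@^~ y) (derive_moll 'e_a (@mollifier_test R n k) u1)).
  rewrite (moll_wderiv (mollifier_test k) (u0 a)) /moll.
  by under eq_Rintegral do rewrite mul0r; rewrite Rint0.
have mc0 : continuous (mollifier 0%N : Rn -> R) by apply/test_cts/mollifier_test.
have ms0 : csupp (mollifier 0%N : Rn -> R) by apply/test_csupp/mollifier_test.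
have cE k w : continuous w -> csupp w ->
    \int[mu]_x (moll (mollifier k) u x * w x) = c k * \int[mu]_x w x.
  move=> cw sw; under eq_Rintegral do rewrite cP.
  by rewrite RintegralZl//; exact: rint_cts.
pose c0 := \int[mu]_x (u x * mollifier 0%N x).
have cc0 : c @ \oo --> c0.
  rewrite (_ : c = fun k => \int[mu]_x (moll (mollifier k) u x * mollifier 0%N x)).
    exact: moll_cvg u1 mc0 ms0.
  by apply/funext => k; rewrite cE// mollifier_mass mulr1.
exists c0; have u1' : Lploc 1 (fun x => u x + - c0).
  by apply: L1locD; [exact: u1|exact: Lploc1_cst].
have : {ae mu, forall x, u x + - c0 = 0}.
  apply: fundamental_lemma => // zeta tz.
  have zi := rint_cts (test_cts tz) (test_csupp tz).
  under eq_Rintegral do rewrite mulrDl.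
  rewrite RintegralD//; [|exact: rint_test|exact: rintZ].
  rewrite RintegralZl// mulNr; apply/eqP; rewrite subr_eq0; apply/eqP.
  have h1 := moll_cvg u1 (test_cts tz) (test_csupp tz).
  apply: (cvg_unique _ h1) => //.
  rewrite (_ : (fun k => _) = (fun k => c k * \int[mu]_x zeta x)).
    by apply: cvgM => //; exact: cvg_cst.
  by apply/funext => k; apply: cE; [exact: test_cts|exact: test_csupp].
by apply: filterS => x; lra.
Qed.

End weak_convergence.

(** * The weak chain rule for shears *)

Lemma cts_inv {R : realType} (T : topologicalType) (f : T -> R) :
  (forall x, f x != 0) -> continuous f -> continuous (fun x => (f x)^-1).
Proof. by move=> f0 cf x; apply: cvgV; [exact: f0|exact: cf]. Qed.

Section shear_chain_rule.
Context {R : realType} {n : nat}.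
Local Notation Rn := 'rV[R]_n.
Local Notation mu := (@lebesgue_rV R n).
Implicit Types (f g u v w : Rn -> R) (a : 'I_n).

Context (b : 'I_n) (k : Rn -> R) (C : R).
Hypotheses (kC1 : C1 k) (ks : csupp k).
Hypotheses (nC : n%:R * C <= 2^-1) (dk : forall a x, `|'D_('e_a) k x| <= C).
Local Notation J := (fun x => 1 + 'D_('e_b) k x).

Let J2 x : 2^-1 <= J x.
Proof. exact: (shear_jacobian b nC dk). Qed.

(** The Jacobian is at least 1/2, so changing variables costs a factor of 2. *)
Lemma shear_L1loc f : Lploc 1 f -> Lploc 1 (fun x => f (shear b k x)).
Proof.
move=> f1; have mf : measurable_fun setT f by case: f1.
have mS : measurable_fun setT (shear b k) by exact: (measurable_shear b kC1).
apply: int_L1loc => [|D cD]; first exact: (measurableT_comp mf mS).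
have mD : measurable D by exact: compact_measurable_rV.
have [B kB] := csupp_bounded (proj1 kC1) ks.
have [M0 [_ /(_ (M0 + 1))]] := compact_bounded cD.
rewrite ltrDl => /(_ ltr01); set M := M0 + 1 => DM.
pose I : set Rn := [set x : Rn | `|x| <= M + B].
have mI : measurable I by apply: compact_measurable_rV; exact: compact_ball_norm.
have fI : mu.-integrable setT (EFin \o (fun x => f x * \1_I x)).
  apply: (@rint_loc _ _ f _ 1); first exact: f1.
  - exact: measurable_indic.
  - by move=> x; rewrite indicE; case: (_ \in _); rewrite ?normr1 ?normr0.
  - by exists (M + B) => x Mx; rewrite indicE memNset//= => h; move: Mx; rewrite ltNge h.
have h1 := rintZ 2 (rint_norm (shear_integrable b kC1 ks nC dk fI)).
apply: (le_integrable mD) (integrableS measurableT mD (@subsetT _ _) h1).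
  by apply/measurable_EFinP; apply: measurable_funTS; exact: (measurableT_comp mf mS).
move=> x Dx /=; rewrite lee_fin [leRHS]ger0_norm ?mulr_ge0//.
rewrite indicE mem_set ?mulr1; last first.
  rewrite /I /shear /=; apply: le_trans (ler_normD _ _) _; apply: lerD; first exact: DM.
  rewrite normrZ; apply: le_trans (_ : B * 1 <= _); last by rewrite mulr1.
  apply: ler_pM => //; apply: norm_le_coord => // i.
  by rewrite mxE eqxx /=; case: (_ == _); rewrite ?normr1 ?normr0.
rewrite normrM mulrCA ler_peMr//; have := J2 x; move: (1 + _) => t t2.
by rewrite ger0_norm; lra.
Qed.

(** The adjoint of the composition with a shear, W = (w / J) o Psi with Psi the
    inverse shear.  The last clause controls W through the point z' = Psi z, which
    is what the limit of small shears requires. *)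
Lemma shear_dual w : continuous w -> csupp w ->
  exists W, [/\ continuous W, csupp W, forall u, Lploc 1 u ->
      \int[mu]_x (u (shear b k x) * w x) = \int[mu]_x (u x * W x)
    & forall z, exists2 z', W z = w z' * (1 + 'D_('e_b) k z')^-1 &
      forall B, (forall x, `|k x| <= B) -> `|z' - z| <= B].
Proof.
move=> cw sw.
have [Psi [K1 K2 cP PB]] := shear_inverse b kC1 ks nC dk.
have [B kB] := csupp_bounded (proj1 kC1) ks.
have [M wM] := sw.
pose W z := w (Psi z) * (J (Psi z))^-1.
have cJ : continuous J.
  apply: cts_add; first exact: cts_cst.
  by have [_ /(_ b) []] := kC1.
have J0 x : J x != 0 by rewrite gt_eqF//; have := J2 x; lra.
have cW : continuous W.
  apply: cts_mul; first exact: (cts_comp cP cw).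
  by apply: cts_inv => [z|]; [exact: J0|exact: (cts_comp cP cJ)].
have sW : csupp W.
  exists (M + B) => z Mz; rewrite /W wM ?mul0r//.
  have := PB B kB z; have := ler_normB (Psi z) (Psi z - z).
  by rewrite opprB addrC subrK; lra.
exists W; split=> // [u u1|z]; last by exists (Psi z) => // B' kB'; exact: PB.
rewrite (shear_Rintegral b kC1 ks nC dk (rint_loc_cts u1 cW sW)).
by apply: eq_Rintegral => x _; rewrite /W K1 mulrA divfK.
Qed.

Lemma shear_differentiable x : differentiable (shear b k) x /\
  forall v : Rn, 'd (shear b k) x v = v + 'd k x v *: 'e_b.
Proof.
have dk' : differentiable k x by exact: C1_differentiable.
have d1 : differentiable (fun x => k x *: 'e_b : Rn) x.
  exact: differentiableZl.
split; first by apply: differentiableD.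
move=> v; rewrite (@diffD _ _ _ id (fun x => k x *: 'e_b : Rn)) //.
change ('d (@id Rn) x v + 'd (fun x => k x *: 'e_b : Rn) x v = v + 'd k x v *: 'e_b).
have E1 : 'd (@id Rn) x = id :> (Rn -> Rn) by exact: diff_val.
have E2 : 'd (fun x => k x *: 'e_b : Rn) x = (fun z => 'd k x z *: 'e_b) :> (Rn -> Rn).
  exact: diffZl dk'.
exact: (congr2 (fun f g : Rn -> Rn => f v + g v) E1 E2).
Qed.

Lemma C1_shear v : C1 v -> C1 (fun x => v (shear b k x)) /\
  forall a x, 'D_('e_a) (fun x => v (shear b k x)) x =
    'D_('e_a) v (shear b k x) + 'D_('e_a) k x * 'D_('e_b) v (shear b k x).
Proof.
move=> vC1.
have D a x : derivable (fun x => v (shear b k x)) x 'e_a /\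
    'D_('e_a) (fun x => v (shear b k x)) x =
    'D_('e_a) v (shear b k x) + 'D_('e_a) k x * 'D_('e_b) v (shear b k x).
  have [ds dsE] := shear_differentiable x.
  have dv : differentiable v (shear b k x) by exact: C1_differentiable.
  have dc : differentiable (v \o shear b k) x by exact: differentiable_comp.
  split; first exact: diff_derivable.
  rewrite (deriveE _ dc) (diff_comp ds dv) /= dsE linearD linearZ /=.
  by rewrite (deriveE 'e_a dv) (deriveE 'e_b dv) (deriveE 'e_a (C1_differentiable x kC1)).
have cs : continuous (shear b k).
  by move=> x; apply: differentiable_continuous; case: (shear_differentiable x).
split; last by move=> a x; case: (D a x).
split; first by apply: cts_comp cs _; case: vC1.
move=> a; split; first by move=> x; case: (D a x).
rewrite (_ : 'D_('e_a) _ = fun x =>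
    'D_('e_a) v (shear b k x) + 'D_('e_a) k x * 'D_('e_b) v (shear b k x)).
  have [_ vc] := vC1; have [_ kc] := kC1.
  apply: cts_add; first exact: (cts_comp cs (vc a).2).
  by apply: cts_mul; [exact: (kc a).2|exact: (cts_comp cs (vc b).2)].
by apply/funext => x; case: (D a x).
Qed.

Let moll_shear_cvg u w : Lploc 1 u -> continuous w -> csupp w ->
  \int[mu]_x (moll (mollifier j) u (shear b k x) * w x) @[j --> \oo] -->
  \int[mu]_x (u (shear b k x) * w x).
Proof.
move=> u1 cw sw; have [W [cW sW WE _]] := shear_dual cw sw.
rewrite WE//; under eq_fun => j.
  rewrite WE; last by apply: Lploc_cts ler01 _; exact: continuous_moll (@mollifier_test R n j) u1.
  over.
exact: moll_cvg.
Qed.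

(** The classical chain rule holds for the mollifications of u, and all terms pass
    to the limit: the shear moves onto the test functions, against which
    mollifications converge. *)
Lemma is_wderiv_shear u (g : 'I_n -> Rn -> R) : (forall a, is_wderiv a u (g a)) ->
  forall a, is_wderiv a (fun x => u (shear b k x))
    (fun x => g a (shear b k x) + 'D_('e_a) k x * g b (shear b k x)).
Proof.
move=> ug a; have u1 : Lploc 1 u by case: (ug a).
have g1 c : Lploc 1 (g c) by case: (ug c).
have [_ kc] := kC1.
have [Ca [_ dCa]] : exists Ca, 0 <= Ca /\ forall x, `|'D_('e_a) k x| <= Ca.
  by exists C; split => //; apply: le_trans (dk a 0).
split; first exact: shear_L1loc.
  apply: L1locD; first exact: (shear_L1loc (g1 a)).
  apply: (Lploc_mul ler01 (shear_L1loc (g1 b)) _ dCa).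
  by apply: continuous_measurable_rV; case: (kc a).
move=> zeta tz.
have c1 := test_cts tz; have s1 := test_csupp tz.
have cd := test_cts (test_derive 'e_a tz); have sd := test_csupp (test_derive 'e_a tz).
have ck : continuous (fun x => 'D_('e_a) k x * zeta x).
  by apply: cts_mul => //; case: (kc a).
have sk : csupp (fun x => 'D_('e_a) k x * zeta x) by exact: csuppMr.
have lim1 := moll_shear_cvg u1 cd sd.
have lim2 := moll_shear_cvg (g1 a) c1 s1.
have lim3 := moll_shear_cvg (g1 b) ck sk.
have Lm j f : Lploc 1 f -> Lploc 1 (fun x => moll (mollifier j) f (shear b k x)).
  move=> f1; apply: shear_L1loc; apply: Lploc_cts ler01 _.
  exact: continuous_moll (@mollifier_test R n j) f1.
have E j : \int[mu]_x (moll (mollifier j) u (shear b k x) * 'D_('e_a) zeta x) =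
   - (\int[mu]_x (moll (mollifier j) (g a) (shear b k x) * zeta x) +
      \int[mu]_x (moll (mollifier j) (g b) (shear b k x) * ('D_('e_a) k x * zeta x))).
  have mC1 := C1_moll (@mollifier_test R n j) u1.
  have [sC1 sD] := C1_shear mC1.
  have DE c y : 'D_('e_c) (moll (mollifier j) u) y = moll (mollifier j) (g c) y.
    rewrite -(moll_wderiv (@mollifier_test R n j) (ug c)).
    exact: (congr1 (@^~ y) (derive_moll 'e_c (@mollifier_test R n j) u1)).
  rewrite (integration_by_parts_rV a sC1 (test_C1 tz) s1).
  rewrite -RintegralD//; [|exact: (rint_loc_cts (Lm j _ (g1 a)))|exact: (rint_loc_cts (Lm j _ (g1 b)))].
  congr (- _); apply: eq_Rintegral => x _; rewrite sD.
  by rewrite !DE; ring.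
rewrite (_ : - _ = - (\int[mu]_x (g a (shear b k x) * zeta x) +
    \int[mu]_x (g b (shear b k x) * ('D_('e_a) k x * zeta x)))); last first.
  rewrite -RintegralD//; [|exact: (rint_loc_cts (shear_L1loc (g1 a)))
    |exact: (rint_loc_cts (shear_L1loc (g1 b)))].
  by congr (- _); apply: eq_Rintegral => x _; ring.
have lim : \int[mu]_x (moll (mollifier j) u (shear b k x) * 'D_('e_a) zeta x) @[j --> \oo] -->
    - (\int[mu]_x (g a (shear b k x) * zeta x) +
    \int[mu]_x (g b (shear b k x) * ('D_('e_a) k x * zeta x))).
  by rewrite (funext E); apply: cvgN; exact: cvgD.
exact: (cvg_unique _ lim1 lim).
Qed.

End shear_chain_rule.

(** * Smooth vector-valued maps *)

Section smooth_vectors.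
Context {R : realType}.

Lemma smooth_sum {V : normedModType R} (U : set V) (I : Type) (r : seq I) (P : pred I)
    (f : I -> V -> R) : open U -> (forall i, smooth_on U (f i)) ->
  smooth_on U (fun x => \sum_(i <- r | P i) f i x).
Proof.
move=> oU sf; apply: (smooth_algebra_smooth oU); elim: r => [|i r IH].
  under eq_fun do rewrite big_nil; exact: smooth_cst.
under eq_fun do rewrite big_cons; case: (P i) => //.
by apply: smooth_add => //; exact: smooth_gen.
Qed.

Lemma smooth_bigprod {V : normedModType R} (U : set V) (I : Type) (r : seq I) (P : pred I)
    (f : I -> V -> R) : open U -> (forall i, smooth_on U (f i)) ->
  smooth_on U (fun x => \prod_(i <- r | P i) f i x).
Proof.
move=> oU sf; apply: (smooth_algebra_smooth oU); elim: r => [|i r IH].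
  under eq_fun do rewrite big_nil; exact: smooth_cst.
under eq_fun do rewrite big_cons; case: (P i) => //.
by apply: smooth_mul => //; exact: smooth_gen.
Qed.

Lemma smooth_onS {V W : normedModType R} (U U' : set V) (f : V -> W) :
  U' `<=` U -> smooth_on U f -> smooth_on U' f.
Proof. by move=> UU sf vs x /UU; exact: sf. Qed.

Lemma derive_coord {V : normedModType R} {m} (f : V -> 'rV[R]_m) x v i :
  derivable f x v ->
  derivable (fun y => f y 0 i) x v /\ 'D_v (fun y => f y 0 i) x = 'D_v f x 0 i.
Proof.
move=> df; split; first by move/derivable_mxP: df.
by rewrite (derive_mx df) mxE.
Qed.

Lemma continuous_coord_at {V : topologicalType} {m} (f : V -> 'rV[R]_m) x :
  {for x, continuous f} <-> forall i, {for x, continuous (fun y => f y 0 i)}.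
Proof.
split=> [cf i|cf].
  move=> A nA; exact: (cf _ (@cts_coord R m i (f x) A nA)).
move=> A /nbhs_ballP[e /= e0 eA].
have : \forall y \near x, forall i, ball (f x 0 i) e (f y 0 i).
  by apply: filter_forall => i; apply: cf; exact: nbhsx_ballx.
apply: filterS => y h; apply: eA; split=> // i j; rewrite ord1; exact: h.
Qed.

Lemma smooth_on_coord {V : normedModType R} {m} (U : set V) (f : V -> 'rV[R]_m) i :
  open U -> smooth_on U f -> smooth_on U (fun y => f y 0 i).
Proof.
move=> oU sf.
apply: (@smooth_on_coind _ _ _ U (fun g => exists2 G : V -> 'rV[R]_m, smooth_on U G & g = fun y => G y 0 i)) => //.
- move=> _ x [G sG ->] Ux; split.
    by have /continuous_coord_at := smooth_on_continuous sG Ux; apply.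
  by move=> v; case: (derive_coord i (smooth_on_derivable sG (v := v) Ux)).
- move=> _ v [G sG ->]; exists (fun y => 'D_v G y 0 i).
    by exists ('D_v G); [exact: (smooth_on_derive v sG)|].
  by move=> x Ux; case: (derive_coord i (smooth_on_derivable sG (v := v) Ux)).
- by exists f.
Qed.

Lemma smooth_on_row {V : normedModType R} {m} (U : set V) (f : V -> 'rV[R]_m) :
  open U -> (forall i, smooth_on U (fun y => f y 0 i)) -> smooth_on U f.
Proof.
move=> oU sf.
have dR (G : V -> 'rV[R]_m) x v : U x -> (forall i, smooth_on U (fun y => G y 0 i)) ->
    derivable G x v.
  move=> Ux sG; apply/derivable_mxP => i j; rewrite ord1.
  exact: (smooth_on_derivable (sG j) Ux).
apply: (@smooth_on_coind _ _ _ U (fun g : V -> 'rV[R]_m => forall i, smooth_on U (fun y => g y 0 i))) => //.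
- move=> G x sG Ux; split; last by move=> v; exact: dR.
  by apply/continuous_coord_at => i; exact: (smooth_on_continuous (sG i) Ux).
- move=> G v sG; exists (fun y => \row_i 'D_v (fun y => G y 0 i) y).
    move=> i; rewrite (_ : (fun y => _) = 'D_v (fun y => G y 0 i)).
      exact: smooth_on_derive.
    by apply/funext => y; rewrite mxE.
  by move=> x Ux; rewrite (derive_mx (dR G x v Ux sG)); apply/rowP => j; rewrite !mxE.
Qed.

(** Coinduction on the class of the functions a q_i + b. *)
Lemma smooth_coordinate {n} (U : set 'rV[R]_n) i : open U ->
  smooth_on U (fun q : 'rV[R]_n => q 0 i).
Proof.
move=> oU.
apply: (@smooth_on_coind _ _ _ U (fun f : 'rV[R]_n -> R =>
  exists a b : R, f = fun q => a * q 0 i + b)) => //; last first.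
- by exists 1, 0; apply/funext => q; rewrite mul1r addr0.
- move=> _ w [x [y ->]]; exists (fun=> x * w 0 i).
    by exists 0, (x * w 0 i); apply/funext => q; rewrite mul0r add0r.
  move=> q _; have d1 := is_derive_coord i q w.
  rewrite deriveD ?derive_cst ?addr0; [|exact: derivableM|exact: derivable_cst].
  by rewrite (deriveZ (f := fun q : 'rV[R]_n => q 0 i))// derive_val.
- move=> _ q [x [y ->]] _; split.
    have h : continuous (fun q : 'rV[R]_n => x * q 0 i + y).
      apply: cts_add; last exact: cts_cst.
      by apply: cts_mul; [exact: cts_cst|exact: cts_coord].
    exact: h.
  move=> w; have d1 := is_derive_coord i q w.
  by apply: derivableD; [exact: derivableM|exact: derivable_cst].
Qed.

Lemma smooth_on_differentiable {n} (U : set 'rV[R]_n) (f : 'rV[R]_n -> R) x :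
  open U -> smooth_on U f -> U x -> differentiable f x.
Proof.
move=> oU sf Ux; apply: differentiable_C1_at.
  have : \forall z \near x, U z by exact: open_nbhs_nbhs.
  by apply: filterS => z Uz i; exact: (smooth_on_derivable sf Uz).
by move=> i; exact: (smooth_on_continuous (smooth_on_derive _ sf) Ux).
Qed.

Lemma derive_basis {n} (f : 'rV[R]_n -> R) x v : differentiable f x ->
  'D_v f x = \sum_j v 0 j * 'D_('e_j) f x.
Proof.
move=> df; rewrite deriveE// {1}(row_sum_delta v) linear_sum.
by apply: eq_bigr => j _; rewrite linearZ deriveE.
Qed.

Lemma is_derive_curve {n} (U : set 'rV[R]_n) (f : 'rV[R]_n -> R) (c : R -> 'rV[R]_n) t c' :
  open U -> smooth_on U f -> U (c t) -> is_derive t 1 c c' ->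
  is_derive t 1 (fun s => f (c s)) (\sum_j c' 0 j * 'D_('e_j) f (c t)).
Proof.
move=> oU sf Uc [dc <-].
have dc' : differentiable c t by exact/derivable1_diffP.
have df := smooth_on_differentiable oU sf Uc.
have dfc : differentiable (f \o c) t by exact: differentiable_comp.
split; first exact/derivable1_diffP.
rewrite (deriveE _ dfc) (diff_comp dc' df) /= -(deriveE _ dc') -derive_basis//.
by rewrite (deriveE _ df).
Qed.

Lemma mulmx_norm_bound m n (A : 'M[R]_(m, n)) : exists2 C, 0 <= C &
  forall s : 'rV[R]_m, `|s *m A| <= C * `|s|.
Proof.
exists (\sum_i \sum_j `|A i j|).
  by apply: sumr_ge0 => i _; apply: sumr_ge0.
move=> s; apply: norm_le_coord => [|j].
  by rewrite mulr_ge0//; apply: sumr_ge0 => i _; apply: sumr_ge0.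
rewrite mxE; apply: le_trans (ler_norm_sum _ _ _) _; rewrite mulr_suml.
apply: ler_sum => i _; rewrite normrM mulrC ler_pM// ?coord_le_norm//.
by rewrite (bigD1 j)//= lerDl sumr_ge0.
Qed.

(** Near a point a smooth map is uniformly approximated by its differential
    there, also between two nearby points. *)
Lemma strict_differential {n m} (U : set 'rV[R]_n) (F : 'rV[R]_n -> 'rV[R]_m) p :
  open U -> smooth_on U F -> U p -> forall e, 0 < e -> exists2 r, 0 < r &
  forall x h, `|x - p| < r -> `|h| < r -> U (x + h) /\
   `|F (x + h) - F x - h *m \matrix_(j, i) 'D_('e_j) F p 0 i| <= e * `|h|.
Proof.
move=> oU sF Up e e0.
(* The errors in the n coordinates add up; n may be 0. *)
pose e' := e / n.+1%:R.
have e'0 : 0 < e' by rewrite divr_gt0.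
have : \forall z \near p, U z /\ forall j i,
    `|'D_('e_j) (fun y => F y 0 i) p - 'D_('e_j) (fun y => F y 0 i) z| < e'.
  apply: filterI; first exact: open_nbhs_nbhs.
  apply: (@filter_forall 'rV[R]_n _ _ (nbhs p) _) => j.
  apply: (@filter_forall 'rV[R]_n _ _ (nbhs p) _) => i.
  have h : \forall z \near p, ball ('D_('e_j) (fun y => F y 0 i) p) e' ('D_('e_j) (fun y => F y 0 i) z).
    exact: (smooth_on_continuous (smooth_on_derive ('e_j) (smooth_on_coord i oU sF)) Up
      (nbhsx_ballx _ _ e'0)).
  by apply: filterS h => z; rewrite -ball_normE.
move=> /nbhs_ballP[r /= r0 rP].
have {}rP z : `|z - p| < r -> U z /\ forall j i,
    `|'D_('e_j) (fun y => F y 0 i) p - 'D_('e_j) (fun y => F y 0 i) z| < e'.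
  by move=> zr; apply: rP; rewrite -ball_normE /= distrC.
exists (r / 2) => [|x h xp hr]; first by rewrite divr_gt0.
have xh z : `|z - x| <= `|h| -> `|z - p| < r.
  by move=> zx; have := ler_normD (z - x) (x - p); rewrite addrA subrK; lra.
split.
  by have [|] := rP (x + h) _ => //; apply: xh; rewrite addrAC subrr add0r.
apply: norm_le_coord => [|i]; first by rewrite mulr_ge0// ltW.
have [z i' zx|xi [xiP]] := @mean_value_coord R n (fun y => F y 0 i) x h.
  have [Uz _] := rP z (xh z zx).
  exact: (smooth_on_derivable (smooth_on_coord i oU sF) Uz).
move=> xiE.
have -> : (F (x + h) - F x - h *m \matrix_(j, i0) 'D_('e_j) F p 0 i0) 0 i =
    \sum_j h 0 j * ('D_('e_j) (fun y => F y 0 i) (xi j) - 'D_('e_j) (fun y => F y 0 i) p).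
  rewrite !mxE xiE -sumrB; apply: eq_bigr => j _; rewrite mxE mulrBr.
  by rewrite (derive_coord i (smooth_on_derivable sF Up)).2.
apply: le_trans (ler_norm_sum _ _ _) _.
apply: (@le_trans _ _ (\sum_(j < n) e' * `|h|)).
  apply: ler_sum => j _; rewrite normrM mulrC ler_pM// ?coord_le_norm// distrC ltW//.
  by have [_] := rP (xi j) (xh _ (xiP j)); apply.
rewrite sumr_const card_ord -mulrnAl ler_wpM2r// /e' -mulr_natr -mulrA ler_piMr ?ltW//.
by rewrite mulrC ltr_pdivrMr// mul1r ltr_nat.
Qed.

End smooth_vectors.

Section smooth_matrices.
Context {R : realType} {V : normedModType R} (U : set V) (oU : open U).

Lemma smooth_det n (M : V -> 'M[R]_n) : (forall i j, smooth_on U (fun q => M q i j)) ->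
  smooth_on U (fun q => \det (M q)).
Proof.
move=> sM; rewrite /determinant; apply: smooth_sum => // s.
by apply: smooth_onM => //; [exact: smooth_on_cst|exact: smooth_bigprod].
Qed.

Lemma smooth_invmx n (M : V -> 'M[R]_n) : (forall i j, smooth_on U (fun q => M q i j)) ->
  (forall q, U q -> \det (M q) != 0) ->
  forall i j, smooth_on U (fun q => invmx (M q) i j).
Proof.
move=> sM M0 i j.
have s1 : smooth_on U (fun q => (\det (M q))^-1 * \adj (M q) i j).
  apply: smooth_onM => //; first by apply: smooth_onV => //; exact: smooth_det.
  rewrite (_ : (fun q => _) = fun q => (-1) ^+ (j + i) * \det (row' j (col' i (M q)))); last first.
    by apply/funext => q; rewrite mxE.
  apply: smooth_onM => //; first exact: smooth_on_cst.
  apply: smooth_det => k l.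
  by rewrite (_ : (fun q => _) = fun q => M q (lift j k) (lift i l)) //; apply/funext => q; rewrite !mxE.
apply: (smooth_algebra_smooth oU); apply: smooth_ext (smooth_gen _ s1) _ => q Uq.
by rewrite /invmx unitmxE unitfE M0// [RHS]mxE.
Qed.

Lemma smooth_mulmx m n p (M : V -> 'M[R]_(m, n)) (M' : V -> 'M[R]_(n, p)) :
  (forall i j, smooth_on U (fun q => M q i j)) ->
  (forall i j, smooth_on U (fun q => M' q i j)) ->
  forall i j, smooth_on U (fun q => (M q *m M' q) i j).
Proof.
move=> sM sM' i j; rewrite (_ : (fun q => _) = fun q => \sum_k M q i k * M' q k j).
  by apply: smooth_sum => // k; exact: smooth_onM.
by apply/funext => q; rewrite mxE.
Qed.

End smooth_matrices.

(** * The implicit function theorem for curves *)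

(** Banach's fixed point theorem asks for the structure of a complete normed
    module, whose parts row vectors already carry. *)

HB.instance Definition _ (R : realType) (m : nat) := Complete.copy 'rV[R]_m 'rV[R]_m.

(** The deviation of the step h v + s A from h (v - v J N A) is computed from its
    image under J alone, which is small when the step joins two zeros of a map with
    differential J. *)
Lemma newton_defect (R : comPzRingType) n m (A : 'M[R]_(m, n)) (J : 'M[R]_(n, m))
    (N : 'M[R]_m) (v : 'rV[R]_n) (s : 'rV[R]_m) (h : R) : A *m J *m N = 1%:M ->
  h *: v + s *m A - h *: (v - v *m J *m N *m A) = (h *: v + s *m A) *m J *m N *m A.
Proof.
move=> AJN; transitivity (h *: (v *m J *m N *m A) + s *m A).
  by rewrite scalerBr opprB addrC addrA subrK.
have E : s *m A *m J *m N *m A = s *m A.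
  by rewrite -(mulmxA s) -(mulmxA s) AJN mulmx1.
by rewrite !mulmxDl E -!scalemxAl.
Qed.

(** A is a right inverse of the differential of F at p and v a vector of its
    kernel.  The curve through p with velocity v in the zero set of F is sought in
    the form p + t v + s(t) A. *)
Section implicit_curve.
Context {R : realType} {n m : nat}.
Context (U : set 'rV[R]_n) (F : 'rV[R]_n -> 'rV[R]_m) (p : 'rV[R]_n).
Hypotheses (oU : open U) (sF : smooth_on U F) (Up : U p) (Fp : F p = 0).

Definition jacobian q : 'M[R]_(n, m) := \matrix_(j, i) 'D_('e_j) F q 0 i.

Context (A : 'M[R]_(m, n)) (v : 'rV[R]_n).
Hypotheses (AJ : A *m jacobian p = 1%:M) (vJ : v *m jacobian p = 0).
Let curve t s := p + t *: v + s *m A.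

Let curveB t s t' s' : curve t' s' - curve t s = (t' - t) *: v + (s' - s) *m A.
Proof. by rewrite /curve mulmxBl scalerBl; apply/rowP => i; rewrite !mxE; ring. Qed.

Let curveBJ t s t' s' : (curve t' s' - curve t s) *m jacobian p = s' - s.
Proof.
rewrite curveB [LHS]mulmxDl -(mulmxA (s' - s)) AJ mulmx1.
apply: etrans (_ : (t' - t) *: (v *m jacobian p) + (s' - s) = _).
  by rewrite scalemxAl.
by rewrite vJ scaler0 add0r.
Qed.

(** For fixed t the map s - F(p + t v + s A) is a contraction of a small ball,
    because F differs from its differential at p by a map with small Lipschitz
    constant; s(t) is its fixed point.  The same estimate makes s Lipschitz. *)
Lemma implicit_curve (r' : R) : 0 < r' -> exists t0 C (s : R -> 'rV[R]_m),
  [/\ 0 < t0, s 0 = 0,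
      forall t, `|t| < t0 -> `|p + t *: v + s t *m A - p| < r' /\
        F (p + t *: v + s t *m A) = 0
    & forall t t', `|t| < t0 -> `|t'| < t0 -> `|s t' - s t| <= C * `|t' - t| ].
Proof.
move=> r'0; have [a a0 aA] := mulmx_norm_bound A.
(* e (a + 1) = 1/2 makes the iteration contract by 1/2; rho and t0 are chosen for
   the iterates to stay in the ball of radius r around p, where e controls F. *)
pose e := (2 * (a + 1))^-1.
have a1 : 0 < a + 1 by lra.
have e0 : 0 < e by rewrite invr_gt0; lra.
have ea : e * (a + 1) = 2^-1 by rewrite /e; field; rewrite gt_eqF.
have [r1 r10 r1P] := strict_differential oU sF Up e0.
pose r := Num.min r1 r'.
have r0 : 0 < r by rewrite lt_min r10.
have rP x h : `|x - p| < r -> `|h| < r ->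
    `|F (x + h) - F x - h *m jacobian p| <= e * `|h|.
  by rewrite !lt_min => /andP[xr _] /andP[hr _]; case: (r1P x h xr hr).
have rr' : r <= r' by rewrite ge_min lexx orbT.
pose rho := r / (4 * (a + 1)).
have rho0 : 0 < rho by rewrite divr_gt0//; lra.
have rhoa : rho * (a + 1) = r / 4 by rewrite /rho; field; rewrite gt_eqF.
pose W := `|v| + 1.
have W0 : 0 < W by rewrite ltr_wpDl.
have vW : `|v| <= W by rewrite lerDl.
pose t0 := rho / (4 * W).
have t00 : 0 < t0 by rewrite divr_gt0//; lra.
have t0W : t0 * W = rho / 4 by rewrite /t0; field; rewrite gt_eqF.
have ea2 : e * a <= 2^-1 by rewrite -ea; apply: ler_wpM2l; lra.
have e2 : e <= 2^-1 by rewrite -ea mulrDr mulr1 lerDr mulr_ge0// ltW.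
have rhor : rho <= r / 4 by rewrite -rhoa; apply: ler_peMr; lra.
have rhoar : rho * a <= r / 4 by rewrite -rhoa; apply: ler_wpM2l; lra.
clearbody t0 W rho r e.
have tv t : `|t| < t0 -> `|t *: v| <= rho / 4.
  move=> tt; rewrite normrZ -t0W; apply: ler_pM => //; exact: ltW.
have sA (s : 'rV[R]_m) : `|s| <= rho -> `|s *m A| <= r / 4.
  by move=> sr; apply: le_trans (aA s) _; apply: le_trans rhoar; rewrite mulrC ler_wpM2r.
have cp t s : `|t| < t0 -> `|s| <= rho -> `|curve t s - p| < r / 2.
  move=> tt ss; rewrite (_ : _ - p = t *: v + s *m A); last first.
    by rewrite /curve; apply/rowP => i; rewrite !mxE; ring.
  by have := ler_normD (t *: v) (s *m A); have := tv t tt; have := sA s ss; lra.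
have key t s t' s' : `|t| < t0 -> `|s| <= rho -> `|t'| < t0 -> `|s'| <= rho ->
    `|F (curve t' s') - F (curve t s) - (s' - s)| <= e * (`|t' - t| * W + a * `|s' - s|).
  move=> h1 h2 h3 h4.
  have k1 := cp _ _ h1 h2; have k2 := cp _ _ h3 h4.
  have hr : `|curve t' s' - curve t s| < r.
    have := ler_normB (curve t' s' - p) (curve t s - p).
    by rewrite opprB addrA subrK; lra.
  have := rP (curve t s) _ (lt_trans k1 _) hr.
  rewrite [curve t s + _]addrC subrK curveBJ => H; apply: le_trans (H _) _; first by lra.
  apply: (ler_wpM2l (ltW e0)); rewrite curveB; apply: le_trans (ler_normD _ _) _.
  by apply: lerD => //; rewrite normrZ ler_wpM2l.
have cp0 : curve 0 0 = p by rewrite /curve scale0r mul0mx !addr0.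
have ex t : exists s, `|t| < t0 -> `|s| <= rho /\ F (curve t s) = 0.
  have [tt|] := boolP (`|t| < t0); last by exists 0.
  pose B : set 'rV[R]_m := [set s | `|s| <= rho].
  pose T s := s - F (curve t s).
  have TB : {homo T : s / B s >-> B s}.
    move=> s Bs; rewrite /B /T /=.
    have := @key 0 0 t s _ _ tt Bs; rewrite !normr0 => /(_ t00 (ltW rho0)).
    rewrite cp0 Fp !subr0 -normrN opprB => H; apply: le_trans H _.
    have : `|t| * W <= rho / 4 by rewrite -t0W ler_wpM2r// ltW.
    have : a * `|s| <= a * rho by rewrite ler_wpM2l.
    move=> h1 h2; apply: (@le_trans _ _ (e * (rho / 4 + a * rho))).
      by apply: (ler_wpM2l (ltW e0)); apply: lerD.
    have : e * (rho / 4) <= 2^-1 * (rho / 4) by rewrite ler_wpM2r// divr_ge0// ltW.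
    have : e * a * rho <= 2^-1 * rho by rewrite ler_wpM2r// ltW.
    by rewrite mulrDr mulrA; lra.
  pose Tf := mkfun_fun TB.
  have [|||s Bs sT] := @banach_fixed_point R 'rV[R]_m B Tf.
  - have h2 : (0 : R) <= 2^-1 by rewrite invr_ge0.
    exists (NngNum h2); split; first by rewrite /= invf_lt1// ltr1n.
    move=> [s s'] [/= Bs Bs']; rewrite /T.
    have := key t s' t s tt Bs' tt Bs; rewrite subrr normr0 mul0r add0r -normrN => H.
    rewrite (_ : _ - _ - _ = - (F (curve t s) - F (curve t s') - (s - s'))); last first.
      by apply/rowP => i; rewrite !mxE; ring.
    by apply: le_trans H _; rewrite mulrA ler_wpM2r.
  - rewrite /B; apply: (@closed_comp _ _ (fun x : 'rV[R]_m => `|x|) [set y | y <= rho]).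
      by move=> x _; exact: norm_continuous.
    exact: closed_le.
  - by exists 0; rewrite /B /= normr0 ltW.
  exists s => _; split => //; move: sT; rewrite /Tf /= /T => /eqP.
  by rewrite -subr_eq0 opprB addrC subrK => /eqP.
have [s sP] := choice ex.
have lip t s1 t' s2 : `|t| < t0 -> `|s1| <= rho -> F (curve t s1) = 0 ->
    `|t'| < t0 -> `|s2| <= rho -> F (curve t' s2) = 0 ->
    `|s2 - s1| <= W * `|t' - t|.
  move=> h1 h2 h3 h4 h5 h6; have := key _ _ _ _ h1 h2 h4 h5.
  rewrite h3 h6 subrr sub0r normrN mulrDr mulrA => H.
  have : e * a * `|s2 - s1| <= 2^-1 * `|s2 - s1| by rewrite ler_wpM2r.
  have : e * (`|t' - t| * W) <= 2^-1 * (`|t' - t| * W).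
    by rewrite ler_wpM2r// mulr_ge0// ltW.
  rewrite (mulrC W); move: H; rewrite mulrA; lra.
exists t0, W, s; split => //.
- have n0 : `|0 : R| < t0 by rewrite normr0.
  have [h1 h2] := sP 0 n0.
  have := lip 0 0 0 (s 0); rewrite cp0 subrr !normr0 mulr0 subr0 => H.
  by apply/eqP; rewrite -normr_le0; apply: H => //; exact: ltW.
- move=> t tt; have [h1 h2] := sP t tt; split => //.
  by have := cp t (s t) tt h1; rewrite /curve; lra.
- move=> t t' tt tt'; have [h1 h2] := sP t tt; have [h3 h4] := sP t' tt'.
  exact: lip.
Qed.

Let is_derive_o (f : R -> 'rV[R]_n) (t : R) l :
  (forall e, 0 < e -> exists2 r, 0 < r & forall h : R, `|h| < r ->
     `|f (t + h) - f t - h *: l| <= e * `|h|) -> is_derive t 1 f l.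
Proof.
move=> fe.
suff cv : h^-1 *: ((f \o shift t) (h *: 1) - f t) @[h --> (0 : R)^'] --> l.
  by split; [apply/cvg_ex; exists l|apply: cvg_lim].
apply/cvgrPdist_le => e e0; have [r r0 rP] := fe e e0; near=> h.
have h0 : h != 0 by near: h; exact: nbhs_dnbhs_neq.
have h1 : `|h| < r.
  near: h; apply: cvg_within; apply: filterS (nbhsx_ballx (0 : R) r r0) => z.
  by rewrite -ball_normE /= sub0r normrN.
have := rP h h1; rewrite -ler_pdivrMr ?normr_gt0// mulrC -normfV -normrZ.
rewrite (_ : l - _ = - (h^-1 *: (f (t + h) - f t - h *: l))) ?normrN//.
apply: etrans (_ : l - h^-1 *: (f (t + h) - f t) = _).
  by rewrite /= [h *: 1]mulr1 [h + t]addrC.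
by apply/rowP => i; rewrite !mxE; field.
Unshelve. all: by end_near. Qed.

Let smooth_jacobian j i : smooth_on U (fun q => jacobian q j i).
Proof.
rewrite (_ : (fun q => _) = fun q => 'D_('e_j) F q 0 i).
  exact: (smooth_on_coord i oU (smooth_on_derive _ sF)).
by apply/funext => q; rewrite mxE.
Qed.

(** The velocity of the curve at q: the only vector of the form v + s A in the
    kernel of the differential of F at q. *)
Let field (q : 'rV[R]_n) : 'rV[R]_n := v - v *m jacobian q *m invmx (A *m jacobian q) *m A.

(** The curve is differentiable since it is Lipschitz and F is constant on it, and
    it solves c' = field c.  So the functions G(c(t)) with G smooth form a class
    that is closed under derivatives, and coinduction applies. *)
Lemma implicit_smooth_curve : exists (e : R) (c : R -> 'rV[R]_n),
  [/\ 0 < e, smooth_on [set t | - e < t < e] c,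
      forall t, - e < t < e -> U (c t) /\ F (c t) = 0, c 0 = p & 'D_1 c 0 = v].
Proof.
pose M q := A *m jacobian q.
have sM i j : smooth_on U (fun q => M q i j).
  by apply: (smooth_mulmx oU (M := fun=> A) (M' := jacobian)) => k l;
    [exact: smooth_on_cst|exact: smooth_jacobian].
have [r' r'0 r'P] : exists2 r', 0 < r' & forall q, ball p r' q -> U q /\ \det (M q) != 0.
  have c1 := smooth_on_continuous (smooth_det oU sM) Up.
  have h1 : \forall q \near p, ball (\det (M p)) 1 (\det (M q)).
    exact: (c1 _ (nbhsx_ballx _ _ ltr01)).
  have h2 : \forall q \near p, U q by exact: open_nbhs_nbhs.
  have h3 : \forall q \near p, ball (\det (M p)) 1 (\det (M q)) /\ U q by apply: filterI.
  move/nbhs_ballP: h3 => [r' /= r'0 r'P].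
  exists r' => [//|q /r'P [h3 h4]]; split; first exact: h4.
  apply/eqP => d0; move: h3; rewrite d0 /M AJ det1 -ball_normE /= subr0 normr1 ltxx//.
have [t0 [C [s [t00 s0 sP sL]]]] := implicit_curve r'0.
pose c (t : R) : 'rV[R]_n := p + t *: v + s t *m A.
pose U' : set 'rV[R]_n := ball p r'.
have oU' : open U' by exact: ball_open.
have UU' : U' `<=` U by move=> q /r'P [].
have cU (t : R) : `|t| < t0 -> U' (c t).
  by move=> /sP[h _]; rewrite /U' -ball_normE /= distrC.
have dc (t : R) : `|t| < t0 -> is_derive t 1 c (field (c t)).
  move=> tt; set q := c t; have Uq : U q by exact/UU'/cU.
  have Mq : M q \in unitmx by rewrite unitmxE unitfE; case: (r'P q (cU t tt)).
  apply: is_derive_o => e e0.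
  have [a a0 aA] := mulmx_norm_bound A.
  have [b b0 bN] := mulmx_norm_bound (invmx (M q)).
  pose W := `|v| + a * `|C|.
  have W0 : 0 <= W by rewrite addr_ge0// mulr_ge0.
  have abW : 0 <= a * b * W by rewrite mulr_ge0// mulr_ge0.
  pose e1 := e / (a * b * W + 1).
  have e10 : 0 < e1 by rewrite divr_gt0//; lra.
  have [r r0 rP] := strict_differential oU sF Uq e10.
  exists (Num.min (t0 - `|t|) (r / (W + 1))).
    by rewrite lt_min subr_gt0 tt divr_gt0//; lra.
  move=> h; rewrite lt_min => /andP[ht hr].
  have tht : `|t + h| < t0 by have := ler_normD t h; lra.
  pose sg := s (t + h) - s t.
  have sgC : `|sg| <= `|C| * `|h|.
    apply: le_trans (sL t (t + h) tt tht) _; rewrite addrAC subrr add0r.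
    by rewrite ler_wpM2r// ler_norm.
  have cB : c (t + h) - q = h *: v + sg *m A.
    rewrite /q /c /sg mulmxBl scalerDl; apply/rowP => i; rewrite !mxE; ring.
  have cW : `|c (t + h) - q| <= W * `|h|.
    rewrite cB; apply: le_trans (ler_normD _ _) _; rewrite normrZ /W mulrDl.
    apply: lerD; first by rewrite mulrC.
    by apply: le_trans (aA _) _; rewrite -mulrA ler_wpM2l.
  have cr : `|c (t + h) - q| < r.
    apply: le_lt_trans cW _; move: hr; rewrite ltr_pdivlMr; last by lra.
    by apply: le_lt_trans; rewrite mulrC ler_wpM2l//; lra.
  have := rP q (c (t + h) - q); rewrite subrr normr0 => /(_ r0 cr) [_].
  have Fc1 : F (c (t + h)) = 0 by case: (sP _ tht).
  have Fq : F q = 0 by case: (sP _ tt).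
  rewrite [q + _]addrC subrK Fc1 Fq subrr sub0r normrN -/(jacobian q) => H.
  have -> : c (t + h) - c t - h *: field (c t) =
      (c (t + h) - q) *m jacobian q *m invmx (M q) *m A.
    rewrite -/q cB; apply: newton_defect; exact: mulmxV.
  apply: le_trans (aA _) _; apply: (@le_trans _ _ (a * (b * (e1 * (W * `|h|))))).
    rewrite ler_wpM2l//; apply: le_trans (bN _) _; rewrite ler_wpM2l//.
    by apply: le_trans H _; rewrite ler_wpM2l// ltW.
  rewrite (_ : _ * _ = (a * b * W) * e1 * `|h|); last by ring.
  rewrite ler_wpM2r// /e1 mulrCA ler_piMr ?ltW// ltr_pdivrMr; lra.
have sId i := smooth_coordinate i oU'.
have sfield i : smooth_on U' (fun q => field q 0 i).
  have sJ k l : smooth_on U' (fun q => jacobian q k l).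
    exact: smooth_onS UU' (smooth_jacobian k l).
  rewrite (_ : (fun q => _) = fun q => v 0 i + -1 *
      (v *m jacobian q *m invmx (M q) *m A) 0 i); last first.
    by apply/funext => q; rewrite /field !mxE; ring.
  have cst k l (B : 'M[R]_(k, l)) i' j' : smooth_on U' (fun=> B i' j') by exact: smooth_on_cst.
  have h1 := smooth_mulmx oU' (M := fun=> v) (M' := jacobian) (cst _ _ v) sJ.
  have h2 : forall i' j', smooth_on U' (fun q => invmx (M q) i' j').
    apply: smooth_invmx; [exact: oU'| |by move=> q /r'P []].
    by move=> k2 l2; exact: smooth_onS UU' (sM k2 l2).
  have h3 := smooth_mulmx oU' h1 h2.
  have h4 := smooth_mulmx oU' (M' := fun=> A) h3 (cst _ _ A).
  apply: (smooth_onD oU'); first exact: smooth_on_cst.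
  by apply: (smooth_onM oU'); [exact: smooth_on_cst|exact: h4].
pose T := [set t : R | - t0 < t < t0].
have oT : open T.
  rewrite (_ : T = `]- t0, t0[%classic); first exact: interval_open.
  by apply/seteqP; split => t /=; rewrite in_itv.
have TT (t : R) : T t -> `|t| < t0 by rewrite /T /= ltr_norml.
pose P (g : R -> 'rV[R]_n) := exists2 G : 'rV[R]_n -> 'rV[R]_n, smooth_on U' G & g = (fun t => G (c t)).
have dG (G : 'rV[R]_n -> 'rV[R]_n) (t : R) : smooth_on U' G -> T t ->
    is_derive t 1 (fun t => G (c t)) (\row_i \sum_j field (c t) 0 j * 'D_('e_j) G (c t) 0 i).
  move=> sG Tt; have Uc : U' (c t) by exact/cU/TT.
  have d i : is_derive t 1 (fun t => G (c t) 0 i)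
      (\sum_j field (c t) 0 j * 'D_('e_j) G (c t) 0 i).
    have h := is_derive_curve oU' (smooth_on_coord i oU' sG) Uc (dc t (TT t Tt)).
    apply: (is_derive_val h); apply: eq_bigr => j _; congr (_ * _).
    by case: (derive_coord i (smooth_on_derivable sG (v := 'e_j) Uc)).
  have dG : derivable (fun t => G (c t)) t 1.
    by apply/derivable_mxP => i j; rewrite ord1; case: (d j).
  split => //; rewrite (derive_mx dG); apply/rowP => j; rewrite !mxE.
  by case: (d j).
exists t0, c; split => //.
- apply: (@smooth_on_coind _ _ _ T P oT).
  + move=> _ t [G sG ->] Tt; have [d _] := dG G t sG Tt; split.
      by apply: differentiable_continuous; exact/derivable1_diffP.
    move=> w; have -> : w = w *: 1 by rewrite /GRing.scale /= mulr1.
    apply: diff_derivable; exact/derivable1_diffP.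
  + move=> _ w [G sG ->].
    exists (fun t => \row_i \sum_j w * (field (c t) 0 j * 'D_('e_j) G (c t) 0 i)).
      exists (fun q => \row_i \sum_j w * (field q 0 j * 'D_('e_j) G q 0 i)); last by [].
      apply: (smooth_on_row oU') => i.
      rewrite (_ : (fun q => _) = fun q => \sum_j w * (field q 0 j * 'D_('e_j) G q 0 i)).
        apply: (smooth_sum _ _ oU') => j; apply: (smooth_onM oU'); first exact: smooth_on_cst.
        apply: (smooth_onM oU'); first exact: sfield.
        exact: (smooth_on_coord i oU' (smooth_on_derive _ sG)).
      by apply/funext => q; rewrite mxE.
    move=> t Tt; have [d dE] := dG G t sG Tt.
    have df : differentiable (fun t => G (c t)) t by exact/derivable1_diffP.
    rewrite deriveE// (_ : w = w *: 1) ?linearZ -?deriveE// ?dE; last first.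
      by rewrite /GRing.scale /= mulr1.
    by apply/rowP => i; rewrite !mxE mulr_sumr /GRing.scale /= !mulr1.
  + by exists id; [exact: (smooth_on_row oU' sId)|].
- move=> t Tt; have tt := TT t Tt; split; first exact/UU'/cU.
  by have [] := sP t tt.
- by rewrite /c s0 mul0mx scale0r !addr0.
- have t0' : `|0 : R| < t0 by rewrite normr0.
  have [_ ->] := dc 0 t0'; rewrite /field /c s0 mul0mx scale0r !addr0.
  by rewrite vJ !mul0mx subr0.
Qed.

End implicit_curve.

(** * Tangent spaces of submanifolds *)

Section tangent_spaces.
Context {R : realType}.

Lemma row_norm2_eq0 n (x : 'rV[R]_n) : x *m x^T = 0 -> x = 0.
Proof.
move=> /matrixP/(_ 0 0); rewrite !mxE => h; apply/rowP => i; rewrite mxE.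
apply/eqP; rewrite -sqrf_eq0 eq_le sqr_ge0 andbT -h (bigD1 i)//= mxE expr2 lerDl.
by apply: sumr_ge0 => j _; rewrite mxE -expr2 sqr_ge0.
Qed.

(** P = 1 - J (J^T J)^-1 J^T; the Gram matrix J^T J is invertible since J has a
    left inverse. *)
Lemma kernel_projection n m (J : 'M[R]_(n, m)) (A : 'M[R]_(m, n)) : A *m J = 1%:M ->
  exists P : 'M[R]_n, [/\ P^T = P, P *m P = P & forall v : 'rV_n, v *m J = 0 <-> v *m P = v].
Proof.
move=> AJ; pose G := J^T *m J.
have Gu : G \in unitmx.
  rewrite -row_free_unit; apply: inj_row_free => x xG.
  have : (x *m J^T) *m (x *m J^T)^T = 0.
    by rewrite trmx_mul trmxK mulmxA -(mulmxA x) -/G xG mul0mx.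
  move=> /row_norm2_eq0 xJ.
  by rewrite -[x]mulmx1 -trmx1 -AJ trmx_mul mulmxA xJ mul0mx.
pose Q := J *m invmx G *m J^T.
have GT : G^T = G by rewrite /G trmx_mul trmxK.
have QT : Q^T = Q by rewrite /Q !trmx_mul trmxK trmx_inv GT mulmxA.
have QJ : Q *m J = J by rewrite /Q -!mulmxA -/G mulVmx// mulmx1.
have QQ : Q *m Q = Q.
  by rewrite {2}/Q !mulmxA QJ.
exists (1%:M - Q); split.
- by rewrite linearB /= trmx1 QT.
- by rewrite mulmxBl mul1mx mulmxBr mulmx1 QQ subrr subr0.
- move=> v; rewrite mulmxBr mulmx1; split=> [vJ|].
    by rewrite /Q !mulmxA vJ !mul0mx subr0.
  move=> /eqP; rewrite subr_eq addrC -subr_eq subrr eq_sym => /eqP vQ.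
  by rewrite -QJ mulmxA vQ mul0mx.
Qed.

Lemma derive_jacobian n m (U : set 'rV[R]_n) (F : 'rV[R]_n -> 'rV[R]_m) p v :
  open U -> smooth_on U F -> U p -> 'D_v F p = v *m jacobian F p.
Proof.
move=> oU sF Up; apply/rowP => i.
rewrite -(derive_coord i (smooth_on_derivable sF (v := v) Up)).2.
rewrite derive_basis; last exact: (smooth_on_differentiable oU (smooth_on_coord i oU sF) Up).
rewrite mxE; apply: eq_bigr => j _; rewrite mxE.
by rewrite (derive_coord i (smooth_on_derivable sF (v := 'e_j) Up)).2.
Qed.

(** N is the zero set of a submersion near p.  Velocities of curves in it are
    annihilated by the differential, and conversely the implicit function theorem
    provides a curve for each vector of the kernel. *)
Lemma tangent_kernel K d (N : set 'rV[R]_K) p : submanifold d N -> N p ->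
  exists m (J : 'M[R]_(K, m)) (A : 'M[R]_(m, K)), A *m J = 1%:M /\
    forall v, tangent N p v <-> v *m J = 0.
Proof.
move=> [_ /(_ p)] H Np; have {H} [U [F [oU Up sF surF NU]]] := H Np.
have Fp : F p = 0.
  by have : (N `&` U) p by []; rewrite NU => -[].
have [a aP] : exists a : 'I_(K - d) -> 'rV[R]_K, forall i, 'D_(a i) F p = 'e_i.
  have /choice[a aP] : forall i : 'I_(K - d), exists v, 'D_v F p = 'e_i.
    by move=> i; exact: surF.
  by exists a.
pose A := \matrix_i a i.
have AJ : A *m jacobian F p = 1%:M.
  apply/row_matrixP => i; rewrite row_mul rowK -(derive_jacobian _ oU sF Up) aP.
  by rewrite row1.
exists (K - d)%N, (jacobian F p), A; split => // v; split.
  move=> [e [c [e0 sc cN c0 cv]]].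
  have T0 : [set t | - e < t < e] (0 : R) by rewrite /= oppr_lt0 e0.
  have dc : is_derive (0 : R) 1 c v.
    by split => //; exact: (smooth_on_derivable sc T0).
  apply/rowP => i; rewrite !mxE.
  have Uc : U (c 0) by rewrite c0.
  have [_ D] := is_derive_curve oU (smooth_on_coord i oU sF) Uc dc.
  have near0 : \forall t \near (0 : R), F (c t) 0 i = (cst 0 : R -> R) t.
    have h1 : \forall t \near (0 : R), U (c t).
      have cc := smooth_on_continuous sc T0.
      by apply: cc; rewrite c0; exact: open_nbhs_nbhs.
    have h2 : \forall t \near (0 : R), - e < t < e.
      apply: filterS (nbhsx_ballx (0 : R) e e0) => t.
      by rewrite -ball_normE /= sub0r normrN ltr_norml.
    apply: filterS2 h1 h2 => t Ut te.
    have : (N `&` U) (c t) by split => //; exact: cN.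
    by rewrite NU => -[_ ->]; rewrite mxE.
  have {}D : \sum_j v 0 j * 'D_('e_j) (fun y => F y 0 i) p = 0.
    rewrite -c0 -D; have -> := near_eq_derive (1 : R) near0.
    exact: derive_cst.
  rewrite -[RHS]D; apply: eq_bigr => j _; rewrite mxE.
  by rewrite (derive_coord i (smooth_on_derivable sF (v := 'e_j) Up)).2.
move=> vJ; have [e [c [e0 sc cUF c0 cv]]] := implicit_smooth_curve oU sF Up Fp AJ vJ.
exists e, c; split => // t te; have [Uc Fc] := cUF t te.
have NUc : (N `&` U) (c t) by rewrite NU.
by case: NUc.
Qed.

Lemma tangent_projP K d (N : set 'rV[R]_K) p : submanifold d N -> N p ->
  is_tangent_proj N p (tangent_proj N p).
Proof.
move=> sN Np; have [m [J [A [AJ TJ]]]] := tangent_kernel sN Np.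
have [P [PT PP PJ]] := kernel_projection AJ.
apply: (xgetPex 0); exists P; split => // v; rewrite -PJ; exact: TJ.
Qed.

End tangent_spaces.

(** * Real inner products of spinors *)

Section spinor_algebra.
Context {R : realType}.
Local Notation C := R[i].

(** The real and the imaginary part under one name, so that a spinor has real
    coordinates indexed by b, s, i. *)
Definition part (b : bool) (z : C) : R := if b then complex.Re z else complex.Im z.

Lemma partD b (z w : C) : part b (z + w) = part b z + part b w.
Proof. by case: z w b => [x y] [x' y'] []. Qed.

Lemma part0 b : part b (0 : C) = 0.
Proof. by case: b. Qed.

Lemma part_sum b (I : Type) (r : seq I) (P : pred I) (F : I -> C) :
  part b (\sum_(i <- r | P i) F i) = \sum_(i <- r | P i) part b (F i).
Proof. exact: (big_morph (part b) (@partD b) (part0 b)). Qed.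

Lemma partM b (z w : C) : part b (z * w) =
  complex.Re z * part b w + (if b then - complex.Im z else complex.Im z) * part (~~ b) w.
Proof. by case: z w b => [x y] [x' y'] [] /=; ring. Qed.

Lemma partZ b (c : R) (z : C) : part b ((c%:C)%C * z) = c * part b z.
Proof. by rewrite partM; case: b => /=; ring. Qed.

Lemma part_inj (z w : C) : (forall b, part b z = part b w) -> z = w.
Proof.
case: z w => [x y] [x' y'] h; have := h true; have := h false.
by rewrite /part /= => -> ->.
Qed.

Context {L : nat}.

Definition ip {m} (u v : 'M[C]_(L, m)) : R := complex.Re (herm u v).

Lemma ipE m (u v : 'M[C]_(L, m)) :
  ip u v = \sum_b \sum_s \sum_i part b (u s i) * part b (v s i).
Proof.
have E : ip u v = \sum_s \sum_i part true (u s i * conjc (v s i)).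
  rewrite /ip /herm -/(part true _) part_sum; apply: eq_bigr => s _.
  by rewrite part_sum.
rewrite E [RHS]exchange_big; apply: eq_bigr => s _ /=.
rewrite [RHS]exchange_big; apply: eq_bigr => i _ /=.
rewrite big_bool; case: (u s i) (v s i) => [x y] [x' y'] /=; ring.
Qed.

Lemma ipC m (u v : 'M[C]_(L, m)) : ip u v = ip v u.
Proof.
rewrite !ipE; apply: eq_bigr => b _; apply: eq_bigr => s _.
by apply: eq_bigr => i _; rewrite mulrC.
Qed.

Lemma ipDl m (u u' v : 'M[C]_(L, m)) : ip (u + u') v = ip u v + ip u' v.
Proof.
rewrite !ipE -big_split; apply: eq_bigr => b _; rewrite -big_split.
apply: eq_bigr => s _; rewrite -big_split; apply: eq_bigr => i _ /=.
by rewrite mxE partD mulrDl.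
Qed.

Lemma ipDr m (u v v' : 'M[C]_(L, m)) : ip u (v + v') = ip u v + ip u v'.
Proof. by rewrite ipC ipDl !(ipC u). Qed.

Lemma ip0l m (v : 'M[C]_(L, m)) : ip 0 v = 0.
Proof.
rewrite ipE; apply: big1 => b _; apply: big1 => s _; apply: big1 => i _.
by rewrite mxE part0 mul0r.
Qed.

Lemma ip0r m (v : 'M[C]_(L, m)) : ip v 0 = 0.
Proof. by rewrite ipC ip0l. Qed.

Lemma ipZl m (c : R) (u v : 'M[C]_(L, m)) : ip ((c%:C)%C *: u) v = c * ip u v.
Proof.
rewrite !ipE mulr_sumr; apply: eq_bigr => b _; rewrite mulr_sumr.
apply: eq_bigr => s _; rewrite mulr_sumr; apply: eq_bigr => i _ /=.
by rewrite mxE partZ mulrA.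
Qed.

Lemma ipZr m (c : R) (u v : 'M[C]_(L, m)) : ip u ((c%:C)%C *: v) = c * ip u v.
Proof. by rewrite ipC ipZl ipC. Qed.

Lemma ip_sumr m (u : 'M[C]_(L, m)) (I : Type) (r : seq I) (P : pred I) (F : I -> 'M[C]_(L, m)) :
  ip u (\sum_(i <- r | P i) F i) = \sum_(i <- r | P i) ip u (F i).
Proof. exact: (big_morph (ip u) (@ipDr _ u) (ip0r u)). Qed.

Lemma part_mulr m k (b : bool) (u : 'M[C]_(L, m)) (P : 'M[R]_(m, k)) s i :
  part b ((u *m complexify P) s i) = \sum_j part b (u s j) * P j i.
Proof.
rewrite mxE part_sum; apply: eq_bigr => j _; rewrite mxE mulrC partM /=.
by case: b => /=; ring.
Qed.

Lemma ip_mulr m k (u : 'M[C]_(L, k)) (v : 'M[C]_(L, m)) (P : 'M[R]_(m, k)) :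
  ip u (v *m complexify P) = ip (u *m complexify P^T) v.
Proof.
rewrite !ipE; apply: eq_bigr => b _; apply: eq_bigr => s _.
under eq_bigr do rewrite part_mulr mulr_sumr.
under [in RHS]eq_bigr do rewrite part_mulr mulr_suml.
rewrite exchange_big; apply: eq_bigr => j _; apply: eq_bigr => i _ /=.
by rewrite mxE; ring.
Qed.


Definition unit_spinor m (b : bool) (s : 'I_L) (i : 'I_m) : 'M[C]_(L, m) :=
  \matrix_(s', i') if (s' == s) && (i' == i) then (if b then 1 else 'i%C) else 0.

Lemma ip_unit_spinor m (u : 'M[C]_(L, m)) b s i : ip u (unit_spinor b s i) = part b (u s i).
Proof.
rewrite ipE (bigD1 b)//= (bigD1 s)//= (bigD1 i)//= mxE !eqxx /=.
rewrite (_ : part b (if b then 1 else 'i%C) = 1) ?mulr1; last by case: (b).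
rewrite big1 ?addr0; last by move=> i' /negPf i'i; rewrite mxE i'i andbF part0 mulr0.
rewrite big1 ?addr0; last first.
  by move=> s' /negPf s's; apply: big1 => i' _; rewrite mxE s's part0 mulr0.
rewrite big1 ?addr0// => b' b'b; apply: big1 => s' _; apply: big1 => i' _; rewrite mxE.
by case: ifP => _; rewrite ?part0 ?mulr0//; move: b b' b'b => [] []//= _; rewrite ?mulr0.
Qed.

Lemma ip_coord_le m (u : 'M[C]_(L, m)) b s i : part b (u s i) ^+ 2 <= ip u u.
Proof.
have h0 b' s' i' : 0 <= part b' (u s' i') * part b' (u s' i').
  by rewrite -expr2 sqr_ge0.
have h1 b' s' : 0 <= \sum_i' part b' (u s' i') * part b' (u s' i').
  by apply: sumr_ge0 => i' _.
have h2 b' : 0 <= \sum_s' \sum_i' part b' (u s' i') * part b' (u s' i').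
  by apply: sumr_ge0 => s' _.
rewrite ipE (bigD1 b)//= (bigD1 s)//= (bigD1 i)//= expr2 -!addrA lerDl.
by rewrite !addr_ge0//; apply: sumr_ge0.
Qed.

Context {n : nat} (E : 'I_n -> 'M[C]_L).

Lemma clifford_mul_delta m a (u : 'M[C]_(L, m)) : clifford_mul E (delta_mx 0 a) u = E a *m u.
Proof.
rewrite /clifford_mul (bigD1 a)//= mxE !eqxx /= scale1r big1 ?addr0// => b /negPf ba.
by rewrite mxE ba andbF scale0r.
Qed.

Hypothesis cE : clifford_module E.

(** Clifford modules are axiomatized on single spinors; this and its companions
    carry the axioms over to K-tuples, column by column. *)
Lemma ip_col m (u v : 'M[C]_(L, m)) : ip u v = \sum_i ip (col i u) (col i v).
Proof.
under eq_bigr do rewrite ipE.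
rewrite exchange_big ipE; apply: eq_bigr => b _ /=.
rewrite exchange_big; apply: eq_bigr => s _ /=; apply: eq_bigr => i _ /=.
by rewrite big_ord1 !mxE.
Qed.

Lemma ip_skew m a (u v : 'M[C]_(L, m)) : ip (E a *m u) v = - ip u (E a *m v).
Proof.
rewrite (ip_col (E a *m u)) (ip_col u) -sumrN; apply: eq_bigr => i _.
have := clifford_skew cE (delta_mx 0 a) (col i u) (col i v).
rewrite !clifford_mul_delta !colE !mulmxA /ip => ->.
by case: (herm _ _).
Qed.

Lemma clifford_anticomm m a b (u : 'M[C]_(L, m)) :
  E a *m (E b *m u) + E b *m (E a *m u) = ((- (2 *+ (a == b)))%:C)%C *: u.
Proof.
apply/matrixP => s i.
have := clifford_relation cE (delta_mx 0 a) (delta_mx 0 b) (col i u).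
rewrite !clifford_mul_delta => /matrixP/(_ s 0) h.
have -> : (E a *m (E b *m u) + E b *m (E a *m u)) s i =
   (E a *m (E b *m col i u) + E b *m (E a *m col i u)) s 0.
  have colP (M : 'M[C]_(L, m)) : M s i = col i M s 0 by rewrite mxE.
  by rewrite colP colE mulmxDl -!mulmxA -colE.
rewrite h !mxE; congr ((_)%:C%C * _).
rewrite (bigD1 a)//= big1 ?addr0; last first.
  by move=> c /negPf ca; rewrite !mxE ca andbF mul0r.
by rewrite !mxE !eqxx /= mul1r; case: (a == b); rewrite ?mulr1 ?mulr0 ?mulr1n ?mulr0n ?oppr0.
Qed.

(** The real part of <u, e_a o u> is its own negative. *)
Lemma ip_skew0 m a (u : 'M[C]_(L, m)) : ip u (E a *m u) = 0.
Proof.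
have := ip_skew a u u; rewrite ipC => /eqP.
by rewrite -addr_eq0 -mulr2n mulrn_eq0 /= => /eqP.
Qed.

End spinor_algebra.

(** * The density of the functional *)

Section density.
Context {R : realType} {n K L : nat}.
Local Notation Rn := 'rV[R]_n.
Local Notation RK := 'rV[R]_K.
Local Notation mu := (@lebesgue_rV R n).
Local Notation spinor := 'M[R[i]]_(L, K).
Implicit Types (E : 'I_n -> 'M[R[i]]_L) (N : set RK) (phi : Rn -> RK) (psi : Rn -> spinor).

Definition is_spinor_wderiv a psi (dpsi : Rn -> spinor) := forall b s i,
  is_wderiv a (fun x : Rn => part b (psi x s i)) (fun x => part b (dpsi x s i)).

Definition tangential N phi psi := {ae mu, forall x, forall nu,
  normal N (phi x) nu -> psi x *m (complexify nu)^T = 0}.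

(** The rows of 1 - P are normal vectors, so u annihilates them. *)
Lemma tangent_proj_spinor d N p (u : spinor) : submanifold d N -> N p ->
  (forall nu, normal N p nu -> u *m (complexify nu)^T = 0) ->
  u *m complexify (tangent_proj N p) = u.
Proof.
move=> sN Np uN; have [PT PP PT'] := tangent_projP sN Np.
set P := tangent_proj N p in PT PP PT' *.
have nP i : normal N p (row i (1%:M - P)).
  move=> v /PT' vP; rewrite -row_mul -[X in _ *m X]trmxK -[_ *m _]trmxK trmx_mul trmxK.
  by rewrite linearB /= trmx1 PT trmxK mulmxBr mulmx1 vP subrr trmx0 row0.
apply/matrixP => s i; apply: part_inj => b.
rewrite part_mulr; have := uN _ (nP i) => /matrixP/(_ s 0)/(congr1 (part b)).
have -> : (complexify (row i (1%:M - P)))^T = complexify (row i (1%:M - P))^T.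
  by apply/matrixP => k l; rewrite !mxE.
rewrite part_mulr mxE part0.
under eq_bigr do rewrite !mxE mulrBr.
rewrite sumrB (bigD1 i)//= eqxx mulr1 big1 ?addr0; last first.
  by move=> j ji; rewrite eq_sym (negbTE ji) mulr0.
move=> /eqP; rewrite subr_eq0 => /eqP ->; apply: eq_bigr => j _.
by rewrite -{1}PT mxE.
Qed.

(** The projection is symmetric and moves onto u, which it fixes. *)
Lemma dirac_proj E (P : 'M[R]_K) (u : spinor) (du : 'I_n -> spinor) : P^T = P ->
  u *m complexify P = u ->
  ip u (\sum_a clifford_mul E (delta_mx 0 a) (du a *m complexify P)) =
  \sum_a ip u (E a *m du a).
Proof.
move=> PT uP; rewrite ip_sumr; apply: eq_bigr => a _.
by rewrite clifford_mul_delta mulmxA ip_mulr PT uP.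
Qed.

Lemma spinor_deriv_ae psi (dpsi : Rn -> spinor) a : is_spinor_wderiv a psi dpsi ->
  {ae mu, forall x, spinor_deriv a psi x = dpsi x}.
Proof.
move=> pd.
have : {ae mu, forall x, forall s i b,
    wderiv a (fun y => part b (psi y s i)) x = part b (dpsi x s i)}.
  do 3 (apply: filter_forall => ?); exact: wderiv_ae (pd _ _ _).
apply: filterS => x h; apply/matrixP => s i; rewrite mxE.
by apply: part_inj => -[]; rewrite -h.
Qed.

Lemma map_deriv_ae phi (A : Rn -> RK) a :
  (forall i, is_wderiv a (fun x => phi x 0 i) (fun x => A x 0 i)) ->
  {ae mu, forall x, map_deriv a phi x = A x}.
Proof.
move=> pA.
have : {ae mu, forall x, forall i, wderiv a (fun y => phi y 0 i) x = A x 0 i}.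
  by apply: filter_forall => i; exact: wderiv_ae (pA i).
by apply: filterS => x h; apply/rowP => i; rewrite mxE h.
Qed.

Definition lagrangian_density E (A : 'I_n -> RK) (u : spinor) (du : 'I_n -> spinor) : R :=
  \sum_a \sum_i A a 0 i ^+ 2 + \sum_a ip u (E a *m du a).

(** On tangential fields the functional only sees flat weak derivatives, of which
    any version may be taken. *)
Lemma lagrangianE d E N D phi psi (A : 'I_n -> Rn -> RK) (dpsi : 'I_n -> Rn -> spinor) :
  submanifold d N -> {ae mu, forall x, N (phi x)} -> tangential N phi psi ->
  (forall a i, is_wderiv a (fun x => phi x 0 i) (fun x => A a x 0 i)) ->
  (forall a, is_spinor_wderiv a psi (dpsi a)) ->
  lagrangian E N D phi psi =
  \int[mu]_(x in D) lagrangian_density E (A^~ x) (psi x) (dpsi^~ x).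
Proof.
move=> sN Nphi tpsi dphi dps; apply: Rintegral_ae.
have h1 : {ae mu, forall x, forall a, map_deriv a phi x = A a x}.
  by apply: filter_forall => a; exact: map_deriv_ae (dphi a).
have h2 : {ae mu, forall x, forall a, spinor_deriv a psi x = dpsi a x}.
  by apply: filter_forall => a; exact: spinor_deriv_ae (dps a).
apply: filterS2 (filterI Nphi tpsi) (filterI h1 h2) => x [Nx tx] [Ax dx].
congr (_ + _).
  by apply: eq_bigr => a _; apply: eq_bigr => i _; rewrite Ax.
have [PT _ _] := tangent_projP sN Nx.
rewrite -/(ip _ _) dirac_proj//; last exact: (tangent_proj_spinor sN Nx tx).
by apply: eq_bigr => a _; rewrite dx.
Qed.

End density.

(** * Global integrability classes *)

Section global_integrability.
Context {R : realType} {n : nat}.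
Local Notation Rn := 'rV[R]_n.
Local Notation mu := (@lebesgue_rV R n).
Implicit Types (f g u v w : Rn -> R).

Definition Lint (p : R) f := measurable_fun setT f /\
  mu.-integrable setT (EFin \o (fun x => `|f x| `^ p)).

Lemma Lint_Lploc p f : Lint p f -> Lploc p f.
Proof. by move=> [mf fi]; apply/LplocE; split; [exact: mf|exact: rint_L1loc]. Qed.

Lemma LintD p f g : 0 <= p -> Lint p f -> Lint p g -> Lint p (fun x => f x + g x).
Proof.
move=> p0 [mf fi] [mg gi].
have mfg : measurable_fun setT (fun x => f x + g x) by exact: measurable_funD.
split; first exact: mfg.
apply: (rint_dom (g := fun x => 2 `^ p * (`|f x| `^ p + `|g x| `^ p))).
- exact: measurable_powR_norm.
- by move=> x; rewrite ger0_norm ?powR_ge0//; exact: powR_normD.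
- by apply: rintZ; exact: rintD.
Qed.

Lemma Lint_mul p B f w : 0 <= p -> Lint p f -> measurable_fun setT w ->
  (forall x, `|w x| <= B) -> Lint p (fun x => w x * f x).
Proof.
move=> p0 [mf fi] mw wB.
have mwf : measurable_fun setT (fun x => w x * f x) by exact: measurable_funM.
split; first exact: mwf.
apply: (rint_dom (g := fun x => B `^ p * `|f x| `^ p)); [exact: measurable_powR_norm| |exact: rintZ].
move=> x; have B0 : 0 <= B by exact: le_trans (wB x).
rewrite ger0_norm ?powR_ge0// -powRM//.
by apply: ge0_ler_powR => //; rewrite ?nnegrE ?mulr_ge0// normrM ler_wpM2r.
Qed.

Lemma LintZ p (c : R) f : 0 <= p -> Lint p f -> Lint p (fun x => c * f x).
Proof.
by move=> p0 fp; exact: (@Lint_mul p `|c| f (fun=> c) p0 fp (measurable_cst _)).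
Qed.

Lemma Lint0 p : p != 0 -> Lint p (fun _ : Rn => 0).
Proof.
move=> p0; split; first exact: measurable_cst.
apply: (eq_integrable measurableT (EFin \o (fun _ : Rn => 0 : R))); last exact: rint0.
by move=> x _ /=; rewrite normr0 powR0.
Qed.

Lemma Lint_sum p (I : Type) (r : seq I) (F : I -> Rn -> R) : 0 < p ->
  (forall i, Lint p (F i)) -> Lint p (fun x => \sum_(i <- r) F i x).
Proof.
move=> p0 Fp; elim: r => [|i r IH].
  under eq_fun do rewrite big_nil; apply: Lint0; by rewrite gt_eqF.
under eq_fun do rewrite big_cons; apply: LintD (Fp i) IH; exact: ltW.
Qed.

(** A test function is bounded and vanishes off a compact set. *)
Lemma Lint_cutoff p f (eta : Rn -> R) : 0 < p -> Lploc p f -> test_function eta ->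
  Lint p (fun x => eta x * f x).
Proof.
move=> p0 /LplocE[mf fp] te.
have me := continuous_measurable_rV (test_cts te).
split; first exact: measurable_funM.
apply: (eq_integrable measurableT (EFin \o (fun x => `|f x| `^ p * `|eta x| `^ p))).
  by move=> x _ /=; rewrite normrM powRM// mulrC.
have [C eC] := csupp_bounded (test_cts te) (test_csupp te).
have [M eM] := test_csupp te.
apply: (rint_loc (B := C `^ p) fp); first exact: measurable_powR_norm.
- move=> x; rewrite ger0_norm ?powR_ge0//; apply: ge0_ler_powR; rewrite ?nnegrE//; first exact: ltW.
  exact: le_trans (eC x).
- by exists M => x /eM ->; rewrite normr0 powR0// gt_eqF.
Qed.

(** With c = b^(1/3) the claim is a c^3 <= a^4 + c^4: compare a and c. *)
Lemma young4 (a b : R) : 0 <= a -> 0 <= b -> a * b <= a `^ 4 + b `^ (4 / 3).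
Proof.
move=> a0 b0; pose c := b `^ (1 / 3).
have c0 : 0 <= c by exact: powR_ge0.
have bE : b = c ^+ 3.
  by rewrite -powR_mulrn// /c -powRrM (_ : 1 / 3 * 3%:R = 1) ?powRr1//; field.
have cE : b `^ (4 / 3) = c ^+ 4.
  by rewrite -powR_mulrn// /c -powRrM; congr (_ `^ _); field.
rewrite cE powR_mulrn// bE.
have [ac|/ltW ca] := leP a c.
  apply: (@le_trans _ _ (c ^+ 4)); last by rewrite lerDr exprn_ge0.
  by rewrite [c ^+ 4]exprS ler_wpM2r// exprn_ge0.
apply: (@le_trans _ _ (a ^+ 4)); last by rewrite lerDl exprn_ge0.
by rewrite [a ^+ 4]exprS ler_wpM2l// lerXn2r// nnegrE.
Qed.

Lemma rint_prod4 f g : Lint 4 f -> Lint (4 / 3) g ->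
  mu.-integrable setT (EFin \o (fun x => f x * g x)).
Proof.
move=> [mf fi] [mg gi].
apply: (rint_dom (g := fun x => `|f x| `^ 4 + `|g x| `^ (4 / 3))); last exact: rintD.
  exact: measurable_funM.
by move=> x; rewrite normrM young4.
Qed.

Lemma rint_prod2 f g : Lint 2 f -> Lint 2 g ->
  mu.-integrable setT (EFin \o (fun x => f x * g x)).
Proof.
move=> [mf fi] [mg gi].
apply: (rint_dom (g := fun x => `|f x| `^ 2 + `|g x| `^ 2)); last exact: rintD.
  exact: measurable_funM.
move=> x; rewrite normrM !powR_mulrn//.
have := sqr_ge0 (`|f x| - `|g x|); have := mulr_ge0 (normr_ge0 (f x)) (normr_ge0 (g x)).
by rewrite sqrrB; lra.
Qed.

End global_integrability.

Section spinor_fields.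
Context {R : realType} {n K L : nat}.
Local Notation Rn := 'rV[R]_n.
Local Notation mu := (@lebesgue_rV R n).
Local Notation spinor := 'M[R[i]]_(L, K).
Implicit Types (u v psi : Rn -> spinor).

Definition spinor_Lint (p : R) u := forall b s i, Lint p (fun x : Rn => part b (u x s i)).

Lemma part_mull (B : 'M[R[i]]_L) (v : spinor) b s i : part b ((B *m v) s i) =
  \sum_r (complex.Re (B s r) * part b (v r i) +
    (if b then - complex.Im (B s r) else complex.Im (B s r)) * part (~~ b) (v r i)).
Proof. by rewrite mxE part_sum; apply: eq_bigr => r _; rewrite partM. Qed.

Lemma spinor_Lint_mull p (B : 'M[R[i]]_L) v : 0 < p -> spinor_Lint p v ->
  spinor_Lint p (fun x => B *m v x).
Proof.
move=> p0 vp b s i; under eq_fun do rewrite part_mull.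
by apply: Lint_sum => // r; apply: LintD; [exact: ltW|apply: LintZ; [exact: ltW|exact: vp]..].
Qed.

Lemma spinor_wderiv_ip a (S : spinor) psi dpsi : is_spinor_wderiv a psi dpsi ->
  is_wderiv a (fun x => ip (psi x) S) (fun x => ip (dpsi x) S).
Proof.
move=> pd; under eq_fun do rewrite ipE.
under [X in is_wderiv _ _ X]eq_fun do rewrite ipE.
do 3 apply: is_wderiv_sum => ?.
under eq_fun do rewrite mulrC; under [X in is_wderiv _ _ X]eq_fun do rewrite mulrC.
by apply: is_wderivZ; exact: pd.
Qed.

Lemma Lint_ip p (S : spinor) psi : 0 < p -> spinor_Lint p psi -> Lint p (fun x => ip (psi x) S).
Proof.
move=> p0 pd; under eq_fun do rewrite ipE.
do 3 apply: (Lint_sum _ p0) => ?.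
by under eq_fun do rewrite mulrC; apply: LintZ; [exact: ltW|exact: pd].
Qed.

Lemma rint_ip u v : spinor_Lint 4 u -> spinor_Lint (4 / 3) v ->
  mu.-integrable setT (EFin \o (fun x => ip (u x) (v x))).
Proof.
move=> u4 v4; under [X in _.-integrable _ (EFin \o X)]eq_fun do rewrite ipE.
by do 3 apply: rint_sum => ?; apply: rint_prod4; [exact: u4|exact: v4].
Qed.

Lemma rint_ip_clifford (B : 'M[R[i]]_L) u v : spinor_Lint 4 u -> spinor_Lint (4 / 3) v ->
  mu.-integrable setT (EFin \o (fun x => ip (u x) (B *m v x))).
Proof. by move=> u4 v4; apply: rint_ip => //; apply: spinor_Lint_mull. Qed.

End spinor_fields.

(** * Vertical variations *)

Section affine_variations.
Context {R : realType} {n : nat}.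
Local Notation Rn := 'rV[R]_n.
Local Notation mu := (@lebesgue_rV R n).

Lemma sobolev_locD (q p : R) (f g : Rn -> R) : 0 <= q -> 0 <= p -> sobolev_loc q p f ->
  sobolev_loc q p g -> sobolev_loc q p (fun x => f x + g x).
Proof.
move=> q0 p0 [fq fp] [gq gp]; split; first exact: LplocD.
move=> a; have [f' ff' fp'] := fp a; have [g' gg' gp'] := gp a.
by exists (fun x => f' x + g' x); [exact: is_wderivD|exact: LplocD].
Qed.

Lemma sobolev_locZ (q p c : R) (f : Rn -> R) : 0 <= q -> 0 <= p -> sobolev_loc q p f ->
  sobolev_loc q p (fun x => c * f x).
Proof.
move=> q0 p0 [fq fp]; split; first exact: LplocZ.
move=> a; have [f' ff' fp'] := fp a.
by exists (fun x => c * f' x); [exact: is_wderivZ|exact: LplocZ].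
Qed.

Let integral_zero (F : Rn -> \bar R) : (forall x, 0 <= F x)%E ->
  {ae mu, forall x, F x = 0%E} -> (\int[mu]_x F x = 0)%E.
Proof.
by move=> F0 Fae; rewrite (ge0_integral_ae F0 (g := cst 0%E))// integral0.
Qed.

(** The difference quotients are equal to h and those of the weak derivatives to
    that of h, almost everywhere and for all t, so the limits are limits of zero. *)
Lemma sobolev_derivable_affine (q p : R) (f h : Rn -> R) : 0 < q -> 0 < p ->
  sobolev_loc q p f -> sobolev_loc q p h ->
  sobolev_derivable q p (fun t x => f x + t * h x) h.
Proof.
move=> q0 p0 sf sh.
have zero (F : R -> \bar R) : (forall t, t != 0 -> F t = 0%E) -> F t @[t --> 0^'] --> 0%E.
  move=> F0; apply: cvg_near_cst; near=> t; apply: F0.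
  by near: t; exact: nbhs_dnbhs_neq.
split=> [//||a]; apply: zero => t t0.
  under eq_integral => x _.
    rewrite (_ : (_ - _) / t - h x = 0); last by field.
    rewrite normr0 powR0 ?gt_eqF//.
    over.
  exact: integral0.
apply: integral_zero => [x|]; first by rewrite lee_fin powR_ge0.
have [f' ff' _] := sf.2 a; have [h' hh' _] := sh.2 a.
have d t' : is_wderiv a (fun x => f x + t' * h x) (fun x => f' x + t' * h' x).
  by apply: is_wderivD => //; exact: is_wderivZ.
apply: filterS3 (wderiv_ae (d t)) (wderiv_ae (d 0)) (wderiv_ae hh') => x -> -> ->.
rewrite (_ : (_ - _) / t - h' x = 0) ?normr0 ?powR0 ?gt_eqF//; by field.
Unshelve. all: by end_near. Qed.

End affine_variations.

Lemma is_derive_seq {R : realType} (f : R -> R) (l : R) (t : nat -> R) :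
  is_derive (0 : R) 1 f l -> t @ \oo --> (0 : R) -> (forall k, t k != 0) ->
  (f (t k) - f 0) / t k @[k --> \oo] --> l.
Proof.
move=> [df <-] t0 tn0.
have /cvgr_dnbhsP/(_ t) h := df.
rewrite (_ : (fun k => _) = fun k => (t k)^-1 *: ((f \o shift 0) (t k *: 1) - f 0)).
  exact: h (conj tn0 t0).
by apply/funext => k; rewrite /= addr0 /GRing.scale /= mulr1 mulrC.
Qed.

(** A and dpsi are versions of the weak derivatives of phi and psi.  They are
    parameters because weak derivatives are determined up to null sets only. *)
Section vertical_variations.
Context {R : realType} {n K L d : nat}.
Local Notation Rn := 'rV[R]_n.
Local Notation RK := 'rV[R]_K.
Local Notation mu := (@lebesgue_rV R n).
Local Notation spinor := 'M[R[i]]_(L, K).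
Context (E : 'I_n -> 'M[R[i]]_L) (N : set RK) (phi : Rn -> RK) (psi : Rn -> spinor).
Context (A : 'I_n -> Rn -> RK) (dpsi : 'I_n -> Rn -> spinor).
Hypotheses (sN : submanifold d N) (wdh : weakly_dirac_harmonic E N phi psi).
Hypotheses (phiA : forall a i, is_wderiv a (fun x => phi x 0 i) (fun x => A a x 0 i)).
Hypotheses (A2 : forall a i, Lint 2 (fun x => A a x 0 i)).
Hypotheses (psid : forall a, is_spinor_wderiv a psi (dpsi a)).
Hypotheses (psi4 : spinor_Lint 4 psi) (dpsi43 : forall a, spinor_Lint (4 / 3) (dpsi a)).

Lemma rint_map_energy : mu.-integrable setT (EFin \o
  (fun x => \sum_a \sum_i A a x 0 i ^+ 2)).
Proof.
apply: rint_sum => a; apply: rint_sum => i.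
by under [X in _.-integrable _ (EFin \o X)]eq_fun do rewrite expr2; exact: rint_prod2.
Qed.

Lemma rint_clifford_sum (u : Rn -> spinor) (v : 'I_n -> Rn -> spinor) : spinor_Lint 4 u ->
  (forall a, spinor_Lint (4 / 3) (v a)) ->
  mu.-integrable setT (EFin \o (fun x => \sum_a ip (u x) (E a *m v a x))).
Proof. by move=> u4 v4; apply: rint_sum => a; exact: rint_ip_clifford. Qed.

Lemma rint_density : mu.-integrable setT (EFin \o
  (fun x => lagrangian_density E (A^~ x) (psi x) (dpsi^~ x))).
Proof. by apply: rintD; [exact: rint_map_energy|exact: rint_clifford_sum]. Qed.

Lemma density_affine (A' : 'I_n -> RK) (u v : spinor) (du dv : 'I_n -> spinor) (t : R) :
  lagrangian_density E A' (u + (t%:C)%C *: v) (fun a => du a + (t%:C)%C *: dv a) =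
  lagrangian_density E A' u du +
    (t * (\sum_a ip v (E a *m du a) + \sum_a ip u (E a *m dv a)) +
    t ^+ 2 * \sum_a ip v (E a *m dv a)).
Proof.
rewrite /lagrangian_density -addrA; congr (_ + _).
rewrite mulrDr !mulr_sumr -!big_split /=; apply: eq_bigr => a _.
by rewrite mulmxDr -scalemxAr !ipDl !ipDr !ipZl !ipZr; ring.
Qed.

Lemma part_affine (t : R) (u v : spinor) b s i :
  part b ((u + (t%:C)%C *: v) s i) = part b (u s i) + t * part b (v s i).
Proof. by rewrite !mxE partD partZ. Qed.

(** Along psi + t xi the functional is a quadratic polynomial in t, and criticality
    says that its linear coefficient vanishes. *)
Lemma weak_equation (D : set Rn) (xi : Rn -> spinor) (dxi : 'I_n -> Rn -> spinor) :
  compact D -> (forall x, ~ D x -> xi x = 0) -> spinor_Lint 4 xi ->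
  (forall a, spinor_Lint (4 / 3) (dxi a)) ->
  (forall a, is_spinor_wderiv a xi (dxi a)) -> tangential N phi xi ->
  \int[mu]_(x in D) (\sum_a ip (xi x) (E a *m dpsi a x) +
     \sum_a ip (psi x) (E a *m dxi a x)) = 0.
Proof.
move=> cD xiD xi4 dxi43 dxiE txi.
have [[phi1 Nphi] [psi1 tpsi] crit] := wdh.
pose psit (t : R) x := psi x + (t%:C)%C *: xi x.
pose dpsit (t : R) a x := dpsi a x + (t%:C)%C *: dxi a x.
have p40 : (0 : R) <= 4 by [].
have p430 : (0 : R) <= 4 / 3 by rewrite divr_ge0.
have sxi b s i : sobolev_loc 4 (4 / 3) (fun x : Rn => part b (xi x s i)).
  split; first exact: Lint_Lploc.
  move=> a; exists (fun x => part b (dxi a x s i)); first exact: dxiE.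
  exact: Lint_Lploc (dxi43 a b s i).
have spsi b s i : sobolev_loc 4 (4 / 3) (fun x : Rn => part b (psi x s i)).
  by have [h1 h2] := psi1 s i; case: b.
have spsit t b s i : sobolev_loc 4 (4 / 3) (fun x : Rn => part b (psit t x s i)).
  under eq_fun do rewrite part_affine.
  by apply: sobolev_locD => //; apply: sobolev_locZ.
have tpsit t : tangential N phi (psit t).
  apply: filterS2 tpsi txi => x h1 h2 nu Nnu.
  by rewrite mulmxDl -scalemxAl h1// h2// scaler0 addr0.
have dpsitE t a : is_spinor_wderiv a (psit t) (dpsit t a).
  move=> b s i; under eq_fun do rewrite part_affine.
  under [X in is_wderiv _ _ X]eq_fun do rewrite part_affine.
  by apply: is_wderivD; [exact: psid|apply: is_wderivZ; exact: dxiE].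
have var : variation N phi psi D (fun=> phi) psit.
  split.
  - apply: filterE => t; split; first by split.
    by split; [move=> s i; split; [exact: (spsit t true)|exact: (spsit t false)]|exact: tpsit].
  - by [].
  - by apply/funext => x; rewrite /psit scale0r addr0.
  - exact: cD.
  - by move=> t x Dx; split => //; rewrite /psit xiD// scaler0 addr0.
  - move=> i; exists (fun=> 0).
    have s0 : sobolev_loc 2 2 (fun _ : Rn => 0 : R).
      have := sobolev_locZ 0 (ler0n R 2) (ler0n R 2) (phi1 i).
      by under eq_fun do rewrite mul0r.
    rewrite (_ : (fun _ : R => _) = fun t x => phi x 0 i + t * (fun _ : Rn => 0) x).
      exact: sobolev_derivable_affine (ltr0Sn R 1) (ltr0Sn R 1) (phi1 i) s0.
    by apply/funext => t; apply/funext => x; rewrite mulr0 addr0.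
  - move=> s i; exists (fun x => part true (xi x s i)), (fun x => part false (xi x s i)).
    have h b := sobolev_derivable_affine (ltr0Sn R 3) (divr_gt0 (ltr0Sn R 3) (ltr0Sn R 2))
      (spsi b s i) (sxi b s i).
    have e b : (fun t x => part b (psit t x s i)) =
        fun t x => part b (psi x s i) + t * part b (xi x s i).
      by apply/funext => t; apply/funext => x; rewrite -part_affine.
    have := h true; have := h false; rewrite -!e => h1 h2.
    by split; [exact: h2|exact: h1].
have := crit _ _ _ var.
have mD : measurable D by exact: compact_measurable_rV.
have int (f : Rn -> R) : mu.-integrable setT (EFin \o f) -> mu.-integrable D (EFin \o f).
  by apply: integrableS.
have i0 := rint_density.
have i1 := rintD (rint_clifford_sum xi4 dpsi43) (rint_clifford_sum psi4 dxi43).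
have i2 := rint_clifford_sum xi4 dxi43.
set c1 := \int[mu]_(x in D) _.
pose c0 := \int[mu]_(x in D) lagrangian_density E (A^~ x) (psi x) (dpsi^~ x).
pose c2 := \int[mu]_(x in D) \sum_a ip (xi x) (E a *m dxi a x).
have Lt t : lagrangian E N D phi (psit t) = c0 + (t * c1 + t ^+ 2 * c2).
  rewrite (lagrangianE E D sN Nphi (tpsit t) phiA (dpsitE t)).
  under eq_Rintegral do rewrite density_affine.
  rewrite RintegralD//; [|exact: int|apply: int; apply: rintD; exact: rintZ].
  rewrite [X in _ + X]RintegralD//; [|apply: int; exact: rintZ..].
  by rewrite !RintegralZl//; exact: int.
move=> /is_derive_seq/(_ cvg_harmonic) h.
have {}h := h (fun k => lt0r_neq0 (harmonic_gt0 k)).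
have lim : (lagrangian E N D phi (psit (harmonic k)) - lagrangian E N D phi (psit 0)) /
    harmonic k @[k --> \oo] --> c1 + 0 * c2.
  rewrite (_ : (fun k => _) = fun k => c1 + harmonic k * c2).
    apply: cvgD; first exact: cvg_cst.
    by apply: cvgM; [exact: cvg_harmonic|exact: cvg_cst].
  apply/funext => k; rewrite !Lt.
  by have := lt0r_neq0 (harmonic_gt0 (R := R) k); move: (harmonic k) => e e0; field.
by have := cvg_unique _ lim h; rewrite mul0r addr0 => ->.
Qed.

(** The variation xi = eta psi.  Both terms of the equation give the integrand,
    and the derivative of eta only meets <psi, e_a o psi>, which vanishes by
    skewness. *)
Lemma energy_identity (cE : clifford_module E) (eta : Rn -> R) : test_function eta ->
  \int[mu]_x (eta x * \sum_a ip (psi x) (E a *m dpsi a x)) = 0.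
Proof.
move=> te; have [_ [psi1 tpsi] _] := wdh.
pose xi x := ((eta x)%:C)%C *: psi x.
pose dxi a x := ((eta x)%:C)%C *: dpsi a x + (('D_('e_a) eta x)%:C)%C *: psi x.
have [M eM] := test_csupp te.
have me := continuous_measurable_rV (test_cts te).
have [C eC] := csupp_bounded (test_cts te) (test_csupp te).
have dxi43 a : spinor_Lint (4 / 3) (dxi a).
  move=> b s i; under eq_fun do rewrite !mxE partD !partZ.
  apply: LintD; [by rewrite divr_ge0| |].
    by apply: (Lint_mul _ _ me eC); [rewrite divr_ge0|exact: dpsi43].
  apply: Lint_cutoff; [by rewrite divr_gt0| |exact: test_derive].
  apply: (@Lploc_le _ _ 4); [by rewrite divr_ge0|by lra|exact: Lint_Lploc].
have dxiE a : is_spinor_wderiv a xi (dxi a).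
  move=> b s i; under eq_fun do rewrite mxE partZ.
  under [X in is_wderiv _ _ X]eq_fun do rewrite !mxE partD !partZ.
  by apply: is_wderivM => //; exact: psid.
pose D := [set x : Rn | `|x| <= M].
have zD x : ~ D x -> M < `|x| by move=> /negP; rewrite -ltNge.
have cD : compact D by exact: compact_ball_norm.
have := @weak_equation D xi dxi cD.
have E0 x : \sum_a ip (xi x) (E a *m dpsi a x) + \sum_a ip (psi x) (E a *m dxi a x) =
    2 * (eta x * \sum_a ip (psi x) (E a *m dpsi a x)).
  rewrite !mulr_sumr -big_split /=; apply: eq_bigr => a _.
  rewrite /xi /dxi mulmxDr -!scalemxAr ipZl ipDr !ipZr.
  by rewrite (ip_skew0 cE) mulr0 addr0; ring.
under eq_Rintegral do rewrite E0.
move=> h; have {h} : \int[mu]_(x in D) (2 * (eta x * \sum_a ip (psi x) (E a *m dpsi a x))) = 0.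
  apply: h => //.
  - by move=> x /zD/eM ex; rewrite /xi ex scale0r.
  - move=> b s i; under eq_fun do rewrite mxE partZ.
    by apply: (Lint_mul _ _ me eC) => //; exact: psi4.
  - apply: filterS tpsi => x h nu Nnu.
    by rewrite -scalemxAl h// scaler0.
have ei : mu.-integrable setT (EFin \o (fun x => eta x * \sum_a ip (psi x) (E a *m dpsi a x))).
  apply: (rint_dom (g := fun x => C * `|\sum_a ip (psi x) (E a *m dpsi a x)|)).
  - apply: measurable_funM => //; exact: (rint_meas (rint_clifford_sum psi4 dpsi43)).
  - by move=> x; rewrite normrM ler_wpM2r.
  - by apply: rintZ; apply: rint_norm; exact: rint_clifford_sum.
rewrite -Rint_supp; last by move=> x /zD/eM ->; rewrite mul0r mulr0.
by rewrite RintegralZl// => /eqP; rewrite mulf_eq0 pnatr_eq0 /= => /eqP.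
Qed.

End vertical_variations.

(** * Domain variations *)

Section moving_integrals.
Context {R : realType} {n : nat}.
Local Notation Rn := 'rV[R]_n.
Local Notation mu := (@lebesgue_rV R n).
Implicit Types (H w y : Rn -> R).

Lemma rint_bounded H w (B : R) : mu.-integrable setT (EFin \o H) -> measurable_fun setT w ->
  (forall x, `|w x| <= B) -> mu.-integrable setT (EFin \o (fun x => H x * w x)).
Proof.
move=> Hi mw wB; apply: (rint_dom (g := fun x => B * `|H x|)).
- by apply: measurable_funM => //; exact: (rint_meas Hi).
- by move=> x; rewrite normrM mulrC ler_wpM2r.
- by apply: rintZ; exact: rint_norm.
Qed.

(** Dominated convergence: the dilates of g converge to the constant g 0. *)
Lemma dilation_limit H g : mu.-integrable setT (EFin \o H) -> continuous g -> csupp g ->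
  \int[mu]_x (H x * g (k.+1%:R^-1 *: x)) @[k --> \oo] --> g 0 * \int[mu]_x H x.
Proof.
move=> Hi cg sg; have [C gC] := csupp_bounded cg sg.
rewrite mulrC -RintegralZr//.
have cs k : continuous (fun x : Rn => k.+1%:R^-1 *: x : Rn).
  apply: cts_rV => z e e0; exists e => // w zw.
  by rewrite -scalerBr normrZ ger0_norm// (le_lt_trans _ zw)// ler_piMl// invS_le1.
have [||||_ //] := @Rint_dct _ Rn R mu (fun k x => H x * g (k.+1%:R^-1 *: x))
  (fun x => H x * g 0) (fun x => C * `|H x|).
- move=> k; apply: measurable_funM; first exact: (rint_meas Hi).
  by apply: continuous_measurable_rV; exact: (cts_comp (cs k) cg).
- move=> x; apply: cvgM; first exact: cvg_cst.
  apply/cvgrPdist_lt => e e0.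
  have /nbhs_ballP[r /= r0 rP] := cg 0 (ball (g 0) e) (nbhsx_ballx _ _ e0).
  near=> k; have := rP (k.+1%:R^-1 *: x); rewrite -!ball_normE /=; apply.
  rewrite sub0r normrN normrZ ger0_norm//.
  have x1 : 0 < `|x| + 1 by rewrite ltr_wpDl.
  apply: (@le_lt_trans _ _ (k.+1%:R^-1 * (`|x| + 1))); first by rewrite ler_wpM2l// lerDl.
  rewrite -ltr_pdivlMr//; near: k; apply: invS_lt; exact: divr_gt0.
- by move=> k x; rewrite normrM mulrC ler_wpM2r.
- by apply: rintZ; exact: rint_norm.
Unshelve. all: by end_near. Qed.

Context (b : 'I_n) (y : Rn -> R) (B C : R).
Hypotheses (ty : test_function y) (yB : forall x, `|y x| <= B).
Hypotheses (yC : forall a x, `|'D_('e_a) y x| <= C).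
Local Notation flow t := (shear b (fun x => t * y x)).
(** The times at which the shear by t y satisfies the contraction condition. *)
Definition small_time (t : R) := n%:R * (`|t| * C) <= 2^-1.

Let C0 : 0 <= C.
Proof. exact: le_trans (yC b 0). Qed.

Lemma flow_C1 t : C1 (fun x => t * y x).
Proof. exact: (test_C1 (test_scale t ty)). Qed.

Lemma flow_csupp t : csupp (fun x => t * y x).
Proof. exact: (test_csupp (test_scale t ty)). Qed.

Lemma flow_derive t v x : 'D_v (fun x => t * y x) x = t * 'D_v y x.
Proof. by rewrite (@deriveZ _ _ _ y t x v (@test_derivable _ _ y x v ty)). Qed.

Lemma flow_bound t a x : `|'D_('e_a) (fun x => t * y x) x| <= `|t| * C.
Proof. by rewrite flow_derive normrM ler_wpM2l. Qed.

Lemma rint_flow H t : small_time t -> mu.-integrable setT (EFin \o H) ->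
  mu.-integrable setT (EFin \o (fun x => H (flow t x))).
Proof.
move=> st Hi.
have h := shear_integrable b (flow_C1 t) (flow_csupp t) st (flow_bound t) Hi.
apply: (rint_dom (g := fun x => 2 * `|H (flow t x) * (1 + 'D_('e_b) (fun x => t * y x) x)|)).
- apply: measurableT_comp (rint_meas Hi) _; exact: measurable_shear (flow_C1 t).
- move=> x; have := shear_jacobian b st (flow_bound t) x.
  move: (1 + _) => J J2; rewrite normrM mulrCA ler_peMr//.
  by rewrite ger0_norm; lra.
- by apply: rintZ; exact: rint_norm.
Qed.

(** H is merely integrable, so the flow is moved onto the continuous function w;
    dominated convergence then applies to the adjoint functions W. *)
Lemma flow_limit H w (t : nat -> R) : (forall k, small_time (t k)) ->
  t @ \oo --> (0 : R) -> mu.-integrable setT (EFin \o H) -> continuous w -> csupp w ->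
  \int[mu]_x (H (flow (t k) x) * w x) @[k --> \oo] --> \int[mu]_x (H x * w x).
Proof.
move=> st t0 Hi cw sw; have [Cw wC] := csupp_bounded cw sw.
have Cw0 : 0 <= Cw by exact: le_trans (wC 0).
have B0 : 0 <= B by exact: le_trans (yB 0).
have /choice[W WP] : forall k, exists W, [/\ continuous W, csupp W,
    \int[mu]_x (H (flow (t k) x) * w x) = \int[mu]_x (H x * W x)
  & forall z, exists2 z', W z = w z' * (1 + t k * 'D_('e_b) y z')^-1 & `|z' - z| <= `|t k| * B].
  move=> k; have [W [cW sW WE Wz]] := shear_dual b (flow_C1 (t k)) (flow_csupp (t k)) (st k) (flow_bound (t k)) cw sw.
  exists W; split => //; first by apply: WE; exact: rint_L1loc.
  move=> z; have [z' z'E z'B] := Wz z; exists z'; first by rewrite z'E flow_derive.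
  by apply: z'B => x; rewrite normrM ler_wpM2l.
have J2 k z : 2^-1 <= 1 + t k * 'D_('e_b) y z.
  by have := shear_jacobian b (st k) (flow_bound (t k)) z; rewrite flow_derive.
have [||||_] := @Rint_dct _ Rn R mu (fun k x => H x * W k x)
  (fun x => H x * w x) (fun x => 2 * Cw * `|H x|).
- move=> k; apply: measurable_funM; first exact: (rint_meas Hi).
  by apply: continuous_measurable_rV; case: (WP k).
- move=> z; apply: cvgM; first exact: cvg_cst.
  have /choice[z' z'P] : forall k, exists z', W k z = w z' * (1 + t k * 'D_('e_b) y z')^-1 /\
      `|z' - z| <= `|t k| * B.
    by move=> k; have [_ _ _ /(_ z) [z' h1 h2]] := WP k; exists z'.
  have wz : w (z' k) @[k --> \oo] --> w z.
    apply/cvgrPdist_lt => e e0.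
    have /nbhs_ballP[r /= r0 rP] := cw z (ball (w z) e) (nbhsx_ballx _ _ e0).
    near=> k; have := rP (z' k); rewrite -!ball_normE /=; apply.
    rewrite distrC; have [_ h] := z'P k; apply: le_lt_trans h _.
    apply: (@le_lt_trans _ _ (`|t k| * (B + 1))); first by rewrite ler_wpM2l// lerDl.
    rewrite -ltr_pdivlMr; last by lra.
    near: k; move/cvgrPdist_lt: t0 => /(_ (r / (B + 1))).
    rewrite divr_gt0//; last by lra.
    by move=> /(_ isT); apply: filterS => k; rewrite sub0r normrN.
  have Jz : 1 + t k * 'D_('e_b) y (z' k) @[k --> \oo] --> (1 : R).
    apply/cvgrPdist_lt => e e0; near=> k.
    rewrite opprD addrA subrr sub0r normrN normrM.
    apply: (@le_lt_trans _ _ (`|t k| * (C + 1))).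
      by rewrite ler_wpM2l//; apply: le_trans (yC _ _) _; rewrite lerDl.
    rewrite -ltr_pdivlMr; last by have := C0; lra.
    near: k; move/cvgrPdist_lt: t0 => /(_ (e / (C + 1))).
    rewrite divr_gt0//; last by have := C0; lra.
    by move=> /(_ isT); apply: filterS => k; rewrite sub0r normrN.
  rewrite (_ : (fun k => _) = fun k => w (z' k) * (1 + t k * 'D_('e_b) y (z' k))^-1); last first.
    by apply/funext => k; case: (z'P k).
  rewrite -[w z]mulr1 -[X in _ * X]invr1.
  by apply: cvgM => //; apply: cvgV => //; exact: oner_neq0.
- move=> k z; rewrite normrM mulrC ler_wpM2r//.
  have [_ _ _ /(_ z) [z' -> _]] := WP k.
  rewrite normrM mulrC; apply: ler_pM => //.
  have := J2 k z'; move: (1 + _) => J J2'; rewrite normfV ger0_norm; last by lra.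
  by rewrite invf_ple ?posrE//; lra.
- by apply: rintZ; exact: rint_norm.
rewrite (_ : (fun k => \int[mu]_x (H (flow (t k) x) * w x)) = (fun k => \int[mu]_x (H x * W k x))) //.
by apply/funext => k; case: (WP k).
Unshelve. all: by end_near. Qed.

(** The Jacobian of the shear by t y is exactly 1 + t D_b y. *)
Lemma flow_integral H t : small_time t -> mu.-integrable setT (EFin \o H) ->
  \int[mu]_x H (flow t x) = \int[mu]_x H x - t * \int[mu]_x (H (flow t x) * 'D_('e_b) y x).
Proof.
move=> st Hi.
have Fi := rint_flow st Hi.
have mdy : measurable_fun setT ('D_('e_b) y).
  by apply: continuous_measurable_rV; exact/test_cts/test_derive.
have Gi := rint_bounded Fi mdy (yC b).
rewrite [in RHS](shear_Rintegral b (flow_C1 t) (flow_csupp t) st (flow_bound t) Hi).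
under [X in _ = X - _]eq_Rintegral do rewrite flow_derive mulrDr mulr1 mulrCA.
by rewrite RintegralD// ?RintegralZl// ?addrK//; exact: rintZ.
Qed.

End moving_integrals.

Lemma cvg_bigsum {R : realType} (I : Type) (r : seq I) (F : I -> nat -> R) (l : I -> R) :
  (forall i, F i k @[k --> \oo] --> l i) ->
  \sum_(i <- r) F i k @[k --> \oo] --> \sum_(i <- r) l i.
Proof.
move=> Fl; elim: r => [|i r IH].
  by under eq_fun do rewrite big_nil; rewrite big_nil; exact: cvg_cst.
by under eq_fun do rewrite big_cons; rewrite big_cons; exact: cvgD.
Qed.

Section horizontal_variations.
Context {R : realType} {n K L d : nat}.
Local Notation Rn := 'rV[R]_n.
Local Notation RK := 'rV[R]_K.
Local Notation mu := (@lebesgue_rV R n).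
Local Notation spinor := 'M[R[i]]_(L, K).
Context (E : 'I_n -> 'M[R[i]]_L) (N : set RK) (phi : Rn -> RK) (psi : Rn -> spinor).
Context (A : 'I_n -> Rn -> RK) (dpsi : 'I_n -> Rn -> spinor).
Hypotheses (sN : submanifold d N) (sdh : stationary_dirac_harmonic E N phi psi).
Hypotheses (phiA : forall a i, is_wderiv a (fun x => phi x 0 i) (fun x => A a x 0 i)).
Hypotheses (A2 : forall a i, Lint 2 (fun x => A a x 0 i)).
Hypotheses (psid : forall a, is_spinor_wderiv a psi (dpsi a)).
Hypotheses (psi4 : spinor_Lint 4 psi) (dpsi43 : forall a, spinor_Lint (4 / 3) (dpsi a)).

Let F0 x := lagrangian_density E (A^~ x) (psi x) (dpsi^~ x).
(** The linear coefficient of the density when the derivatives in direction a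
    are changed by multiples of those in direction b. *)
Definition stress a b x : R :=
  2 * (\sum_i A a x 0 i * A b x 0 i) + ip (psi x) (E a *m dpsi b x).
Let F2 b x := \sum_i A b x 0 i ^+ 2.

Let F0i : mu.-integrable setT (EFin \o F0).
Proof. exact: rint_density. Qed.

Lemma rint_stress a b : mu.-integrable setT (EFin \o stress a b).
Proof.
apply: rintD; last exact: rint_ip_clifford.
by apply: rintZ; apply: rint_sum => i; exact: rint_prod2.
Qed.

Let F2i b : mu.-integrable setT (EFin \o F2 b).
Proof.
apply: rint_sum => i.
by under [X in _.-integrable _ (EFin \o X)]eq_fun do rewrite expr2; exact: rint_prod2.
Qed.

Section one_direction.
Context (b : 'I_n) (y : Rn -> R) (B C : R).
Hypotheses (ty : test_function y) (yB : forall x, `|y x| <= B).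
Hypotheses (yC : forall a x, `|'D_('e_a) y x| <= C).
Local Notation flow t := (shear b (fun x => t * y x)).

(** The chain rule for the shear x + t y(x) e_b replaces D_a by D_a + t (D_a y) D_b,
    so that the density is a polynomial in t, evaluated at the moved point. *)
Let density_flow t x : lagrangian_density E
    (fun a => A a (flow t x) + (t * 'D_('e_a) y x) *: A b (flow t x)) (psi (flow t x))
    (fun a => dpsi a (flow t x) + ((t * 'D_('e_a) y x)%:C)%C *: dpsi b (flow t x)) =
  F0 (flow t x) + (t * (\sum_a stress a b (flow t x) * 'D_('e_a) y x) +
    t ^+ 2 * (\sum_a F2 b (flow t x) * 'D_('e_a) y x ^+ 2)).
Proof.
set z := flow t x; rewrite /F0 /lagrangian_density !mulr_sumr.
rewrite -!big_split /=; apply: eq_bigr => a _.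
rewrite mulmxDr -scalemxAr ipDr ipZr.
have -> : \sum_i (A a z + (t * 'D_('e_a) y x) *: A b z) 0 i ^+ 2 =
    \sum_i A a z 0 i ^+ 2 + (2 * (t * 'D_('e_a) y x) * (\sum_i A a z 0 i * A b z 0 i) +
    (t * 'D_('e_a) y x) ^+ 2 * \sum_i A b z 0 i ^+ 2).
  rewrite !mulr_sumr -!big_split /=; apply: eq_bigr => i _; rewrite !mxE; ring.
rewrite /stress /F2; ring.
Qed.

Let lagrangian_flow D t : small_time (n := n) C t ->
  lagrangian E N D (fun x => phi (x + t *: (y x *: 'e_b))) (fun x => psi (x + t *: (y x *: 'e_b))) =
  \int[mu]_(x in D) (F0 (flow t x) + (t * (\sum_a stress a b (flow t x) * 'D_('e_a) y x) +
    t ^+ 2 * (\sum_a F2 b (flow t x) * 'D_('e_a) y x ^+ 2))).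
Proof.
move=> st; have [[[phi1 Nphi] [psi1 tpsi] _] _] := sdh.
have k1 := flow_C1 ty t; have k2 := flow_csupp ty t; have k3 := flow_bound ty yC t.
have E0 x : x + t *: (y x *: 'e_b) = flow t x by rewrite scalerA.
under eq_fun do rewrite E0; under [fun x => psi _]eq_fun do rewrite E0.
rewrite (@lagrangianE _ _ _ _ d E N D _ _
  (fun a x => A a (flow t x) + (t * 'D_('e_a) y x) *: A b (flow t x))
  (fun a x => dpsi a (flow t x) + ((t * 'D_('e_a) y x)%:C)%C *: dpsi b (flow t x))) //.
- by apply: eq_Rintegral => x _; exact: density_flow.
- exact: (shear_ae b k1 k2 st k3 Nphi).
- exact: (shear_ae b k1 k2 st k3 tpsi).
- move=> a i; under [X in is_wderiv _ _ X]eq_fun do rewrite !mxE.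
  have := is_wderiv_shear b k1 k2 st k3 (fun c => phiA c i) a.
  by under [X in is_wderiv _ _ X]eq_fun do rewrite (flow_derive ty).
- move=> a bb s i; under [X in is_wderiv _ _ X]eq_fun do rewrite !mxE partD partZ.
  have := is_wderiv_shear b k1 k2 st k3 (fun c => psid c bb s i) a.
  by under [X in is_wderiv _ _ X]eq_fun do rewrite (flow_derive ty).
Qed.

(** The difference quotients of the functional consist of the linear coefficient at
    the moved points and of the change of the integral of the density under the
    shear; both converge as t tends to 0. *)
Lemma virial_identity :
  \sum_a \int[mu]_x (stress a b x * 'D_('e_a) y x) =
  \int[mu]_x (F0 x * 'D_('e_b) y x).
Proof.
have C0 : 0 <= C by exact: le_trans (yC b 0).
have [M yM] := test_csupp ty.
pose D := [set x : Rn | `|x| <= M].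
have cD : compact D by exact: compact_ball_norm.
have zD x : ~ D x -> M < `|x| by move=> /negP; rewrite -ltNge.
pose Y x : Rn := y x *: 'e_b.
have Ysupp : supported_in D Y by move=> x /zD/yM yx; rewrite /Y yx scale0r.
have tY : test_function Y.
  split; last by exists D.
  apply: smooth_on_row; first exact: openT.
  move=> i; rewrite (_ : (fun x => _) = fun x => ('e_b : Rn) 0 i * y x); last first.
    by apply/funext => x; rewrite !mxE mulrC.
  by apply: (smooth_onM openT); [exact: smooth_on_cst openT|case: ty].
(* Small enough for the multiples t k to be small times. *)
pose t1 : R := (2 * (n%:R * C + 1))^-1.
have nC0 : 0 <= n%:R * C by rewrite mulr_ge0.
have t10 : 0 < t1 by rewrite invr_gt0; lra.
pose t (k : nat) : R := t1 * harmonic k.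
have t0 k : 0 < t k by rewrite mulr_gt0// harmonic_gt0.
have tlim : t @ \oo --> (0 : R).
  rewrite -[X in _ --> X](mulr0 t1); apply: cvgM; first exact: cvg_cst.
  exact: cvg_harmonic.
have st k : small_time (n := n) C (t k).
  rewrite /small_time (ger0_norm (ltW (t0 k))) mulrCA.
  apply: (@le_trans _ _ (t1 * (n%:R * C))).
    by rewrite ler_wpM2r//; apply: (ler_piMr (ltW t10)); exact: invS_le1.
  by rewrite /t1 invfM -mulrA ler_piMr// mulrC ler_pdivrMr; lra.
have st0 : small_time (n := n) C 0 by rewrite /small_time normr0 mul0r mulr0.
have := sdh.2 Y D tY cD Ysupp => /is_derive_seq/(_ tlim (fun k => lt0r_neq0 (t0 k))).
set q := (fun k => _) => qlim.
have mD a : measurable_fun setT ('D_('e_a) y).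
  by apply: continuous_measurable_rV; exact/test_cts/test_derive.
have yC2 a x : `|'D_('e_a) y x ^+ 2| <= C ^+ 2.
  by rewrite normrX ler_sqr ?nnegrE.
have mD2 a : measurable_fun setT (fun x => 'D_('e_a) y x ^+ 2) by exact: measurable_funX.
have i1 k a : mu.-integrable setT (EFin \o (fun x => stress a b (flow (t k) x) * 'D_('e_a) y x)).
  by apply: (rint_bounded _ (mD a) (yC a)); apply: (rint_flow _ ty yC (st k)); exact: rint_stress.
have i2 k a : mu.-integrable setT (EFin \o (fun x => F2 b (flow (t k) x) * 'D_('e_a) y x ^+ 2)).
  by apply: (rint_bounded _ (mD2 a) (yC2 a)); apply: (rint_flow _ ty yC (st k)); exact: F2i.
have flow0 x k : ~ D x -> flow (t k) x = x.
  by move=> /zD/yM yx; rewrite /shear yx mulr0 scale0r addr0.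
have dy0 x a : ~ D x -> 'D_('e_a) y x = 0 by move=> /zD; exact: derive_supp.
pose G k x := F0 (flow (t k) x) + (t k * (\sum_a stress a b (flow (t k) x) * 'D_('e_a) y x) +
    t k ^+ 2 * (\sum_a F2 b (flow (t k) x) * 'D_('e_a) y x ^+ 2)).
have Fi k := rint_flow b ty yC (st k) F0i.
have G1i k : mu.-integrable setT (EFin \o (fun x =>
    \sum_a stress a b (flow (t k) x) * 'D_('e_a) y x)) by exact: rint_sum.
have G2i k : mu.-integrable setT (EFin \o (fun x =>
    \sum_a F2 b (flow (t k) x) * 'D_('e_a) y x ^+ 2)) by exact: rint_sum.
have Gi k : mu.-integrable setT (EFin \o G k).
  by apply: rintD => //; apply: rintD; exact: rintZ.
have mDD : measurable D by exact: compact_measurable_rV.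
have qE k : q k = \sum_a \int[mu]_x (stress a b (flow (t k) x) * 'D_('e_a) y x) +
    t k * \sum_a \int[mu]_x (F2 b (flow (t k) x) * 'D_('e_a) y x ^+ 2) -
    \int[mu]_x (F0 (flow (t k) x) * 'D_('e_b) y x).
  have L0 : lagrangian E N D (fun x => phi (x + 0 *: Y x)) (fun x => psi (x + 0 *: Y x)) =
      \int[mu]_(x in D) F0 x.
    rewrite (lagrangian_flow D st0); apply: eq_Rintegral => x _.
    by rewrite expr2 !mul0r !addr0 /shear mul0r scale0r addr0.
  have LB : lagrangian E N D (fun x => phi (x + t k *: Y x)) (fun x => psi (x + t k *: Y x)) -
      lagrangian E N D (fun x => phi (x + 0 *: Y x)) (fun x => psi (x + 0 *: Y x)) =
      \int[mu]_x G k x - \int[mu]_x F0 x.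
    rewrite L0 (lagrangian_flow D (st k)) -[LHS]RintegralB//; last 2 first.
    - exact: integrableS (Gi k).
    - exact: integrableS F0i.
    rewrite -[RHS]RintegralB// -Rint_supp// => x Dx.
    rewrite flow0//.
    rewrite big1 ?mulr0 ?add0r; last by move=> a _; rewrite dy0// mulr0.
    rewrite big1 ?mulr0 ?addr0 ?subrr//.
    by move=> a _; rewrite dy0// expr2 mulr0 mulr0.
  rewrite /q LB /G RintegralD//; last by apply: rintD; exact: rintZ.
  rewrite [X in _ + X - _]RintegralD//; [|exact: rintZ..].
  rewrite !RintegralZl// (flow_integral b ty yC (st k) F0i) !Rint_sum//.
  by have := lt0r_neq0 (t0 k); move: (t k) => e e0; field.
have lim : q k @[k --> \oo] --> \sum_a \int[mu]_x (stress a b x * 'D_('e_a) y x) +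
   0 * \sum_a \int[mu]_x (F2 b x * 'D_('e_a) y x ^+ 2) - \int[mu]_x (F0 x * 'D_('e_b) y x).
  rewrite (_ : (fun k => _) = fun k =>
    \sum_a \int[mu]_x (stress a b (flow (t k) x) * 'D_('e_a) y x) +
    t k * \sum_a \int[mu]_x (F2 b (flow (t k) x) * 'D_('e_a) y x ^+ 2) -
    \int[mu]_x (F0 (flow (t k) x) * 'D_('e_b) y x)); last exact/funext.
  have cd a : continuous ('D_('e_a) y) by exact/test_cts/test_derive.
  have sd a : csupp ('D_('e_a) y) by exact/test_csupp/test_derive.
  apply: cvgB; last exact: flow_limit.
  apply: cvgD.
    apply: cvg_bigsum => a; apply: flow_limit => //; exact: rint_stress.
  apply: cvgM => //; apply: cvg_bigsum => a.
  apply: (@flow_limit R n b y B C ty yB yC (F2 b) _ t st tlim (F2i b)).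
    by under eq_fun do rewrite expr2; exact: cts_mul.
  by under eq_fun do rewrite expr2; exact: csuppMl.
have := cvg_unique _ lim qlim; rewrite mul0r addr0 => h.
by apply/eqP; rewrite -subr_eq0; apply/eqP; exact: h.
Qed.

End one_direction.
(** The virial identities for the fields x_b eta(x/r) e_b, which localize the
    dilation field.  The derivative of x_b eta(x/r) in direction a is
    delta_ab eta(x/r) + g_a(x/r) with g_a = x_b D_a eta, and g_a(0) = 0; so as r grows there
    remains the equality of the integrals of stress b b and of the density.
    Its sum over b is 2 e + s = n (e + s), where the spinor part s vanishes. *)
Lemma energy_zero (cE : clifford_module E) : (3 <= n)%N ->
  \int[mu]_x (\sum_a \sum_i A a x 0 i ^+ 2) = 0.
Proof.
move=> n3; pose eta : Rn -> R := mollifier 0%N.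
have te : test_function eta := mollifier_test 0%N.
have eta0 : eta 0 != 0 by rewrite gt_eqF// mollifier_gt0.
have ce := test_cts te; have se := test_csupp te.
pose c (k : nat) : R := k.+1%:R^-1.
have c0 k : c k != 0 by rewrite /c invr_neq0.
have teta k : test_function (fun x => eta (c k *: x)) by case: (test_dilate (c0 k) te).
have Ei := rint_map_energy A2.
have e1i := rint_clifford_sum E psi4 dpsi43.
have e10 : \int[mu]_x (\sum_a ip (psi x) (E a *m dpsi a x)) = 0.
  have h := dilation_limit e1i ce se.
  have l0 : (fun _ : nat => 0 : R) k @[k --> \oo] --> (0 : R) by exact: cvg_cst.
  rewrite (_ : (fun k => _) = fun _ : nat => 0 : R) in h; last first.
    apply/funext => k; under eq_Rintegral do rewrite mulrC.
    exact: (energy_identity sN sdh.1 phiA A2 psid psi4 dpsi43 cE (teta k)).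
  have : 0 = eta 0 * \int[mu]_x (\sum_a ip (psi x) (E a *m dpsi a x)).
    exact: (cvg_unique _ l0 h).
  by move/eqP; rewrite eq_sym mulf_eq0 (negbTE eta0) /= => /eqP.
have key b : \int[mu]_x stress b b x = \int[mu]_x F0 x.
  pose g a (x : Rn) : R := x 0 b * 'D_('e_a) eta x.
  have cg a : continuous (g a).
    by apply: cts_mul; [exact: cts_coord|exact/test_cts/test_derive].
  have sg a : csupp (g a) by apply: csuppMr; exact/test_csupp/test_derive.
  pose y k (x : Rn) : R := x 0 b * eta (c k *: x).
  have ty k : test_function (y k).
    by apply: test_mul => //; apply: smooth_coordinate; exact: openT.
  have dy k a x : 'D_('e_a) (y k) x = (a == b)%:R * eta (c k *: x) + g a (c k *: x).
    have [_ dE] := test_dilate (c0 k) te.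
    have d1 := is_derive_coord b x ('e_a : Rn).
    have d2 : derivable (fun x => eta (c k *: x)) x 'e_a by exact: test_derivable.
    rewrite (@deriveM _ _ (fun x : Rn => x 0 b)) // derive_val dE mxE eqxx /=.
    rewrite /g mxE /GRing.scale /= eq_sym; ring.
  have vir k : \sum_a \int[mu]_x (stress a b x * ((a == b)%:R * eta (c k *: x) + g a (c k *: x))) =
      \int[mu]_x (F0 x * (eta (c k *: x) + g b (c k *: x))).
    have [B yB] := csupp_bounded (test_cts (ty k)) (test_csupp (ty k)).
    have /choice[C CP] : forall a, exists C : R, forall x : Rn, `|'D_('e_a) (y k) x| <= C.
      by move=> a; apply: csupp_bounded; [exact/test_cts/test_derive|exact/test_csupp/test_derive].
    have yC a x : `|'D_('e_a) (y k) x| <= \sum_a `|C a|.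
      apply: le_trans (CP a x) _; apply: le_trans (ler_norm _) _.
      by rewrite (bigD1 a)//= lerDl sumr_ge0.
    have := virial_identity b (ty k) yB yC.
    under eq_bigr => a _ do under eq_Rintegral do rewrite dy.
    by under [in X in _ = X -> _]eq_Rintegral do rewrite dy eqxx mul1r.
  have cD a (e : R) : continuous (fun x : Rn => e * eta x + g a x).
    by apply: cts_add => //; apply: cts_mul => //; exact: cts_cst.
  have sD a (e : R) : csupp (fun x : Rn => e * eta x + g a x).
    by apply: csuppD => //; exact: csuppMr.
  have g0 a : g a 0 = 0 by rewrite /g mxE mul0r.
  have lim1 : \sum_a \int[mu]_x (stress a b x * ((a == b)%:R * eta (c k *: x) + g a (c k *: x)))
      @[k --> \oo] --> \sum_a ((a == b)%:R * eta 0 + g a 0) * \int[mu]_x stress a b x.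
    apply: cvg_bigsum => a.
    exact: (dilation_limit (rint_stress a b) (cD a (a == b)%:R) (sD a (a == b)%:R)).
  have lim2 : \int[mu]_x (F0 x * (eta (c k *: x) + g b (c k *: x))) @[k --> \oo] -->
      (eta 0 + g b 0) * \int[mu]_x F0 x.
    have := dilation_limit F0i (cD b 1) (sD b 1); rewrite mul1r.
    by under eq_fun do under eq_Rintegral do rewrite mul1r.
  rewrite (funext vir) in lim1.
  have := cvg_unique _ lim1 lim2.
  rewrite (bigD1 b)//= eqxx mul1r g0 addr0 big1 ?addr0; last first.
    by move=> a /negPf ->; rewrite mul0r g0 addr0 mul0r.
  by move=> h; apply: (mulfI eta0); exact: h.
have S1 : \sum_b \int[mu]_x stress b b x = 2 * \int[mu]_x (\sum_a \sum_i A a x 0 i ^+ 2).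
  rewrite -Rint_sum; last by move=> b; exact: rint_stress.
  transitivity (\int[mu]_x (2 * (\sum_a \sum_i A a x 0 i ^+ 2) +
      \sum_a ip (psi x) (E a *m dpsi a x))).
    apply: eq_Rintegral => x _; rewrite /stress big_split /= mulr_sumr.
    by congr (_ + _); apply: eq_bigr => b _; congr (_ * _).
  by rewrite RintegralD//; [rewrite RintegralZl// e10 addr0|exact: rintZ].
have S2 : \int[mu]_x F0 x = \int[mu]_x (\sum_a \sum_i A a x 0 i ^+ 2).
  by rewrite /F0 /lagrangian_density RintegralD// e10 addr0.
move: S1; under eq_bigr do rewrite key S2.
rewrite sumr_const card_ord -[X in X = _]mulr_natl; set e := Rintegral _ _ _ => /eqP.
rewrite -subr_eq0 -mulrBl mulf_eq0 => /orP[|/eqP//].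
by rewrite subr_eq0 eqr_nat; case: (n) n3 => [|[|[|]]].
Qed.

End horizontal_variations.

(** * Liouville's theorem in L^4 *)

Section mollification_L4.
Context {R : realType} {n : nat}.
Local Notation Rn := 'rV[R]_n.
Local Notation mu := (@lebesgue_rV R n).
Implicit Types (w : Rn -> R).

Let tangent4 (s a : R) : 0 <= s -> 0 <= a -> a ^+ 4 + 4 * a ^+ 3 * (s - a) <= s ^+ 4.
Proof.
move=> s0 a0; rewrite -subr_ge0.
rewrite (_ : _ - _ = (s - a) ^+ 2 * (s ^+ 2 + 2 * (s * a) + 3 * a ^+ 2)); last by ring.
by rewrite mulr_ge0 ?sqr_ge0// !addr_ge0 ?mulr_ge0 ?sqr_ge0.
Qed.

Lemma Lploc4 w : Lploc 4 w -> Lploc 1 (fun x => `|w x| ^+ 4).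
Proof.
by move=> /LplocE[_]; under eq_fun do rewrite powR_mulrn//.
Qed.

(** Jensen's inequality: integrate the tangent line inequality of the fourth power
    at a, the value of the mollification. *)
Lemma moll_jensen k w (x : Rn) : Lploc 4 w ->
  `|moll (mollifier k) w x| ^+ 4 <= \int[mu]_y (`|w y| ^+ 4 * mollifier k (x - y)).
Proof.
move=> w4; have w1 : Lploc 1 w by apply: Lploc_le w4 => //; rewrite ler1n.
have tr := test_reflect x (@mollifier_test R n k).
pose a := `|moll (mollifier k) w x|; rewrite -/a.
have a0 : 0 <= a by exact: normr_ge0.
have i1 := rint_test w1 tr.
have i4 := rint_test (Lploc4 w4) tr.
have im := mollifier_intl k x.
have in1 : mu.-integrable setT (EFin \o (fun y => `|w y| * mollifier k (x - y))).
  apply: eq_integrable (rint_norm i1) => // y _ /=.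
  by rewrite normrM (ger0_norm (mollifier_ge0 _ _)).
have ale : a <= \int[mu]_y (`|w y| * mollifier k (x - y)).
  apply: le_trans (le_normr_Rintegral _ i1) _ => //.
  rewrite le_eqVlt; apply/orP; left; apply/eqP; apply: eq_Rintegral => y _.
  by rewrite normrM (ger0_norm (mollifier_ge0 _ _)).
apply: (@le_trans _ _ (\int[mu]_y ((a ^+ 4 - 4 * a ^+ 3 * a) * mollifier k (x - y) +
    4 * a ^+ 3 * (`|w y| * mollifier k (x - y))))); last first.
  apply: le_Rintegral => //; first by apply: rintD; exact: rintZ.
  move=> y _; apply: (@le_trans _ _ ((a ^+ 4 + 4 * a ^+ 3 * (`|w y| - a)) * mollifier k (x - y))).
    by rewrite le_eqVlt; apply/orP; left; apply/eqP; ring.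
  by rewrite ler_wpM2r ?mollifier_ge0// tangent4.
rewrite RintegralD//; [|exact: rintZ..].
rewrite [X in X + _]RintegralZl// [X in _ + X]RintegralZl// mollifier_massl mulr1.
have : 4 * a ^+ 3 * a <= 4 * a ^+ 3 * \int[mu]_y (`|w y| * mollifier k (x - y)).
  by rewrite ler_wpM2l// mulr_ge0// exprn_ge0.
move: (\int[mu]_y (`|w y| * mollifier k (x - y))) => I; clearbody a => {tr i1 i4 im in1 ale}.
by move=> h; rewrite -addrA lerDl addrC subr_ge0.
Qed.

(** Integrate Jensen's inequality in x and exchange the integrals: the mollifier
    has mass one in either variable. *)
Lemma Lint_moll k w : Lint 4 w -> Lint 4 (moll (mollifier k) w).
Proof.
move=> w4; have wl := Lint_Lploc w4; have [mw wi] := w4.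
have w1 : Lploc 1 w by apply: Lploc_le wl => //; rewrite ler1n.
have cm : continuous (moll (mollifier k) w) := continuous_moll (@mollifier_test R n k) w1.
have mm := continuous_measurable_rV cm.
have mk : measurable_fun setT (mollifier k : Rn -> R).
  exact: (continuous_measurable_rV (test_cts (@mollifier_test R n k))).
split; first exact: mm.
apply/integrableP; split; first by apply/measurable_EFinP; exact: measurable_powR_norm.
have m4 : measurable_fun setT (fun y => `|w y| ^+ 4).
  by apply: measurable_funX; exact: measurableT_comp.
pose f (p : Rn * Rn) : R := `|w p.2| ^+ 4 * mollifier k (p.1 - p.2).
have mf : measurable_fun setT (EFin \o f).
  apply/measurable_EFinP; apply: measurable_funM.
    exact: (measurableT_comp m4 measurable_snd).
  apply: (measurableT_comp mk); apply: measurable_mxP => i j.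
  under eq_fun do rewrite !mxE.
  by apply: measurable_funB; apply: (measurableT_comp (measurable_mx_coord i j)).
have f0 p : (0 <= (EFin \o f) p)%E.
  by rewrite lee_fin mulr_ge0 ?exprn_ge0 ?mollifier_ge0.
apply: (@le_lt_trans _ _ (\int[mu]_x \int[mu]_y (EFin \o f) (x, y))%E).
  apply: ge0_le_integral => //.
  - by apply: measurableT_comp => //; apply/measurable_EFinP; exact: measurable_powR_norm.
  - exact: measurable_fun_fubini_tonelli_F.
  - move=> x _ /=; rewrite powR_mulrn// ger0_norm ?exprn_ge0//.
    rewrite Rint_EFin; last exact: (rint_test (Lploc4 wl) (test_reflect x (@mollifier_test R n k))).
    by rewrite lee_fin; exact: moll_jensen.
rewrite fubini_tonelli//.
rewrite (_ : (\int[mu]_y _)%E = (\int[mu]_y (`|w y| `^ 4)%:E)%E).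
  by rewrite Rint_EFin// ltry.
apply: eq_integral => y _; rewrite /f /= powR_mulrn//.
under eq_integral do rewrite EFinM.
rewrite ge0_integralZl//; [|exact: measurable_int (mollifier_intr k y)|..].
  by rewrite Rint_EFin; [rewrite mollifier_massr mule1|exact: mollifier_intr].
by move=> x _; rewrite lee_fin mollifier_ge0.
Qed.

(** The boxes ]-k, k[^n have volume at least k, as n > 0. *)
Lemma integrable_cst0 (e : R) : (0 < n)%N ->
  mu.-integrable setT (EFin \o (fun _ : Rn => e)) -> e = 0.
Proof.
move=> n0 ei; apply/eqP; apply: contraT => e0.
have e1 : 0 < `|e| by rewrite normr_gt0.
pose M := \int[mu]_x (`|e| + 0 * (x : Rn) 0 (Ordinal n0)).
have box (k : nat) : `|e| * k.+1%:R <= M.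
  pose Bk : set Rn := open_box (const_mx (- k.+1%:R)) (const_mx k.+1%:R).
  have mB : measurable Bk by exact: measurable_open_box.
  have : (`|e|%:E * mu Bk <= M%:E)%E.
    rewrite /M; under eq_Rintegral do rewrite mul0r addr0.
    rewrite -Rint_EFin; last exact: rint_norm.
    rewrite -integral_cst//; apply: ge0_subset_integral => //.
    by move=> x _; rewrite lee_fin.
  rewrite lebesgue_open_box -EFinM lee_fin; apply: le_trans.
  rewrite ler_wpM2l//; apply: (@le_trans _ _ (\prod_(i < n) k.+1%:R)).
    by rewrite prodr_const card_ord; apply: ler_eXnr => //; rewrite ler1n.
  apply: ler_prod => i _; rewrite !mxE gtrN// ler0n /=.
  by rewrite opprK lerDl.
have : \forall k \near \oo, M / `|e| < k%:R by exact: nbhs_infty_gtr.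
move=> [k _ /(_ k (leqnn _))] /=; rewrite ltr_pdivrMr// mulrC.
have := box k; have : `|e| * k%:R <= `|e| * k.+1%:R by rewrite ler_wpM2l// ler_nat.
lra.
Qed.

End mollification_L4.

Section liouville.
Context {R : realType} {n : nat}.
Local Notation Rn := 'rV[R]_n.
Local Notation mu := (@lebesgue_rV R n).
Implicit Types (w : Rn -> R).

Definition weakly_harmonic w := forall zeta : Rn -> R, test_function zeta ->
  \int[mu]_x (w x * \sum_a 'D_('e_a) ('D_('e_a) zeta) x) = 0.

(** The second derivatives fall on the kernel, which is a test function of y. *)
Lemma moll_harmonic k w x : Lploc 1 w -> weakly_harmonic w ->
  \sum_a 'D_('e_a) ('D_('e_a) (moll (mollifier k) w)) x = 0.
Proof.
move=> w1 hw; have tm := @mollifier_test R n k.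
have DE a : 'D_('e_a) ('D_('e_a) (moll (mollifier k) w)) x =
    moll ('D_('e_a) ('D_('e_a) (mollifier k))) w x.
  rewrite (derive_moll 'e_a tm w1).
  exact: (congr1 (@^~ x) (derive_moll 'e_a (test_derive 'e_a tm) w1)).
under eq_bigr do rewrite DE.
rewrite /moll -Rint_sum; last by move=> a; exact: moll_int (test_derive _ (test_derive _ tm)) w1.
rewrite -[RHS](hw _ (test_reflect x tm)); apply: eq_Rintegral => y _.
rewrite -mulr_sumr; apply: (congr1 (fun z => w y * z)); apply: eq_bigr => a _.
have [_ D1] := smooth_reflect x tm.1.
have tdm := test_derive 'e_a tm.
have [s2 D2] := smooth_reflect x tdm.1.
have -> : 'D_('e_a) (fun y => mollifier k (x - y)) = fun y => -1 * 'D_('e_a) (mollifier k) (x - y).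
  by apply/funext => z; rewrite D1 mulN1r.
rewrite (@deriveZ _ _ _ (fun y => 'D_('e_a) (mollifier k) (x - y)) (-1) y).
  by rewrite D2 /GRing.scale /= mulN1r opprK.
exact: (smooth_on_derivable s2).
Qed.

(** The divergence of u^3 eta^2 grad u is
    3 u^2 eta^2 |grad u|^2 + 2 u^3 eta <grad eta, grad u>, since u is harmonic; its
    integral vanishes, and the mixed term is absorbed by the square of
    u eta grad u + u^2 grad eta. *)
Lemma caccioppoli (u eta : Rn -> R) : C1 u -> (forall a, C1 ('D_('e_a) u)) ->
  (forall x, \sum_a 'D_('e_a) ('D_('e_a) u) x = 0) -> test_function eta ->
  2 * \int[mu]_x (u x ^+ 2 * eta x ^+ 2 * \sum_a 'D_('e_a) u x ^+ 2) <=
  \int[mu]_x (u x ^+ 4 * \sum_a 'D_('e_a) eta x ^+ 2).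
Proof.
move=> uC duC hu te; have eC := test_C1 te; have es := test_csupp te.
pose V a x := (u x * (u x * u x)) * ('D_('e_a) u x * (eta x * eta x)).
have VC a : C1 (V a) by exact: (C1M (C1M uC (C1M uC uC)) (C1M (duC a) (C1M eC eC))).
have Vs a : csupp (V a) by rewrite /V; apply: csuppMr; apply: csuppMr; exact: csuppMr.
have cu : continuous u by case: uC.
have ce : continuous eta by case: eC.
have cdu a : continuous ('D_('e_a) u) by case: (duC a).
have cddu a : continuous ('D_('e_a) ('D_('e_a) u)) by case: (duC a) => _ /(_ a) [].
have cde a : continuous ('D_('e_a) eta) by exact/test_cts/test_derive.
have sde a : csupp ('D_('e_a) eta) by exact/test_csupp/test_derive.
have DV a x : 'D_('e_a) (V a) x = 3 * (u x ^+ 2 * eta x ^+ 2 * 'D_('e_a) u x ^+ 2) +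
    2 * (u x ^+ 3 * eta x * ('D_('e_a) eta x * 'D_('e_a) u x)) +
    u x ^+ 3 * eta x ^+ 2 * 'D_('e_a) ('D_('e_a) u) x.
  have du : is_derive x 'e_a u ('D_('e_a) u x) by apply: DeriveDef => //; case: uC => _ /(_ a) [].
  have dd : is_derive x 'e_a ('D_('e_a) u) ('D_('e_a) ('D_('e_a) u) x).
    by apply: DeriveDef => //; case: (duC a) => _ /(_ a) [].
  have de : is_derive x 'e_a eta ('D_('e_a) eta x) by apply: DeriveDef => //; exact: test_derivable.
  have d3 := is_deriveM du (is_deriveM du du).
  have d4 := is_deriveM dd (is_deriveM de de).
  have [_ ->] := is_deriveM d3 d4.
  transitivity ((u x * (u x * u x)) * ('D_('e_a) u x * (eta x * 'D_('e_a) eta x + eta x * 'D_('e_a) eta x) +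
      (eta x * eta x) * 'D_('e_a) ('D_('e_a) u) x) +
    ('D_('e_a) u x * (eta x * eta x)) * (u x * (u x * 'D_('e_a) u x + u x * 'D_('e_a) u x) +
      (u x * u x) * 'D_('e_a) u x)); first by [].
  ring.
pose f1 x := u x ^+ 2 * eta x ^+ 2 * \sum_a 'D_('e_a) u x ^+ 2.
pose f2 x := u x ^+ 3 * eta x * \sum_a ('D_('e_a) eta x * 'D_('e_a) u x).
pose f3 x := u x ^+ 4 * \sum_a 'D_('e_a) eta x ^+ 2.
have csq (f : Rn -> R) : continuous f -> continuous (fun x => f x ^+ 2).
  by move=> cf; under eq_fun do rewrite expr2; exact: cts_mul.
have f1i : mu.-integrable setT (EFin \o f1).
  apply: rint_cts.
    apply: cts_mul; first by apply: cts_mul; exact: csq.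
    by apply: continuous_bigsum => a; exact: csq.
  by apply: csuppMl; apply: csuppMr; under eq_fun do rewrite expr2; exact: csuppMl.
have f2i : mu.-integrable setT (EFin \o f2).
  apply: rint_cts.
    apply: cts_mul; first by apply: cts_mul => //; under eq_fun do rewrite exprS; apply: cts_mul => //; exact: csq.
    by apply: continuous_bigsum => a; exact: cts_mul.
  by apply: csuppMl; exact: csuppMr.
have f3i : mu.-integrable setT (EFin \o f3).
  apply: rint_cts.
    apply: cts_mul; last by apply: continuous_bigsum => a; exact: csq.
    by under eq_fun do rewrite (exprM _ 2 2); exact: csq (csq _ cu).
  apply: csuppMr; have [M eM] := es; exists M => x Mx.
  by apply: big1 => a _; rewrite (derive_supp _ eM Mx) expr2 mulr0.
have S x : \sum_a 'D_('e_a) (V a) x = 3 * f1 x + 2 * f2 x.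
  under eq_bigr do rewrite DV.
  rewrite !big_split /= -!mulr_sumr hu mulr0 addr0.
  by congr (3 * _ + 2 * _); rewrite /f1 /f2 -mulr_sumr.
have V0 : \int[mu]_x (3 * f1 x + 2 * f2 x) = 0.
  under eq_Rintegral do rewrite -S.
  rewrite Rint_sum; first by apply: big1 => a _; exact: integral_derive_csupp.
  move=> a; apply: rint_cts; first by case: (VC a) => _ /(_ a) [].
  exact: csupp_derive.
have If : 3 * \int[mu]_x f1 x + 2 * \int[mu]_x f2 x = 0.
  rewrite -V0 RintegralD//; [|exact: rintZ..].
  by rewrite [X in _ = X + _]RintegralZl// [X in _ = _ + X]RintegralZl.
have : 0 <= \int[mu]_x (f1 x + (2 * f2 x + f3 x)).
  apply: Rintegral_ge0 => x _.
  rewrite /f1 /f2 /f3 !mulr_sumr -!big_split /=; apply: sumr_ge0 => a _.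
  rewrite (_ : _ + _ = (u x * eta x * 'D_('e_a) u x + u x ^+ 2 * 'D_('e_a) eta x) ^+ 2).
    exact: sqr_ge0.
  ring.
rewrite RintegralD//; last by apply: rintD => //; exact: rintZ.
rewrite [X in _ <= _ + X]RintegralD//; last exact: rintZ.
rewrite [X in _ <= _ + (X + _)]RintegralZl//.
change (0 <= \int[mu]_x f1 x + (2 * \int[mu]_x f2 x + \int[mu]_x f3 x) ->
  2 * \int[mu]_x f1 x <= \int[mu]_x f3 x).
move: (\int[mu]_x f1 x) (\int[mu]_x f2 x) (\int[mu]_x f3 x) If => I1 I2 I3.
clear; lra.
Qed.

End liouville.

Section liouville_L4.
Context {R : realType} {n : nat}.
Local Notation Rn := 'rV[R]_n.
Local Notation mu := (@lebesgue_rV R n).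
Implicit Types (w : Rn -> R).

(** Caccioppoli's estimate for the dilated cut-offs eta(x/r) bounds the energy of u^2
    by the integral of u^4 over r^2, so u^2 has vanishing gradient (Fatou) and is
    a constant; an integrable constant is 0. *)
Lemma smooth_liouville_L4 (u : Rn -> R) : (0 < n)%N -> C1 u -> (forall a, C1 ('D_('e_a) u)) ->
  (forall x, \sum_a 'D_('e_a) ('D_('e_a) u) x = 0) ->
  mu.-integrable setT (EFin \o (fun x => u x ^+ 4)) -> {ae mu, forall x, u x = 0}.
Proof.
move=> n0 uC duC hu u4i.
pose eta : Rn -> R := mollifier 0%N.
have te : test_function eta := mollifier_test 0%N.
have eta0 : eta 0 != 0 by rewrite gt_eqF// mollifier_gt0.
pose c (k : nat) : R := k.+1%:R^-1.
have c0 k : c k != 0 by rewrite invr_eq0 pnatr_eq0.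
have c_cvg : c k @[k --> \oo] --> (0 : R) by exact: cvg_harmonic.
pose g (x : Rn) := u x ^+ 2 * \sum_a 'D_('e_a) u x ^+ 2.
have cu : continuous u by case: uC.
have cdu a : continuous ('D_('e_a) u) by case: (duC a).
have csq (f : Rn -> R) : continuous f -> continuous (fun x => f x ^+ 2).
  by move=> cf; under eq_fun do rewrite expr2; exact: cts_mul.
have cg : continuous g.
  by apply: cts_mul; [exact: csq|apply: continuous_bigsum => a; exact: csq].
have g0 x : 0 <= g x by rewrite mulr_ge0 ?sqr_ge0// sumr_ge0// => a _; exact: sqr_ge0.
pose eta2 x := eta x ^+ 2.
have ceta : continuous eta := test_cts te.
have ceta2 : continuous eta2 by exact: csq.
have [B deB] : exists B, forall x, \sum_a 'D_('e_a) eta x ^+ 2 <= B.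
  have [||B hB] := @csupp_bounded R n (fun x => \sum_a 'D_('e_a) eta x ^+ 2).
  - by apply: continuous_bigsum => a; apply: csq; exact/test_cts/test_derive.
  - have [M eM] := test_csupp te; exists M => x Mx.
    by apply: big1 => a _; rewrite (derive_supp _ eM Mx) expr2 mulr0.
  - by exists B => x; exact: le_trans (ler_norm _) (hB x).
pose I4 := \int[mu]_x (u x ^+ 4).
pose gk (k : nat) (x : Rn) := g x * eta2 (c k *: x).
have cgk k : continuous (gk k).
  have [tk _] := test_dilate (c0 k) te.
  exact: (cts_mul cg (csq _ (test_cts tk))).
have mgk k : measurable_fun setT (EFin \o gk k).
  by apply/measurable_EFinP; exact: (continuous_measurable_rV (cgk k)).
have gk0 k x : (0 <= (EFin \o gk k) x)%E by rewrite lee_fin mulr_ge0// sqr_ge0.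
(* The gradient of eta(c_k x) carries a factor c_k, which tends to 0. *)
have gkI k : (\int[mu]_x (gk k x)%:E <= (2^-1 * (c k ^+ 2 * (B * I4)))%:E)%E.
  have [tk Dk] := test_dilate (c0 k) te.
  have h := caccioppoli uC duC hu tk.
  rewrite Rint_EFin; last first.
    apply: rint_cts; first exact: cgk.
    have [M tM] := test_csupp tk; exists M => x Mx.
    by rewrite /gk /eta2 (tM x Mx) expr2 !mulr0.
  rewrite lee_fin ler_pdivlMl//.
  rewrite (_ : \int[mu]_x gk k x = \int[mu]_x (u x ^+ 2 * eta (c k *: x) ^+ 2 * \sum_a 'D_('e_a) u x ^+ 2)).
    apply: le_trans h _; rewrite mulrA -RintegralZl//; apply: le_Rintegral => //.
    - apply: (rint_dom (g := fun x => (c k ^+ 2 * B) * u x ^+ 4)).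
      + apply: continuous_measurable_rV; apply: cts_mul.
          by under eq_fun do rewrite (exprM _ 2 2); exact: csq (csq _ cu).
        by apply: continuous_bigsum => a; apply: csq; exact/test_cts/test_derive.
      + move=> x; rewrite ger0_norm.
          rewrite mulrC ler_wpM2r ?(exprM _ 2 2) ?sqr_ge0//.
          by under eq_bigr do rewrite Dk exprMn; rewrite -mulr_sumr ler_wpM2l ?sqr_ge0.
        by rewrite mulr_ge0 ?(exprM _ 2 2) ?sqr_ge0// sumr_ge0// => a _; exact: sqr_ge0.
      + exact: rintZ.
    - exact: rintZ.
    - move=> x _; rewrite mulrC ler_wpM2r ?(exprM _ 2 2) ?sqr_ge0//.
      by under eq_bigr do rewrite Dk exprMn; rewrite -mulr_sumr ler_wpM2l ?sqr_ge0.
  by apply: eq_Rintegral => x _; rewrite /gk /g /eta2 mulrAC.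
have lim_gk x : (EFin \o gk k) x @[k --> \oo] --> (g x * eta2 0)%:E.
  apply: cvg_EFin; first by apply: nearW.
  rewrite /gk /=; apply: cvgM; first exact: cvg_cst.
  have ck : (c k *: x) @[k --> \oo] --> (0 : Rn).
    by rewrite -[X in _ --> X](scale0r x); apply: cvgZl.
  by apply: (@cvg_comp _ _ _ (fun k => c k *: x) eta2 _ _ _ ck); exact: ceta2.
have Ig : (\int[mu]_x (g x * eta2 0)%:E = 0)%E.
  apply/eqP; rewrite eq_le; apply/andP; split; last first.
    by apply: integral_ge0 => x _; rewrite lee_fin mulr_ge0// sqr_ge0.
  have := fatou mu measurableT (fun k => mgk k) (fun k x _ => gk0 k x).
  rewrite (_ : (\int[mu]_x limn_einf _)%E = (\int[mu]_x (g x * eta2 0)%:E)%E); last first.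
    by apply: eq_integral => x _; have [-> _] := cvg_limn_einf_sup (lim_gk x).
  move=> h; apply: (le_trans h).
  have l0 : (\int[mu]_x (EFin \o gk k) x)%E @[k --> \oo] --> 0%E.
    apply: (@squeeze_cvge _ _ _ _ (fun=> 0%E) _ (fun k => (2^-1 * (c k ^+ 2 * (B * I4)))%:E)).
    - by apply: nearW => k; rewrite gkI integral_ge0.
    - exact: cvg_cst.
    - apply: cvg_EFin; first exact: nearW.
      rewrite (_ : _ \o _ = (fun k => 2^-1 * (c k * c k * (B * I4)))); last by [].
      rewrite (_ : (0 : R) = 2^-1 * (0 * 0 * (B * I4))); last by rewrite mul0r mul0r mulr0.
      apply: cvgM; first exact: cvg_cst.
      apply: cvgM; last exact: cvg_cst.
      exact: cvgM.
  by have [-> _] := cvg_limn_einf_sup l0.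
have gz : {ae mu, forall x, g x = 0}.
  have := integral_eq0_ae _ _ Ig => h.
  apply: filterS (h _ _) => [x /eqP||x].
  - by rewrite mulf_eq0 expf_eq0 (negbTE eta0) andbF orbF => /eqP.
  - apply: measurable_funM; [exact: continuous_measurable_rV cg|exact: measurable_cst].
  - by rewrite mulr_ge0// sqr_ge0.
pose v x := u x * u x.
have vC : C1 v := C1M uC uC.
have [e ve] : exists e, {ae mu, forall x, v x = e}.
  apply: wderiv0_cst; last by apply: Lploc_cts ler01 _; case: vC.
  move=> a; have [_ /(_ a)[_ cdv]] := vC.
  apply: is_wderiv_ae (is_wderiv_C1 a vC).
  - by apply: continuous_measurable_rV; case: vC.
  - exact: measurable_cst.
  - by apply: nearW.
  - apply: filterS gz => x; rewrite /g => /eqP.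
    have du : derivable u x 'e_a by case: uC => _ /(_ a) [].
    rewrite /v (_ : 'D_('e_a) (fun x => u x * u x) x = u x * 'D_('e_a) u x + u x * 'D_('e_a) u x); last first.
      exact: deriveM.
    rewrite mulf_eq0 expf_eq0 /= => /orP[/eqP ->|]; first by rewrite mul0r addr0.
    rewrite psumr_eq0; last by move=> b _; exact: sqr_ge0.
    move=> /allP /(_ a (mem_index_enum a)); rewrite /= expf_eq0 /= => /eqP ->.
    by rewrite mulr0 addr0.
have e0 : e ^+ 2 = 0.
  apply: (integrable_cst0 n0); apply: rint_ae_eq u4i; first exact: measurable_cst.
  by apply: filterS ve => x <-; rewrite /v -expr2 -exprM.
apply: filterS ve => x; move: e0 => /eqP; rewrite expf_eq0 /= => /eqP ->.
by rewrite /v => /eqP; rewrite mulf_eq0 orbb => /eqP.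
Qed.

(** The mollifications of w are smooth, harmonic and in L^4, so they vanish; and
    they converge weakly to w. *)
Lemma liouville_L4 w : (0 < n)%N -> Lint 4 w -> weakly_harmonic w ->
  {ae mu, forall x, w x = 0}.
Proof.
move=> n0 w4 hw; have wl := Lint_Lploc w4.
have w1 : Lploc 1 w by apply: Lploc_le wl => //; rewrite ler1n.
suff u0 k : {ae mu, forall x, moll (mollifier k) w x = 0}.
  apply: fundamental_lemma => // zeta tz.
  have h := moll_cvg w1 (test_cts tz) (test_csupp tz).
  have l0 : (fun _ : nat => 0 : R) k @[k --> \oo] --> (0 : R) by exact: cvg_cst.
  rewrite (_ : (fun k => _) = fun _ : nat => 0 : R) in h; first exact: (cvg_unique _ h l0).
  apply/funext => k; transitivity (\int[mu]_x (0 : R)); last exact: Rint0.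
  by apply: Rintegral_ae; apply: filterS (u0 k) => x /= ->; rewrite mul0r.
have tm := @mollifier_test R n k.
set u := moll (mollifier k) w.
have uC : C1 u := C1_moll tm w1.
have duC a : C1 ('D_('e_a) u).
  by rewrite /u (derive_moll 'e_a tm w1); exact: C1_moll (test_derive _ tm) w1.
have hu x : \sum_a 'D_('e_a) ('D_('e_a) u) x = 0 by exact: moll_harmonic.
have [mu_ u4] : Lint 4 u := Lint_moll k w4.
have u4i : mu.-integrable setT (EFin \o (fun x => u x ^+ 4)).
  apply: eq_integrable u4 => // x _ /=.
  by rewrite powR_mulrn// -normrX ger0_norm// (exprM _ 2 2) sqr_ge0.
exact: smooth_liouville_L4.
Qed.

End liouville_L4.

(** * Symmetry of second derivatives *)
Section second_derivatives.
Context {R : realType} {n : nat}.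
Local Notation Rn := 'rV[R]_n.

(** The mean value theorem, first for f(y + h b) - f(y) in direction a. *)
Lemma second_difference (f : Rn -> R) (z a b : Rn) (h : R) : smooth_on setT f ->
  exists s t : R, [/\ `|s| <= `|h|, `|t| <= `|h| &
    f (z + h *: a + h *: b) - f (z + h *: a) - (f (z + h *: b) - f z) =
    h * (h * 'D_b ('D_a f) (z + s *: a + t *: b))].
Proof.
move=> sf.
have sh (c : Rn) : smooth_on setT (fun y => f (c + 1 *: y)) := (smooth_comp_affine c 1 sf).1.
have hE : (fun y : Rn => f (y + h *: b)) = (fun y => f (h *: b + 1 *: y)).
  by apply/funext => y; rewrite scale1r addrC.
pose F (y : Rn) := f (y + h *: b) - f y.
have df y v : derivable f y v by exact: (smooth_on_derivable sf).
have dfh y v : derivable (fun y : Rn => f (y + h *: b)) y v.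
  by rewrite hE; exact: (smooth_on_derivable (sh _)).
have dF y : derivable F y a by apply: derivableB.
have [s [sh1 E1]] := @mean_value_line R n F z a h (fun s _ => dF _).
have sdf : smooth_on setT ('D_a f) by exact: smooth_on_derive.
have ddf y : derivable ('D_a f) y b by exact: (smooth_on_derivable sdf).
have [t [th E2]] := @mean_value_line R n ('D_a f) (z + s *: a) b h (fun t _ => ddf _).
exists s, t; split; [exact: sh1|exact: th|rewrite -E2].
transitivity (F (z + h *: a) - F z); first by [].
rewrite E1; congr (_ * _).
apply: etrans (deriveB (dfh _ _) (df _ _)) _; congr (_ - _).
rewrite hE (smooth_comp_affine (h *: b) 1 sf).2 mul1r scale1r.
by congr ('D_a f _); rewrite addrC.
Qed.

(** The second difference is symmetric in a and b. *)
Lemma derive_comm (f : Rn -> R) (a b z : Rn) : smooth_on setT f ->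
  'D_b ('D_a f) z = 'D_a ('D_b f) z.
Proof.
move=> sf; have sab : smooth_on setT ('D_b ('D_a f)) by do 2 apply: smooth_on_derive.
have sba : smooth_on setT ('D_a ('D_b f)) by do 2 apply: smooth_on_derive.
pose h (k : nat) : R := k.+1%:R^-1.
have h0 k : h k != 0 by rewrite invr_eq0 pnatr_eq0.
have h_cvg : h k @[k --> \oo] --> (0 : R) by exact: cvg_harmonic.
have /choice[p pP] : forall k, exists p : R * R * (R * R),
    [/\ `|p.1.1| <= `|h k|, `|p.1.2| <= `|h k|, `|p.2.1| <= `|h k|, `|p.2.2| <= `|h k| &
    'D_b ('D_a f) (z + p.1.1 *: a + p.1.2 *: b) = 'D_a ('D_b f) (z + p.2.1 *: b + p.2.2 *: a)].
  move=> k; have [s [t [sh th E1]]] := second_difference z a b (h k) sf.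
  have [s' [t' [sh' th' E2]]] := second_difference z b a (h k) sf.
  exists ((s, t), (s', t')); split; [exact: sh|exact: th|exact: sh'|exact: th'|].
  change ('D_b ('D_a f) (z + s *: a + t *: b) = 'D_a ('D_b f) (z + s' *: b + t' *: a)).
  apply: (mulfI (h0 k)); apply: (mulfI (h0 k)).
  have comm (x1 x2 x3 x4 : R) : x1 - x2 - (x3 - x4) = x1 - x3 - (x2 - x4).
    by rewrite !opprB addrACA [RHS]addrACA (addrC (- x2)).
  apply: etrans (esym E1) _; apply: etrans _ E2.
  by rewrite (addrAC z (h k *: b)); exact: comm.
have small (s : nat -> R) : (forall k, `|s k| <= `|h k|) -> s k @[k --> \oo] --> (0 : R).
  move=> sh; apply/cvgr0Pnorm_lt => e e0.
  have /cvgr0Pnorm_lt/(_ e e0) := h_cvg.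
  by apply: filterS => k; exact: le_lt_trans.
have pt (s t : nat -> R) (u v : Rn) : (forall k, `|s k| <= `|h k|) ->
    (forall k, `|t k| <= `|h k|) -> (z + s k *: u + t k *: v) @[k --> \oo] --> z.
  move=> /small s0 /small t0; rewrite -[X in _ --> X]addr0 -(scale0r v).
  rewrite -[X in _ --> X + _]addr0 -[X in _ --> _ + X + _](scale0r u).
  apply: cvgD; last exact: cvgZl.
  by apply: cvgD; [exact: cvg_cst|exact: cvgZl].
have l1 : 'D_b ('D_a f) (z + (p k).1.1 *: a + (p k).1.2 *: b) @[k --> \oo] --> 'D_b ('D_a f) z.
  apply: (@cvg_comp _ _ _ (fun k => z + (p k).1.1 *: a + (p k).1.2 *: b) ('D_b ('D_a f)) _ _ _ (pt _ _ _ _ _ _)).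
  - by move=> k; case: (pP k).
  - by move=> k; case: (pP k).
  - exact: (sab [::] z I).1.
have l2 : 'D_a ('D_b f) (z + (p k).2.1 *: b + (p k).2.2 *: a) @[k --> \oo] --> 'D_a ('D_b f) z.
  apply: (@cvg_comp _ _ _ (fun k => z + (p k).2.1 *: b + (p k).2.2 *: a) ('D_a ('D_b f)) _ _ _ (pt _ _ _ _ _ _)).
  - by move=> k; case: (pP k).
  - by move=> k; case: (pP k).
  - exact: (sba [::] z I).1.
rewrite (_ : (fun k => 'D_b ('D_a f) _) = (fun k => 'D_a ('D_b f) (z + (p k).2.1 *: b + (p k).2.2 *: a))) in l1.
  exact: (cvg_unique _ l1 l2).
by apply/funext => k; case: (pP k).
Qed.

End second_derivatives.

(** * Spinor fields over a constant map *)
Section conclusion.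
Context {R : realType} {n K L d : nat}.
Local Notation Rn := 'rV[R]_n.
Local Notation RK := 'rV[R]_K.
Local Notation mu := (@lebesgue_rV R n).
Local Notation spinor := 'M[R[i]]_(L, K).
Context (E : 'I_n -> 'M[R[i]]_L) (N : set RK) (phi : Rn -> RK) (psi : Rn -> spinor).
Context (A : 'I_n -> Rn -> RK) (dpsi : 'I_n -> Rn -> spinor).
Hypotheses (sN : submanifold d N) (wdh : weakly_dirac_harmonic E N phi psi).
Hypotheses (phiA : forall a i, is_wderiv a (fun x => phi x 0 i) (fun x => A a x 0 i)).
Hypotheses (A2 : forall a i, Lint 2 (fun x => A a x 0 i)).
Hypotheses (psid : forall a, is_spinor_wderiv a psi (dpsi a)).
Hypotheses (psi4 : spinor_Lint 4 psi) (dpsi43 : forall a, spinor_Lint (4 / 3) (dpsi a)).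

Lemma constant_of_energy0 : \int[mu]_x (\sum_a \sum_i A a x 0 i ^+ 2) = 0 ->
  exists c, {ae mu, forall x, phi x = c}.
Proof.
move=> E0; have Ei := rint_map_energy A2.
have sq0 x : 0 <= \sum_a \sum_i A a x 0 i ^+ 2.
  by apply: sumr_ge0 => a _; apply: sumr_ge0 => i _; exact: sqr_ge0.
have Ae : {ae mu, forall x, \sum_a \sum_i A a x 0 i ^+ 2 = 0}.
  apply: integral_eq0_ae; [exact: (rint_meas Ei)|exact: sq0|].
  by rewrite Rint_EFin// E0.
have A0 a i : {ae mu, forall x, A a x 0 i = 0}.
  apply: filterS Ae => x /eqP.
  rewrite psumr_eq0; last by move=> b _; apply: sumr_ge0 => j _; exact: sqr_ge0.
  move=> /allP /(_ a (mem_index_enum a)) /=.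
  rewrite psumr_eq0; last by move=> j _; exact: sqr_ge0.
  by move=> /allP /(_ i (mem_index_enum i)) /=; rewrite sqrf_eq0 => /eqP.
have [[phi1 _] _ _] := wdh.
have phiL i : Lploc 1 (fun x => phi x 0 i).
  by apply: Lploc_le (phi1 i).1 => //; rewrite ler1n.
have /choice[c cP] : forall i, exists c : R, {ae mu, forall x, phi x 0 i = c}.
  move=> i; apply: (wderiv0_cst _ (phiL i)) => a.
  apply: is_wderiv_ae (phiA a i); [exact: (phiL i).1|exact: measurable_cst|by apply: nearW|exact: A0].
exists (\row_i c i).
have : {ae mu, forall x, forall i, phi x 0 i = c i} by apply: filter_forall.
by apply: filterS => x h; apply/rowP => i; rewrite mxE h.
Qed.

Context (c : RK).
Hypotheses (phic : {ae mu, forall x, phi x = c}) (cE : clifford_module E).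

(** The equation is tested with zeta S.  Skewness and integration by parts make
    both of its terms equal. *)
Lemma constant_spinor_equation (S : spinor) (zeta : Rn -> R) :
  (forall nu, normal N c nu -> S *m (complexify nu)^T = 0) -> test_function zeta ->
  \sum_a \int[mu]_x (ip (psi x) (E a *m S) * 'D_('e_a) zeta x) = 0.
Proof.
move=> tS tz.
pose xi x := ((zeta x)%:C)%C *: S.
pose dxi a x := (('D_('e_a) zeta x)%:C)%C *: S.
have [M eM] := test_csupp tz.
have p40 : (0 : R) < 4 by [].
have p430 : (0 : R) < 4 / 3 by rewrite divr_gt0.
have cut p (eta : Rn -> R) : 0 < p -> test_function eta ->
    spinor_Lint p (fun x => ((eta x)%:C)%C *: S).
  move=> p0 te b s i; under eq_fun do rewrite mxE partZ.
  apply: (@Lint_cutoff _ _ p (fun=> part b (S s i))) => //; apply: Lploc_cts.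
    exact: ltW.
  exact: cts_cst.
have dxiE a : is_spinor_wderiv a xi (dxi a).
  move=> b s i; under eq_fun do rewrite mxE partZ.
  under [X in is_wderiv _ _ X]eq_fun do rewrite mxE partZ.
  have h := is_wderivZ (part b (S s i)) (is_wderiv_C1 a (test_C1 tz)).
  by under eq_fun do rewrite mulrC; under [X in is_wderiv _ _ X]eq_fun do rewrite mulrC.
pose D := [set x : Rn | `|x| <= M].
have zD x : ~ D x -> M < `|x| by move=> /negP; rewrite -ltNge.
have cD : compact D by exact: compact_ball_norm.
have h0 : \int[mu]_(x in D) (\sum_a ip (xi x) (E a *m dpsi a x) +
     \sum_a ip (psi x) (E a *m dxi a x)) = 0.
  apply: (weak_equation sN wdh phiA A2 psid psi4 dpsi43 cD _ _ _ dxiE).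
  - by move=> x /zD/eM ex; rewrite /xi ex scale0r.
  - exact: cut.
  - by move=> a; apply: cut => //; exact: test_derive.
  - by apply: filterS phic => x -> nu Nnu; rewrite -scalemxAl tS// scaler0.
pose f a x := ip (psi x) (E a *m S).
pose f' a x := ip (dpsi a x) (E a *m S).
have wf a : is_wderiv a (f a) (f' a) by exact: spinor_wderiv_ip.
have f1 a : Lploc 1 (f a) by case: (wf a).
have f'1 a : Lploc 1 (f' a) by case: (wf a).
have E1 x : \sum_a ip (xi x) (E a *m dpsi a x) + \sum_a ip (psi x) (E a *m dxi a x) =
    \sum_a (f a x * 'D_('e_a) zeta x + -1 * (f' a x * zeta x)).
  rewrite addrC -big_split; apply: eq_bigr => a _ /=.
  rewrite /xi /dxi -!scalemxAr ipZl ipZr /f /f' mulrC mulN1r; congr (_ + _).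
  by rewrite ipC (ip_skew cE) mulrN mulrC.
move: h0; under eq_Rintegral do rewrite E1.
rewrite -Rint_supp; last first.
  by move=> x /zD Mx; apply: big1 => a _; rewrite (derive_supp _ eM Mx) (eM _ Mx) !mulr0 addr0.
have i1 a := rint_test (f1 a) (test_derive 'e_a tz).
have i2 a := rint_test (f'1 a) tz.
rewrite Rint_sum; last by move=> a; apply: rintD; [exact: i1|exact/rintZ/i2].
have two a : \int[mu]_x (f a x * 'D_('e_a) zeta x + -1 * (f' a x * zeta x)) =
    2 * \int[mu]_x (f a x * 'D_('e_a) zeta x).
  rewrite (RintegralD measurableT (i1 a) (rintZ (-1) (i2 a))).
  rewrite (RintegralZl (-1) measurableT (i2 a)).
  by have [_ _ wz] := wf a; rewrite mulN1r -wz// -mulr2n mulr_natl.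
rewrite (eq_bigr _ (fun a _ => two a)) -mulr_sumr => /eqP.
by rewrite mulf_eq0 pnatr_eq0 /= => /eqP.
Qed.

(** The Laplacian as the symmetric part of the square of the Dirac operator. *)
Let clifford_trace (X : 'I_n -> 'I_n -> R) (Y : 'I_n -> R) : \sum_b \sum_a X a b = 0 ->
  (forall a b, X a b + X b a = - (2 *+ (a == b)) * Y a) -> \sum_a Y a = 0.
Proof.
move=> X0 XY.
have : \sum_b \sum_a (X a b + X b a) = 0.
  under eq_bigr do rewrite big_split /=.
  by rewrite big_split /= X0 exchange_big /= X0 addr0.
under eq_bigr => b _.
  under eq_bigr do rewrite XY.
  rewrite (bigD1 b)//= eqxx big1 ?addr0; last first.
    by move=> a /negPf ->; rewrite mulr0n oppr0 mul0r.
over.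
rewrite -mulr_sumr => /eqP; rewrite mulf_eq0 oppr_eq0 pnatr_eq0 /= => /eqP.
exact.
Qed.

(** The preceding equation for the test function D_b zeta and the constant spinor
    e_b o S, summed over b: second derivatives commute, so only the symmetric part of
    e_a o e_b o S remains, and the Clifford relations identify it. *)
Lemma spinor_weakly_harmonic (S : spinor) :
  (forall nu, normal N c nu -> S *m (complexify nu)^T = 0) ->
  weakly_harmonic (fun x => ip (psi x) S).
Proof.
move=> tS zeta tz.
have psiL T : Lploc 1 (fun x => ip (psi x) T).
  by apply: Lploc_le (Lint_Lploc (Lint_ip T _ psi4)) => //; rewrite ler1n.
have td a b : test_function ('D_('e_a) ('D_('e_b) zeta)) by do 2 apply: test_derive.
have int T a b := rint_test (psiL T) (td a b).
pose X a b := \int[mu]_x (ip (psi x) (E a *m (E b *m S)) * 'D_('e_a) ('D_('e_b) zeta) x).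
have X0 : \sum_b \sum_a X a b = 0.
  apply: big1 => b _; apply: constant_spinor_equation; last exact: test_derive.
  by move=> nu Nnu; rewrite -mulmxA tS// mulmx0.
pose Y a := \int[mu]_x (ip (psi x) S * 'D_('e_a) ('D_('e_a) zeta) x).
have diag (a b : 'I_n) (x y : R) : (a = b -> x = y) -> - (2 *+ (a == b)) * x = - (2 *+ (a == b)) * y.
  by case: eqVneq => [ab ->//|_ _]; rewrite mulr0n oppr0 !mul0r.
have XX a b : X a b + X b a = - (2 *+ (a == b)) * Y a.
  rewrite /X; under [X in _ + X]eq_Rintegral do rewrite (derive_comm _ _ _ tz.1).
  rewrite -RintegralD//; [|exact: int..].
  under eq_Rintegral do rewrite -mulrDl -ipDr (clifford_anticomm cE) ipZr -mulrA.
  rewrite (RintegralZl _ measurableT (int S a b)).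
  apply: diag => ab; by rewrite /Y ab.
have Y0 := clifford_trace X0 XX.
under eq_Rintegral do rewrite mulr_sumr.
by rewrite Rint_sum//; move=> a; exact: int.
Qed.

Lemma normal_tangent_proj (p nu : RK) : N p -> normal N p nu -> nu *m tangent_proj N p = 0.
Proof.
move=> Np Nnu; have [PT PP tP] := tangent_projP sN Np.
apply: row_norm2_eq0.
have := Nnu (nu *m tangent_proj N p); rewrite !trmx_mul PT => h.
rewrite mulmxA -(mulmxA nu) PP -mulmxA; apply: h.
by apply/tP; rewrite -mulmxA PP.
Qed.

(** As psi is tangential, its real coordinates are the pairings of psi with the
    projections of the unit spinors to the tangent space at c. *)
Lemma spinor_vanishes : (0 < n)%N -> N c -> {ae mu, forall x, psi x = 0}.
Proof.
move=> n0 Nc; have [PT PP _] := tangent_projP sN Nc.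
pose T b s i : spinor := unit_spinor b s i *m complexify (tangent_proj N c).
have tT b s i nu : normal N c nu -> T b s i *m (complexify nu)^T = 0.
  move=> Nnu; rewrite /T /complexify map_trmx -mulmxA -map_mxM/=.
  rewrite (_ : tangent_proj N c *m nu^T = 0) ?map_mx0 ?mulmx0//.
  by apply: trmx_inj; rewrite trmx_mul trmxK PT normal_tangent_proj// trmx0.
have [_ [_ tpsi] _] := wdh.
have h1 : {ae mu, forall x, forall b s i, ip (psi x) (T b s i) = 0}.
  apply: filter_forall => b; apply: filter_forall => s; apply: filter_forall => i.
  apply: (@liouville_L4 R n (fun x => ip (psi x) (T b s i)) n0).
    by apply: (Lint_ip _ _ psi4).
  exact: (spinor_weakly_harmonic (@tT b s i)).
apply: filterS3 h1 phic tpsi => x h phix tx; rewrite phix in tx.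
have Px := tangent_proj_spinor sN Nc tx.
apply/matrixP => s i; rewrite mxE; apply: part_inj => b.
by rewrite part0 -ip_unit_spinor -Px -{1}PT -ip_mulr; exact: h.
Qed.

End conclusion.

(** * Integrability from finite energy *)
Section finite_energy_bounds.
Context {R : realType} {n K L : nat}.
Local Notation Rn := 'rV[R]_n.
Local Notation RK := 'rV[R]_K.
Local Notation mu := (@lebesgue_rV R n).
Local Notation spinor := 'M[R[i]]_(L, K).
Implicit Types (phi : Rn -> RK) (psi : Rn -> spinor).

Lemma Lint_dominated (p : R) (f g : Rn -> R) : measurable_fun setT f ->
  (forall x, `|f x| `^ p <= g x) -> (\int[mu]_x (g x)%:E < +oo)%E -> Lint p f.
Proof.
move=> mf fg gi; split; first exact: mf.
apply/integrableP; split; first by apply/measurable_EFinP; exact: measurable_powR_norm.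
apply: le_lt_trans gi; apply: ge0_integral_le => // x.
by rewrite /= lee_fin ger0_norm ?powR_ge0//; exact: fg.
Qed.

Lemma part_le_spinor_norm (u : spinor) b s i : `|part b (u s i)| <= spinor_norm u.
Proof. by rewrite -sqrtr_sqr; apply: ler_wsqrtr; exact: ip_coord_le. Qed.

Lemma spinor_norm_le_deriv_norm psi a x : spinor_norm (spinor_deriv a psi x) <= spinor_deriv_norm psi x.
Proof.
rewrite -[leLHS]ger0_norm ?sqrtr_ge0// -sqrtr_sqr; apply: ler_wsqrtr.
by rewrite (bigD1 a)//= lerDl; apply: sumr_ge0 => b _; exact: sqr_ge0.
Qed.

Let square_le_sum (F : 'I_n -> 'I_K -> R) a i : F a i ^+ 2 <= \sum_a \sum_i F a i ^+ 2.
Proof.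
have F0 b : 0 <= \sum_i F b i ^+ 2 by apply: sumr_ge0 => j _; exact: sqr_ge0.
apply: (@le_trans _ _ (\sum_i F a i ^+ 2)).
  by rewrite (bigD1 i)//= lerDl sumr_ge0// => j _; exact: sqr_ge0.
by rewrite [leRHS](bigD1 a)//= lerDl sumr_ge0.
Qed.

Lemma finite_energy_Lint N phi psi : H1loc N phi -> S14loc N phi psi -> finite_energy phi psi ->
  [/\ forall a i, is_wderiv a (fun x => phi x 0 i) (fun x => map_deriv a phi x 0 i),
      forall a i, Lint 2 (fun x => map_deriv a phi x 0 i),
      forall a, is_spinor_wderiv a psi (spinor_deriv a psi),
      spinor_Lint 4 psi & forall a, spinor_Lint (4 / 3) (spinor_deriv a psi)].
Proof.
move=> [phi1 _] [psi1 _] fe.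
have wphi a i : is_wderiv a (fun x => phi x 0 i) (fun x => map_deriv a phi x 0 i).
  have [_ /(_ a)[g fg _]] := phi1 i.
  under [X in is_wderiv _ _ X]eq_fun do rewrite mxE.
  exact: is_wderiv_wderiv fg.
have spsi b s i : sobolev_loc 4 (4 / 3) (fun x : Rn => part b (psi x s i)).
  by have [h1 h2] := psi1 s i; case: b.
have wpsi a : is_spinor_wderiv a psi (spinor_deriv a psi).
  move=> b s i; have [_ /(_ a)[g fg _]] := spsi b s i.
  rewrite (_ : (fun x => part b (spinor_deriv a psi x s i)) = wderiv a (fun x => part b (psi x s i))).
    exact: is_wderiv_wderiv fg.
  by apply/funext => x; rewrite mxE; case: b {fg}.
have sq0 x a : 0 <= \sum_i (map_deriv a phi x 0 i) ^+ 2.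
  by apply: sumr_ge0 => i _; exact: sqr_ge0.
have me0 x : 0 <= map_energy phi x by apply: sumr_ge0 => a _; exact: sq0.
have dn0 x : 0 <= spinor_deriv_norm psi x `^ (4 / 3) by exact: powR_ge0.
have sn0 x : 0 <= spinor_norm (psi x) ^+ 4 by rewrite exprn_ge0// sqrtr_ge0.
split; [exact: wphi| |exact: wpsi| |].
- move=> a i; apply: (Lint_dominated _ _ fe); first by have [_ [h _] _] := wphi a i.
  move=> x; rewrite powR_mulrn// real_normK ?num_real//.
  apply: (@le_trans _ _ (map_energy phi x)); last by rewrite -addrA lerDl addr_ge0.
  exact: (square_le_sum (fun a i => map_deriv a phi x 0 i)).
- move=> b s i; apply: (Lint_dominated _ _ fe); first by case: (spsi b s i) => -[].
  move=> x; rewrite powR_mulrn//.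
  apply: (@le_trans _ _ (spinor_norm (psi x) ^+ 4)); last by rewrite lerDr addr_ge0.
  by apply: lerXn2r; rewrite ?nnegrE ?sqrtr_ge0//; exact: part_le_spinor_norm.
- move=> a b s i; apply: (Lint_dominated _ _ fe); first by have [_ [h _] _] := wpsi a b s i.
  move=> x; apply: (@le_trans _ _ (spinor_deriv_norm psi x `^ (4 / 3))).
    apply: ge0_ler_powR; rewrite ?nnegrE ?divr_ge0 ?sqrtr_ge0//.
    exact: le_trans (part_le_spinor_norm _ _ _ _) (spinor_norm_le_deriv_norm _ _ _).
  by rewrite addrAC lerDr addr_ge0.
Qed.

End finite_energy_bounds.

(** * Stationary Dirac-harmonic maps of finite energy *)

Theorem theorem1p7 (R : realType) (n K d : nat)
    (E : 'I_n -> 'M[R[i]]_(2 ^ n./2)) (N : set 'rV[R]_K)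
    (phi : 'rV[R]_n -> 'rV[R]_K)
    (psi : 'rV[R]_n -> 'M[R[i]]_(2 ^ n./2, K)) :
  (3 <= n)%N ->
  clifford_module E ->
  submanifold d N -> compact N ->
  stationary_dirac_harmonic E N phi psi ->
  finite_energy phi psi ->
  (exists c, {ae @lebesgue_rV R n, forall x, phi x = c}) /\
  {ae @lebesgue_rV R n, forall x, psi x = 0}.
Proof.
move=> n3 cE sN _ sdh fe; have [wdh _] := sdh; have [phi1 psi1 _] := wdh.
have n0 : (0 < n)%N by exact: leq_trans n3.
have [wphi A2 wpsi psi4 dpsi43] := finite_energy_Lint phi1 psi1 fe.
have e0 := energy_zero sN sdh wphi A2 wpsi psi4 dpsi43 cE n3.
have [c phic] := constant_of_energy0 wdh wphi A2 e0.
split; first by exists c.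
(* Otherwise the whole space is a null set, and constants are integrable. *)
have Nc : N c.
  apply: contrapT => Nc.
  have F : {ae @lebesgue_rV R n, forall x : 'rV[R]_n, False}.
    by apply: filterS2 phic phi1.2 => x ->.
  have : (1 : R) = 0.
    apply: (integrable_cst0 n0).
    apply: (rint_ae_eq (f := fun=> 0)); [exact: measurable_cst|by apply: filterS F|exact: rint0].
  by move/eqP; rewrite oner_eq0.
exact: (spinor_vanishes sN wdh wphi A2 wpsi psi4 dpsi43 phic cE n0 Nc).
Qed.
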